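(* Assume the standing setting, Assumption (A), and let $R\in(R_0,R_1]$. Let $n\ge1$. If $\varphi\in C^{2n+1}(B(0,R))$ and $f\in C^{2n+2}(B(0,R))$, then for every $\gamma'<\gamma$ there is a polynomial $P$ (coefficients depending only on $n,d,\gamma,\gamma'$) such that for all $t\ge0$ $$\sup_{x\in B(0,R)}|u_n(x,t)-\varphi_n|\le P\big(\|\varphi\|_{C^{2n+1}(B(0,R))},\|f\|_{C^{2n+2}(B(0,R))},\|\Sigma\|_{C^{2n-1}(B(0,R))}\big)e^{-\gamma' t},$$ where $\varphi_n:=\int_0^\infty(\mathcal{L}_2u_{n-1})(0,s)\,ds$ (a finite number). Moreover, if $\varphi\in C^{k+2n}(B(0,R))$ and $f\in C^{k+1+2n}(B(0,R))$ for some $k\ge1$, then for every $\gamma''<\gamma$ there is a polynomial $P$ (coefficients depending only on $n,k,d,\gamma,\gamma''$) such that for all $t\ge0$ $$\sup_{J\in I_k}\sup_{x\in B(0,R)}|\partial^Ju_n(x,t)|\le P\big(\|\varphi\|_{C^{k+2n}(B(0,R))},\|f\|_{C^{k+1+2n}(B(0,R))},\|\Sigma\|_{C^{k+2n-2}(B(0,R))}\big)e^{-\gamma''t}.$$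
   Context: Standing setting: $\Xi$ is a finite set, $\xi$ a random variable in $\Xi$; for each $\xi$, $f(\cdot;\xi):\mathbb{R}^d\to\mathbb{R}$ is $C^3$ and $f$ satisfies $\mathbb{E}_\xi[\nabla f(x;\xi)]=\nabla f(x)$. $B(0,R)$ is the Euclidean ball of radius $R$ about $0$. Assumption (A): $0$ is a local minimum of $f$; there are $\gamma>0,b>0,R_1>0$ with (1) each $f(\cdot;\xi)-\frac{\gamma}{2}\|\cdot\|^2$ convex on $B(0,R_1)$; (2) $\sup_\xi\|\nabla f(0;\xi)\|\le b$; and $R_1>R_0:=\frac{16b}{3\gamma}$. Operators: $\mathcal{L}_1=-\nabla f\cdot\nabla$ and $\mathcal{L}_2=-\frac14\nabla\|\nabla f\|^2\cdot\nabla+\frac12\mathrm{Tr}(\Sigma\nabla^2)$, where $\Sigma(x)=\mathbb{E}_\xi[(\nabla f(x;\xi)-\nabla f(x))(\nabla f(x;\xi)-\nabla f(x))^{T}]$. Coefficient functions: for $x\in B(0,R)$ let $y_x(t)$ solve $\dot y=-\nabla f(y)$, $y(0)=x$ (it stays in $B(0,R)$). Define $u_0(x,t)=\varphi(y_x(t))$ and, for $n\ge1$, $u_n(x,t)=\int_0^t(\mathcal{L}_2u_{n-1})(y_x(s),t-s)\,ds$; equivalently $\partial_tu_0=\mathcal{L}_1u_0$, $u_0(\cdot,0)=\varphi$, and $\partial_tu_n=\mathcal{L}_1u_n+\mathcal{L}_2u_{n-1}$, $u_n(\cdot,0)=0$. Notation: $I_k=\{J=(j_1,\dots,j_k):1\le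 j_i\le d\}$, $\partial^J=\partial_{j_1}\cdots\partial_{j_k}$; $\|g\|_{C^k(B)}=\max_{|\alpha|\le k}\sup_B|\partial^\alpha g|$ (for matrix-valued $\Sigma$, entrywise). *)

(* Defs.v *)
From mathcomp Require Import all_boot all_order all_algebra.
From mathcomp Require Import all_classical all_reals all_analysis.

Set Implicit Arguments.
Unset Strict Implicit.
Unset Printing Implicit Defensive.

Import Order.TTheory GRing.Theory Num.Theory.
Import numFieldNormedType.Exports.
Local Open Scope classical_set_scope.
Local Open Scope ring_scope.

Section Defs.
Variables (R : realType) (d : nat).
Local Notation V := 'rV[R]_d.

Definition ej (j : 'I_d) : V := delta_mx 0 j.

Definition sqnorm (x : V) : R := \sum_(i < d) (x 0 i) ^+ 2.
Definition enorm (x : V) : R := Num.sqrt (sqnorm x).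
Definition eball (r : R) : set V := [set x | enorm x < r].

Definition pd (j : 'I_d) (g : V -> R) : V -> R := fun x => 'D_(ej j) g x.
Definition pder (J : seq 'I_d) (g : V -> R) : V -> R := foldr pd g J.
Definition grad (g : V -> R) (x : V) : V := \row_(j < d) pd j g x.

Definition Ck (k : nat) (U : set V) (g : V -> R) : Prop :=
  (forall (J : seq 'I_d) (j : 'I_d) (x : V), (size J < k)%N -> U x ->
      derivable (pder J g) x (ej j)) /\
  (forall (J : seq 'I_d) (x : V), (size J <= k)%N -> U x ->
      {for x, continuous (pder J g)}).

Definition Ck_bounded (k : nat) (U : set V) (g : V -> R) : Prop :=
  exists M : R, forall (J : seq 'I_d) (x : V), (size J <= k)%N -> U x ->
    `|pder J g x| <= M.

Definition Cnorm (k : nat) (U : set V) (g : V -> R) : R :=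
  sup [set r : R | exists (J : seq 'I_d) (x : V),
                     [/\ (size J <= k)%N, U x & r = `|pder J g x|]].

Definition is_prob (Xi : finType) (p : Xi -> R) : Prop :=
  (forall xi, 0 <= p xi) /\ \sum_(xi : Xi) p xi = 1.

Variables (Xi : finType) (p : Xi -> R) (f : V -> R) (fxi : Xi -> V -> R).

Definition Sig (i j : 'I_d) (x : V) : R :=
  \sum_(xi : Xi) p xi * ((pd i (fxi xi) x - pd i f x) * (pd j (fxi xi) x - pd j f x)).

Definition SigCnorm (k : nat) (U : set V) : R :=
  \big[Order.max/0]_(i < d) \big[Order.max/0]_(j < d) Cnorm k U (Sig i j).

Definition Sig_Ck (k : nat) (U : set V) : Prop :=
  forall i j, Ck k U (Sig i j) /\ Ck_bounded k U (Sig i j).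

Definition L2 (g : V -> R) (z : V) : R :=
  - (1 / 4) * \sum_(j < d) pd j (fun w => sqnorm (grad f w)) z * pd j g z
  + (1 / 2) * \sum_(i < d) \sum_(j < d) Sig i j z * pd i (pd j g) z.

Definition assumption_A (gamma b R1 : R) : Prop :=
  [/\ is_prob p,
      forall xi, Ck 3 setT (fxi xi),
      forall x j, derivable f x (ej j) /\
                  pd j f x = \sum_(xi : Xi) p xi * pd j (fxi xi) x,
      (exists2 e : R, 0 < e & forall x, enorm x < e -> f 0 <= f x) &
      [/\ 0 < gamma, 0 < b,
          forall xi (x y : V) (l : R), eball R1 x -> eball R1 y -> 0 <= l <= 1 ->
            (let g := fun z => fxi xi z - gamma / 2 * sqnorm z in
             g (l *: x + (1 - l) *: y) <= l * g x + (1 - l) * g y),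
          forall xi, enorm (grad (fxi xi) 0) <= b &
          16 * b / (3 * gamma) < R1]].

Definition is_flow (r : R) (y : V -> R -> V) : Prop :=
  forall x, eball r x ->
    [/\ y x 0 = x,
        (y x) @ at_right 0 --> x &
        forall t : R, 0 < t -> is_derive t 1 (y x) (- grad f (y x t))].

Variables (phi : V -> R) (y : V -> R -> V).

Fixpoint u (n : nat) : V -> R -> R :=
  match n with
  | 0 => fun x t => phi (y x t)
  | n'.+1 => fun x t =>
      Rintegral lebesgue_measure `[0, t] (fun s => L2 (fun z => u n' z (t - s)) (y x s))
  end.

End Defs.

Definition poly3 (R : realType) := seq (R * (nat * nat * nat)).
Definition eval3 (R : realType) (P : poly3 R) (a b c : R) : R :=
  \sum_(m <- P) m.1 * a ^+ m.2.1.1 * b ^+ m.2.1.2 * c ^+ m.2.2.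

Arguments ej {R d} j.

(* Main.v *)
(* A small difference w of two solutions of y' = - grad f(y), or of a linear
   equation w' = - A w + b with A >= gamma, satisfies an energy estimate, hence
   decays like e^(- lambda t) for every lambda < gamma. Applied to difference
   quotients in the initial point, the estimate shows that they are Cauchy,
   uniformly on bounded time intervals, so the flow is differentiable in x and its
   partial derivatives solve the linearized equation, again of the form
   w' = - A w + b. Iterating gives all partial derivatives of the flow with bounds
   C N^q e^(- lambda t), where N = 1 + |phi| + |f| + |Sigma| and C, q are uniform.
   The integral defining u_(n+1) solves such an equation with A = 0, which
   propagates the bounds from u_n to u_(n+1) with an arbitrarily small loss in
   lambda and a loss of two derivatives. Since the flow fixes 0, u_(n+1)(0, t) is
   the integral over [0, t] of (L_2 u_n)(0, s), whose tail decays exponentially,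
   and |u_(n+1)(x, t) - u_(n+1)(0, t)| is controlled by the first derivatives.
   Strong convexity bounds the radius of the ball by a multiple of N. *)

(* The coefficients of the polynomial must be fixed before the data, so every decay statement
   concerns families indexed by the type of all admissible data. Bounding growth by the norm of the
   Hessian would give constants exponential in |f|. Energy estimates use only the lower bound gamma
   on the quadratic form; |f| then enters through the forcing alone, hence polynomially. A forcing
   that decays at the rate of the homogeneous equation itself may create a factor t, so each
   estimate gives up a little of the rate; quantifying over all lambda < gamma absorbs this. Only
   derivatives of u_n decay, since u_n itself tends to a constant; this suffices because L_2 has no
   term of order zero. In the integral for u_(n+1), a derivative in x brings a factor e^(- lambda s)
   from the flow, which meets e^(- lambda (t - s)) from u_n: their product does not depend on s. The
   terminal time t is therefore frozen as a parameter and set equal to the upper limit only at the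
   end. *)
Require Import Defs.
From mathcomp Require Import all_boot all_order all_algebra.
From mathcomp Require Import all_classical all_reals all_analysis.
From mathcomp Require Import measurable_realfun ring lra zify.
Import Order.TTheory GRing.Theory Num.Theory.
Import numFieldNormedType.Exports.
Set Implicit Arguments.
Unset Strict Implicit.
Unset Printing Implicit Defensive.
Local Open Scope classical_set_scope.
Local Open Scope ring_scope.

(** * Energy estimates and linear differential equations *)

Section calculus.
Context {R : realType}.

Lemma cvg_bigsum {T : Type} {V : normedModType R} (F : set_system T) n
    (f : 'I_n -> T -> V) (l : 'I_n -> V) : Filter F ->
  (forall i, f i x @[x --> F] --> l i) ->
  \sum_(i < n) f i x @[x --> F] --> \sum_(i < n) l i.
Proof.
by move=> FF fl; apply: cvg_big => [|i _]; [exact: add_continuous|exact: fl].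
Qed.

Lemma ler_sum_ord n (a : 'I_n -> R) (b : R) :
  (forall i, a i <= b) -> \sum_(i < n) a i <= n%:R * b.
Proof.
move=> ab; apply: (@le_trans _ _ (\sum_(i < n) b)); first exact: ler_sum.
by rewrite sumr_const card_ord mulr_natl.
Qed.

Lemma is_derive_bigsum (V W : normedModType R) n (h : 'I_n -> V -> W)
    (x v : V) (dh : 'I_n -> W) :
  (forall i, is_derive x v (h i) (dh i)) ->
  is_derive x v (fun y => \sum_(i < n) h i y) (\sum_(i < n) dh i).
Proof.
move=> hd; have := @is_derive_sum _ V W n h x v dh hd.
by congr is_derive; apply/funext => y; rewrite fct_sumE.
Qed.

Lemma is_derive_add (V W : normedModType R) (f g : V -> W) (x v : V)
    (df dg : W) : is_derive x v f df -> is_derive x v g dg ->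
  is_derive x v (fun y => f y + g y) (df + dg).
Proof. exact: is_deriveD. Qed.

Lemma is_derive_sub (V W : normedModType R) (f g : V -> W) (x v : V)
    (df dg : W) : is_derive x v f df -> is_derive x v g dg ->
  is_derive x v (fun y => f y - g y) (df - dg).
Proof. exact: is_deriveB. Qed.

Lemma is_derive_addr (V W : normedModType R) (f : V -> W) (x v : V) (df c : W) :
  is_derive x v f df -> is_derive x v (fun y => f y + c) df.
Proof.
move=> fd; have := is_derive_add fd (is_derive_cst c x v).
by move=> /is_derive_eq; apply; rewrite addr0.
Qed.

Lemma is_derive_sqr (f : R -> R) (x df : R) :
  is_derive x 1 f df -> is_derive x 1 (fun y => f y ^+ 2) (2 * f x * df).
Proof.
move=> fd; have := @is_deriveM _ _ f f x 1 df df fd fd.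
have -> : f * f = (fun y => f y ^+ 2).
  by apply/funext => y; rewrite expr2.
by move=> /is_derive_eq; apply; rewrite /GRing.scale /=; ring.
Qed.

Lemma is_derive_mul (V : normedModType R) (f g : V -> R) (x v : V) (df dg : R) :
  is_derive x v f df -> is_derive x v g dg ->
  is_derive x v (fun y => f y * g y) (df * g x + f x * dg).
Proof.
move=> fd gd; have := @is_deriveM _ _ f g x v df dg fd gd.
by move=> /is_derive_eq; apply; rewrite /GRing.scale /=; ring.
Qed.

Lemma is_derive_expRM (a x : R) :
  is_derive x 1 (fun y : R => expR (a * y)) (a * expR (a * x)).
Proof.
have h : is_derive x 1 (fun y : R => a * y) a.
  have := @is_deriveZ _ _ _ id a x 1 1 (is_derive_id _ _).
  by move=> /is_derive_eq; apply; rewrite /GRing.scale /= mulr1.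
have := @is_derive1_comp _ expR (fun y : R => a * y) x _ _ (is_derive_expR _) h.
by move=> /is_derive_eq; apply; rewrite mulrC.
Qed.

Lemma derive_le0_le (f df : R -> R) (a b : R) : a <= b -> continuous f ->
  (forall t : R, a < t < b -> is_derive t 1 f (df t)) ->
  (forall t : R, a < t < b -> df t <= 0) -> f b <= f a.
Proof.
move=> ab fc fd df0.
have : f b - f a <= 0; last by rewrite subr_le0.
move: ab; rewrite le_eqVlt => /orP[/eqP -> | ltab]; first by rewrite subrr.
have fd' c : c \in `]a, b[%R -> is_derive c 1 f (df c) by rewrite in_itv => /fd.
have [c + ->] := MVT ltab fd' (continuous_subspaceT fc).
rewrite in_itv /= => cin.
by rewrite mulr_le0_ge0 ?df0 // subr_ge0 ltW.
Qed.

(** The velocity [v] is left unspecified so that the estimate serves linear equations as well as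
    differences of two solutions of a nonlinear one. The gap [mu - lam] pays for the forcing, whence
    the constant e^(1 / (mu - lam)); it does not depend on [T]. The end points are reached by
    continuity alone. *)
Lemma energy_estimate n (w v g : 'I_n -> R -> R) (T lam mu K2 : R) :
  (forall i, continuous (w i)) ->
  (forall i (t : R), 0 < t < T -> is_derive t 1 (w i) (v i t)) ->
  (forall t : R, 0 < t < T -> \sum_i w i t * v i t <=
     - lam * (\sum_i w i t ^+ 2) + \sum_i w i t * g i t) ->
  (forall t : R, 0 < t < T -> \sum_i g i t ^+ 2 <= K2 * expR (- (2 * mu) * t)) ->
  0 <= K2 -> lam < mu ->
  forall t : R, 0 <= t <= T -> \sum_i w i t ^+ 2 <=
    expR (mu - lam)^-1 * (\sum_i w i 0 ^+ 2 + K2) * expR (- (2 * lam) * t).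
Proof.
move=> wc wd ineq gb K20 lm t /andP[t0 tT].
pose e := mu - lam; have e0 : 0 < e by rewrite subr_gt0.
pose rho s := \sum_i w i s ^+ 2.
(* Solves E' = - e^(- e s) E and decreases from e^(1 / e) towards 1, because e^(- e s) has integral
   1 / e over the half-line. *)
pose E s := expR (e^-1 * expR (- e * s)).
(* psi is nonincreasing: by Young's inequality the forcing contributes at most
   e^(- e s) (e^(2 lam s) rho + K2), which the factor E absorbs. *)
pose psi s := (expR (2 * lam * s) * rho s + K2) * E s.
have rhoc : continuous rho.
  move=> s; apply: cvg_bigsum => i.
  by rewrite expr2; under eq_fun do rewrite expr2; apply: cvgM; exact: wc.
have expc a : continuous (fun s : R => expR (a * s)).
  move=> s; apply: continuous_comp; last exact: continuous_expR.
  exact: mulrl_continuous.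
have Ec : continuous E.
  move=> s; apply: continuous_comp; last exact: continuous_expR.
  by apply: continuous_comp; [exact: expc | exact: mulrl_continuous].
have psic : continuous psi.
  move=> s; apply: cvgM; last exact: Ec.
  by apply: cvgD; [apply: cvgM; [exact: expc | exact: rhoc] | exact: cvg_cst].
pose drho s := \sum_i 2 * w i s * v i s.
pose dpsi s := (2 * lam * expR (2 * lam * s) * rho s
   + expR (2 * lam * s) * drho s) * E s
   + (expR (2 * lam * s) * rho s + K2) * (- expR (- e * s) * E s).
have psid s : 0 < s < t -> is_derive s 1 psi (dpsi s).
  move=> /andP[s0 st]; apply: is_derive_mul.
    apply: is_derive_addr; apply: is_derive_mul; first exact: is_derive_expRM.
    apply: is_derive_bigsum => i; apply/is_derive_sqr/wd.
    by rewrite s0 (lt_le_trans st).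
  have h : is_derive s 1 (fun y => e^-1 * expR (- e * y)) (- expR (- e * s)).
    have := @is_deriveZ _ _ _ _ e^-1 s 1 _ (is_derive_expRM (- e) s).
    move=> /is_derive_eq; apply; rewrite /GRing.scale /= mulrA mulrN mulVf ?gt_eqF//.
    by rewrite mulN1r.
  have := @is_derive1_comp _ expR _ s _ _ (is_derive_expR _) h.
  by move=> /is_derive_eq; apply; rewrite /E mulrC.
have le0 s : 0 < s < t -> dpsi s <= 0.
  move=> /andP[s0 st]; have sT : 0 < s < T by rewrite s0 (lt_le_trans st).
  rewrite /dpsi mulrA -mulrDl; apply: mulr_le0_ge0; last exact: expR_ge0.
  have := ineq _ sT; rewrite -/(rho s) => i1.
  have drhoE : drho s = 2 * \sum_i w i s * v i s.
    by rewrite mulr_sumr; apply: eq_bigr => i _; rewrite mulrA.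
  have yg : 2 * (\sum_i w i s * g i s) <=
     expR (- e * s) * rho s + expR (e * s) * \sum_i g i s ^+ 2.
    rewrite /rho !mulr_sumr -big_split /=; apply: ler_sum => i _.
    set a := w i s; set b := g i s.
    have p : expR (- e * s) * expR (e * s) = 1 :> R.
      by rewrite -expRD mulNr addNr expR0.
    move: p; set x := expR (e * s); set y := expR (- e * s) => p.
    (* Since x y = 1, expanding this square gives Young's inequality with weight [x]. *)
    have : 0 <= y * (a - x * b) ^+ 2 by rewrite mulr_ge0 ?sqr_ge0 ?expR_ge0.
    have -> : y * (a - x * b) ^+ 2 =
      y * a ^+ 2 - 2 * (y * x) * (a * b) + (y * x) * x * b ^+ 2 by ring.
    by rewrite p; lra.
  have gb' := gb _ sT.
  have g2 : expR (2 * lam * s) * (expR (e * s) * \sum_i g i s ^+ 2) <=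
     K2 * expR (- e * s).
    have -> : expR (- e * s) = expR (2 * lam * s) * (expR (e * s) * expR (- (2 * mu) * s)).
      by rewrite -!expRD; congr expR; rewrite /e; ring.
    have -> (a b c : R) : K2 * (a * (b * c)) = a * (b * (K2 * c)) by ring.
    by do 2 (apply: ler_wpM2l; first exact: expR_ge0).
  rewrite drhoE; move: i1 yg g2.
  set X := expR (2 * lam * s); set S1 := \sum_i w i s * v i s.
  set S2 := \sum_i _ * g i s; set S3 := \sum_i g i s ^+ 2.
  set Y := expR (- e * s); set Z := expR (e * s) => i1 yg g2.
  have X0 : 0 <= X by exact: expR_ge0.
  have h : X * (2 * S1) <= X * (- (2 * lam) * rho s + (Y * rho s + Z * S3)).
    by rewrite ler_wpM2l//; lra.
  nra.
have := derive_le0_le t0 psic psid le0.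
rewrite /psi /E !mulr0 expR0 mul1r mulr1 => h.
have E1 : 1 <= E t.
  by rewrite /E -expR0 ler_expR mulr_ge0 ?expR_ge0// invr_ge0 ltW.
have h2 : expR (2 * lam * t) * rho t <= expR e^-1 * (rho 0 + K2).
  rewrite [leRHS]mulrC; apply: le_trans h.
  rewrite -[leLHS]mulr1; apply: ler_pM => //.
    by rewrite mulr_ge0 ?expR_ge0// sumr_ge0// => i _; exact: sqr_ge0.
  by rewrite lerDl.
rewrite mulNr expRN ler_pdivlMr ?expR_gt0// mulrC; exact: h2.
Qed.

End calculus.

(** * Linear systems with coercive coefficients: stability and limits *)

Section linear_ode.
Context {R : realType}.

(** A lower bound on the symmetric part of [A], the only part that acts on the energy. *)
Definition coercive n (A : 'I_n -> 'I_n -> R) (lam : R) :=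
  forall v : 'I_n -> R, lam * (\sum_i v i ^+ 2) <= \sum_i v i * \sum_j A i j * v j.

Lemma linear_energy n (A : 'I_n -> 'I_n -> R -> R) (w g : 'I_n -> R -> R)
    (T lam mu K2 : R) :
  (forall i, continuous (w i)) ->
  (forall i (t : R), 0 < t < T ->
     is_derive t 1 (w i) (- (\sum_j A i j t * w j t) + g i t)) ->
  (forall t : R, 0 < t < T -> coercive (fun i j => A i j t) lam) ->
  (forall t : R, 0 < t < T -> \sum_i g i t ^+ 2 <= K2 * expR (- (2 * mu) * t)) ->
  0 <= K2 -> lam < mu ->
  forall t : R, 0 <= t <= T -> \sum_i w i t ^+ 2 <=
    expR (mu - lam)^-1 * (\sum_i w i 0 ^+ 2 + K2) * expR (- (2 * lam) * t).
Proof.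
move=> wc wd Ac; apply: (energy_estimate wc wd) => t /Ac /(_ (w ^~ t)) h.
under eq_bigr do rewrite mulrDr mulrN.
by rewrite big_split /= sumrN lerD2r mulNr lerN2.
Qed.

(** The constant precedes [A], [w] and [g], so whole families of equations can be compared: this
    gives both the Cauchy property of difference quotients and the continuity of solutions in the
    parameters. *)
Lemma linear_ode_small n (T : R) : 0 <= T ->
  exists2 C : R, 0 < C &
  forall (A : 'I_n -> 'I_n -> R -> R) (w g : 'I_n -> R -> R) (e : R),
  (forall t : R, 0 < t < T -> coercive (fun i j => A i j t) 0) ->
  (forall i, continuous (w i)) ->
  (forall i (t : R), 0 < t < T ->
     is_derive t 1 (w i) (- (\sum_j A i j t * w j t) + g i t)) ->
  (forall i, `|w i 0| <= e) ->
  (forall i (t : R), 0 < t < T -> `|g i t| <= e) -> 0 <= e ->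
  forall i (t : R), 0 <= t <= T -> `|w i t| <= C * e.
Proof.
move=> T0.
(* The energy estimate is applied with rates 0 and 1: on [0, T] a forcing of size at most [e] is
   bounded by [e] times exp (T - t), whence exp (2 T) after squaring. *)
pose M : R := expR 1 * (n%:R + n%:R * expR (2 * T)).
have M0 : 0 <= M by rewrite mulr_ge0 ?expR_ge0// addr_ge0// mulr_ge0 ?expR_ge0.
(* The square of the solution is at most M e^2, and M <= (M + 1)^2 spares a square root. *)
exists (M + 1); first by rewrite ltr_wpDl.
move=> A w g e Ac wc wd w0 gb e0 i t tT.
have sumb (h : 'I_n -> R) : (forall i, `|h i| <= e) -> \sum_i h i ^+ 2 <= n%:R * e ^+ 2.
  move=> hb; apply: ler_sum_ord => k.
  by rewrite -[leLHS]real_normK ?num_real// lerXn2r ?nnegrE.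
have K0 : 0 <= n%:R * e ^+ 2 * expR (2 * T) :> R.
  by rewrite mulr_ge0 ?expR_ge0// mulr_ge0// sqr_ge0.
have gb2 s : 0 < s < T -> \sum_i g i s ^+ 2 <=
    n%:R * e ^+ 2 * expR (2 * T) * expR (- (2 * 1) * s).
  move=> sT; apply: (le_trans (sumb (g ^~ s) _)); first by move=> k; exact: gb.
  rewrite -[leLHS]mulr1 -[leRHS]mulrA ler_wpM2l ?mulr_ge0 ?sqr_ge0//.
  rewrite -expRD -[leLHS]expR0 ler_expR; move: sT => /andP[_ /ltW ?]; lra.
have := linear_energy wc wd Ac gb2 K0 ltr01 tT.
rewrite subr0 invr1 mulr0 oppr0 mul0r expR0 mulr1 => h.
have h1 : w i t ^+ 2 <= \sum_k w k t ^+ 2.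
  by rewrite (bigD1 i)//= lerDl sumr_ge0// => k _; exact: sqr_ge0.
have h2 : w i t ^+ 2 <= M * e ^+ 2.
  have -> : M * e ^+ 2 =
      expR 1 * (n%:R * e ^+ 2 + n%:R * e ^+ 2 * expR (2 * T)) by rewrite /M; ring.
  by rewrite (le_trans h1)// (le_trans h)// ler_wpM2l ?expR_ge0// lerD2r sumb.
rewrite -(@ler_pXn2r _ 2)// ?nnegrE ?mulr_ge0 ?addr_ge0//.
rewrite real_normK ?num_real// exprMn; apply: (le_trans h2).
rewrite ler_wpM2r ?sqr_ge0//; nra.
Qed.

Lemma continuous_bounded_segment (T : R) (f : R -> R) : 0 < T -> continuous f ->
  exists M : R, 0 <= M /\ forall s : R, 0 <= s <= T -> `|f s| <= M.
Proof.
move=> T0 fc.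
have cA : {within `[0, T], continuous (fun s => `|f s|)}.
  by apply: continuous_subspaceT => s; apply: cvg_norm; exact: fc.
have [c _ Hc] := EVT_max (ltW T0) cA.
by exists `|f c|; split => // s sT; apply: Hc; rewrite in_itv.
Qed.

Section limits.
Context {I : Type} (F : set_system I) {FF : ProperFilter F}.

(** By the mean value theorem the difference quotient of [q k] at [t] is a value of [dq k] at a
    nearby point, hence close to r(t) uniformly in [k]; for a fixed increment the bound survives the
    limit in [k]. *)
Lemma is_derive_uniform_lim (q dq : I -> R -> R) (ql r : R -> R) (a b t : R) :
  (\forall h \near F, forall s : R, a < s < b -> is_derive s 1 (q h) (dq h s)) ->
  (forall e : R, 0 < e -> \forall h \near F, forall s : R, a < s < b -> `|dq h s - r s| <= e) ->
  (forall s : R, a < s < b -> q h s @[h --> F] --> ql s) ->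
  a < t < b -> {for t, continuous r} -> is_derive t 1 ql (r t).
Proof.
move=> qd dqr qql tab rc.
suff H : (fun h : R => h^-1 *: ((ql \o shift t) (h *: 1) - ql t)) @ 0^' --> r t.
  by apply: DeriveDef; [apply/cvg_ex; exists (r t) | exact/cvg_lim].
apply/cvgrPdist_le => /= e e0.
have e20 : 0 < e / 2 by rewrite divr_gt0.
have nab : \forall s \near t, a < s < b.
  near=> s; apply/andP; split; near: s; move: tab => /andP[? ?].
    exact: lt_nbhsr.
  exact: lt_nbhsl.
have /cvgrPdist_le/(_ _ e20) rc2 := rc.
have : \forall s \near t, a < s < b /\ `|r t - r s| <= e / 2.
  by apply: filterI.
move=> /nbhs_ballP[d /= d0 db].
near=> h.
have hn0 : h != 0 by near: h; exact: nbhs_dnbhs_neq.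
have hd : `|h| < d by near: h; exact: dnbhs0_lt.
rewrite /= [h *: 1]mulr1.
have bound s : `|s| < d -> a < s + t < b /\ `|r t - r (s + t)| <= e / 2.
  by move=> sd; apply: db; rewrite /ball /= opprD addrCA subrr addr0 normrN.
rewrite -(ler_pM2l (_ : 0 < `|h|)) ?normr_gt0// -normrM mulrBr.
rewrite /GRing.scale /= mulrA divff// mul1r.
have [ab1 _] := bound _ hd.
have cvq : (h * r t - (q k (h + t) - q k t)) @[k --> F] --> h * r t - (ql (h + t) - ql t).
  by apply: cvgB; [exact: cvg_cst | apply: cvgB; exact: qql].
apply: (cvgr_to_le (cvg_norm cvq)).
have := dqr _ e20; have := qd; apply: filter_app2; near=> k => qdk dqrk.
have seg c : Num.min t (h + t) <= c <= Num.max t (h + t) -> `|c - t| < d.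
  move=> hc; apply: le_lt_trans hd.
  rewrite ler_norml; move: hc; case: (leP t (h + t)) => th.
    rewrite lerBlDr lerBrDr => /andP[c1 c2].
    have h0 : 0 <= h by rewrite -(lerD2r t) add0r.
    by rewrite ger0_norm// (le_trans _ c1) ?c2// gerDr oppr_le0.
  rewrite lerBlDr lerBrDr => /andP[c1 c2].
  have h0 : h < 0 by rewrite -(ltrD2r t) add0r.
  by rewrite ltr0_norm// opprK c1 (le_trans c2)// lerDr oppr_ge0 ltW.
have main c : Num.min t (h + t) <= c <= Num.max t (h + t) -> `|dq k c - r t| <= e.
  move=> /seg /bound; rewrite subrK => -[cab rtc].
  rewrite -(subrK (r c) (dq k c)) -addrA (splitr e).
  by rewrite (le_trans (ler_normD _ _))// lerD// ?dqrk// distrC.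
have mvt x y : x < y -> x = Num.min t (h + t) -> y = Num.max t (h + t) ->
    exists2 c, x <= c <= y & q k y - q k x = dq k c * (y - x).
  move=> xy xE yE.
  have cc c : x <= c <= y -> is_derive c 1 (q k) (dq k c).
    by rewrite xE yE => /seg/bound; rewrite subrK => -[cab _]; exact: qdk.
  have [||c + ->] := @MVT _ (q k) (dq k) x y xy.
  - by move=> c; rewrite in_itv /= => /andP[/ltW c1 /ltW c2]; apply: cc; rewrite c1.
  - apply: derivable_within_continuous => c; rewrite in_itv /= => /cc cd.
    exact: ex_derive.
  - by rewrite in_itv /= => /andP[/ltW c1 /ltW c2]; exists c; rewrite ?c1.
have [th|th|th] := ltgtP t (h + t).
- have [//||c cin E] := mvt t (h + t) th; first by rewrite min_l// ltW.
    by rewrite max_r// ltW.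
  rewrite E addrK mulrC -mulrBl normrM mulrC ler_wpM2l// distrC main//.
  by rewrite min_l ?max_r// ltW.
- have [//||c cin E] := mvt (h + t) t th; first by rewrite min_r// ltW.
    by rewrite max_l// ltW.
  have tht : t - (h + t) = - h by ring.
  rewrite -[q k (h + t) - _]opprB E tht mulrN opprK mulrC -mulrBl normrM mulrC ler_wpM2l// distrC main//.
  by rewrite min_r ?max_l// ltW.
- by move: hn0; rewrite -[h](addrK t) -th subrr eqxx.
Unshelve. all: by end_near. Qed.

(** The difference of two members of the family solves the same equation with small forcing and
    small initial values, so [linear_ode_small] makes the family uniformly Cauchy on each [0, T].
    The solution [ql] is thereby constructed, not assumed. *)
Lemma linear_ode_limit n (A : 'I_n -> 'I_n -> R -> R) (q gh : I -> 'I_n -> R -> R)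
    (g : 'I_n -> R -> R) (q0 : 'I_n -> R) :
  (forall i j, continuous (A i j)) ->
  (forall t : R, 0 < t -> coercive (fun i j => A i j t) 0) ->
  (forall i, continuous (g i)) ->
  (\forall h \near F, forall i, continuous (q h i) /\ (forall t : R, 0 < t ->
     is_derive t 1 (q h i) (- (\sum_j A i j t * q h j t) + gh h i t))) ->
  (forall T e : R, 0 < T -> 0 < e -> \forall h \near F, forall i (t : R), 0 <= t <= T ->
     `|gh h i t - g i t| <= e) ->
  (forall i, q h i 0 @[h --> F] --> q0 i) ->
  exists ql : 'I_n -> R -> R,
  [/\ forall i, continuous (ql i),
      forall i (t : R), ql i t = ql i (Num.max t 0),
      forall i, ql i 0 = q0 i,
      forall i (t : R), 0 < t ->
        is_derive t 1 (ql i) (- (\sum_j A i j t * ql j t) + g i t) &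
      forall T e : R, 0 < T -> 0 < e -> \forall h \near F, forall i (t : R), 0 <= t <= T ->
        `|q h i t - ql i t| <= e].
Proof.
move=> Ac Acoer gc qd ghg q0cvg.
have key (T e : R) : 0 < T -> 0 < e -> exists2 S, F S & forall h k, S h -> S k ->
    forall i (t : R), 0 <= t <= T -> `|q h i t - q k i t| <= e.
  move=> T0 e0.
  have coer (t : R) : 0 < t < T -> coercive (fun i j => A i j t) 0.
    by move=> /andP[t0 _]; exact: Acoer.
  have [C C0 HC] := linear_ode_small n (ltW T0).
  pose eta := e / (2 * C); have eta0 : 0 < eta by rewrite divr_gt0 ?mulr_gt0.
  have q0n : \forall h \near F, forall i, `|q0 i - q h i 0| <= eta.
    by apply: filter_forall => i; apply: (cvgrPdist_le _ _).1 (q0cvg i) _ eta0.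
  have Fall := filterI qd (filterI (ghg T eta T0 eta0) q0n).
  eexists; first exact: Fall.
  move=> h k [hd [hg h0]] [kd [kg k0]] i t tT.
  have -> : e = C * (2 * eta).
    by rewrite /eta; field; rewrite gt_eqF.
  apply: (HC A (fun i t => q h i t - q k i t) (fun i t => gh h i t - gh k i t)) => //.
  - by move=> {}i s; apply: cvgB; [exact: (hd i).1 | exact: (kd i).1].
  - move=> {}i r /andP[s0 _].
    have := is_derive_sub ((hd i).2 r s0) ((kd i).2 r s0).
    move=> /is_derive_eq; apply.
    under [in RHS]eq_bigr do rewrite mulrBr.
    by rewrite big_split /= sumrN; ring.
  - move=> {}i; rewrite -(subrKA (q0 i)) mulr2n mulrDl mul1r (le_trans (ler_normD _ _))//.
    by apply: lerD; [rewrite distrC; exact: h0 | exact: k0].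
  - move=> {}i r /andP[/ltW s0 /ltW sT].
    rewrite -(subrKA (g i r)) mulr2n mulrDl mul1r (le_trans (ler_normD _ _))//.
    by apply: lerD; [apply: hg | rewrite distrC; apply: kg]; rewrite s0 sT.
  - by rewrite mulr_ge0// ltW.
have cvgq i (t : R) : 0 <= t -> cvg (q h i t @[h --> F]).
  move=> t0; apply/cauchy_cvgP/cauchy_exP => e e0.
  have e20 : 0 < e / 2 by rewrite divr_gt0.
  have t10 : 0 < t + 1 by rewrite ltr_wpDl.
  have [S FS HS] := key _ _ t10 e20.
  have [k Sk] := filter_ex FS.
  exists (q k i t); suff : F [set h | ball (q k i t) e (q h i t)] by [].
  apply: filterS FS => h Sh; rewrite /ball /=.
  apply: (@le_lt_trans _ _ (e / 2)); last by rewrite [ltRHS]splitr ltrDl.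
  by apply: (HS k h Sk Sh i t); rewrite t0 lerDl ler01.
pose ql i t := lim (q h i (Num.max t 0) @[h --> F]).
have maxp (t : R) : 0 <= t -> Num.max t 0 = t by move=> t0; rewrite max_l.
have qlcvg i (t : R) : 0 <= t -> q h i t @[h --> F] --> ql i t.
  by move=> t0; rewrite /ql maxp//; exact: cvgq.
have qlE i t : ql i t = ql i (Num.max t 0).
  by rewrite /ql [Num.max (Num.max t 0) 0]maxp// le_max lexx orbT.
have unif (T e : R) : 0 < T -> 0 < e -> \forall h \near F, forall i (t : R), 0 <= t <= T ->
    `|q h i t - ql i t| <= e.
  move=> T0 e0; have [S FS HS] := key T e T0 e0.
  apply: filterS (FS) => h Sh i t /andP[t0 tT].
  have c : `|q h i t - q k i t| @[k --> F] --> `|q h i t - ql i t|.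
    by apply: cvg_norm; apply: cvgB; [exact: cvg_cst | exact: qlcvg].
  by apply: (cvgr_to_le c); apply: filterS FS => k Sk; apply: HS => //; rewrite t0.
have maxc : continuous (fun t : R => Num.max t 0).
  move=> t; apply: continuous_max => //; exact: cvg_cst.
have qlc i : continuous (ql i).
  move=> t; apply/cvgrPdist_le => e e0.
  have e30 : 0 < e / 3 by rewrite divr_gt0.
  pose T := `|t| + 1; have T0 : 0 < T by rewrite ltr_wpDl.
  have [h [hu hd]] := filter_ex (filterI (unif T (e / 3) T0 e30) qd).
  have ch : {for t, continuous (fun s : R => q h i (Num.max s 0))}.
    by apply: continuous_comp; [exact: maxc | exact: (hd i).1].
  have tT : 0 <= Num.max t 0 <= T.
    by rewrite le_max lexx orbT ge_max (ltW T0) andbT (le_trans (ler_norm _))// lerDl.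
  have /cvgrPdist_le /(_ _ e30) chs := ch.
  near=> s.
  have sT : 0 <= Num.max s 0 <= T.
    rewrite le_max lexx orbT ge_max (ltW T0) andbT.
    apply: (@le_trans _ _ (t + 1)); last by rewrite lerD2r ler_norm.
    by apply/ltW; near: s; apply: lt_nbhsl; rewrite ltrDl.
  rewrite qlE (qlE i s); set a := ql i _; set b := ql i _.
  have -> : a - b = (a - q h i (Num.max t 0)) + (q h i (Num.max t 0) - q h i (Num.max s 0))
      + (q h i (Num.max s 0) - b) by ring.
  have -> : e = e / 3 + e / 3 + e / 3 by field.
  rewrite (le_trans (ler_normD _ _))// lerD ?hu// (le_trans (ler_normD _ _))//.
  rewrite lerD//; first by rewrite distrC hu.
  by near: s.
exists ql; split => //.
- by move=> i; apply: (cvg_unique _ (qlcvg i 0 _) (q0cvg i)).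
- move=> i t t0.
  pose T := t + 1; have T0 : 0 < T by rewrite ltr_wpDr.
  have [M M0 MA] : exists2 M : R, 0 <= M & forall j (s : R), 0 <= s <= T -> `|A i j s| <= M.
    have [M HM] := choice (fun j => continuous_bounded_segment T0 (Ac i j)).
    exists (\sum_j M j); first by apply: sumr_ge0 => j _; have [] := HM j.
    move=> j s sT; have [_ /(_ s sT) h] := HM j.
    rewrite (le_trans h)// (bigD1 j)//= lerDl sumr_ge0// => k _.
    by have [] := HM k.
  pose dq h s := - (\sum_j A i j s * q h j s) + gh h i s.
  pose r s := - (\sum_j A i j s * ql j s) + g i s.
  apply: (@is_derive_uniform_lim (fun h => q h i) dq (ql i) r 0 T t).
  + by apply: filterS qd => h hd s /andP[s0 _]; exact: (hd i).2.
  + move=> e e0; pose eta := e / (n%:R * M + 1).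
    have D0 : 0 < n%:R * M + 1 by rewrite ltr_wpDl// mulr_ge0.
    have eta0 : 0 < eta by rewrite divr_gt0.
    have uT := unif T eta T0 eta0; have gT := ghg T eta T0 eta0.
    apply: (filterS _ (filterI uT gT)) => h [h1 h2] s /andP[/ltW s0 /ltW sT].
    have sI : 0 <= s <= T by rewrite s0.
    have -> : dq h s - r s = - (\sum_j A i j s * (q h j s - ql j s)) + (gh h i s - g i s).
      under [in RHS]eq_bigr do rewrite mulrBr.
      by rewrite big_split /= sumrN /dq /r; ring.
    have -> : e = n%:R * (M * eta) + eta.
      by rewrite mulrA -[X in _ + X]mul1r -mulrDl mulrC divfK ?gt_eqF.
    rewrite (le_trans (ler_normD _ _))// lerD ?h2// normrN (le_trans (ler_norm_sum _ _ _))//.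
    by apply: ler_sum_ord => j; rewrite normrM ler_pM ?MA ?h1.
  + by move=> s /andP[/ltW s0 _]; exact: qlcvg.
  + by rewrite t0 ltrDl ltr01.
  + apply: cvgD; last exact: gc.
    by apply: cvgN; apply: cvg_bigsum => j; apply: cvgM; [exact: Ac | exact: qlc].
Unshelve. all: by end_near. Qed.

End limits.
End linear_ode.

(** * Partial derivatives *)

Section several_variables.
Context {R : realType} {d : nat}.
Local Notation V := 'rV[R]_d.

Lemma cvg_rV {T : Type} (F : set_system T) (c : T -> V) (l : V) : Filter F ->
  (forall i, c x 0 i @[x --> F] --> l 0 i) -> c @ F --> l.
Proof.
move=> FF cl; apply/cvgrPdist_le => /= e e0.
near=> x.
rewrite [leLHS]/Num.Def.normr/= mx_normrE (bigmax_le _ (ltW e0))//= => -[i j] _ /=.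
rewrite !mxE (ord1 i).
move: j; near: x; apply: filter_forall => j.
by move/cvgrPdist_le : (cl j) => /(_ _ e0).
Unshelve. all: by end_near. Qed.

Lemma coord_le_norm (x : V) i : `|x 0 i| <= `|x|.
Proof.
rewrite [leRHS]/Num.Def.normr /= mx_normrE.
exact: (le_bigmax _ (fun ij : 'I_1 * 'I_d => `|x ij.1 ij.2|) (0, i)).
Qed.

Lemma is_derive_lineP (g : V -> R) (x v : V) (s l : R) :
  is_derive s 1 (fun h => g (h *: v + x)) l <-> is_derive (s *: v + x) v g l.
Proof.
have E : (fun h : R => h^-1 *: (((fun h => g (h *: v + x)) \o shift s) (h *: 1) -
            (fun h => g (h *: v + x)) s)) =
         (fun h : R => h^-1 *: ((g \o shift (s *: v + x)) (h *: v) - g (s *: v + x))).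
  apply/funext => h; congr (_ *: (_ - _)) => /=.
  by rewrite [h *: 1]mulr1 scalerDl addrA.
split=> -[dl <-]; apply: DeriveDef.
- by move: dl; rewrite /derivable E.
- by rewrite /derive E.
- by rewrite /derivable E.
- by rewrite /derive E.
Qed.

(** The corners of a path from [x] to x + h made of [d] moves parallel to the axes, along which only
    partial derivatives are involved. *)
Definition ctrunc (x h : V) (k : nat) : V := \row_i (x 0 i + h 0 i *+ (i < k)%N).

Lemma ctruncS (x h : V) (k : 'I_d) :
  ctrunc x h k.+1 = h 0 k *: ej k + ctrunc x h k.
Proof.
apply/rowP => i; rewrite !mxE /= ltnS leq_eqVlt (_ : (i == k :> nat) = (i == k))//.
case: eqVneq => [->|ik] /=; first by rewrite ltnn mulr1 mulr1n mulr0n addr0 addrC.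
by rewrite mulr0 add0r.
Qed.

(** Both end points move, which allows a base point that itself runs along a trajectory. On each
    move of the path [ctrunc] the increment is a partial derivative at some point near [z0], by the
    mean value theorem. *)
Lemma strict_differentiability (g : V -> R) (z0 : V) :
  (\forall z \near z0, forall i, derivable g z (ej i)) ->
  (forall i, {for z0, continuous (pd i g)}) ->
  forall e : R, 0 < e -> \forall z \near z0 & z' \near z0,
    `|g z' - g z - \sum_i (z' - z) 0 i * pd i g z0| <= e * \sum_i `|(z' - z) 0 i|.
Proof.
move=> gd gc e e0.
have H0 i : \forall z \near z0, derivable g z (ej i) /\ `|pd i g z - pd i g z0| <= e.
  apply: filterI.
    by apply: filterS gd => z; apply.
  have /cvgrPdist_le /(_ _ e0) := gc i.
  by apply: filterS => z; rewrite distrC.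
have /= := filter_forall (nbhs_filter z0) H0.
move=> /nbhs_ballP[r /= r0 rb].
(* A third of the radius: then |z' - z| < 2 r / 3, and every point of the path from [z] to [z'] is
   within [r] of [z0]. *)
have r30 : 0 < r / 3 by rewrite divr_gt0.
suff H (z z' : V) : ball z0 (r / 3) z -> ball z0 (r / 3) z' ->
    `|g z' - g z - \sum_i (z' - z) 0 i * pd i g z0| <= e * \sum_i `|(z' - z) 0 i|.
  exists (ball z0 (r / 3), ball z0 (r / 3)) => /=.
    by split; exact: nbhsx_ballx.
  by move=> [z z'] /= [zb zb']; exact: H.
rewrite -!ball_normE /ball_ /= => zb zb'.
pose h := z' - z; rewrite -/h.
have -> : g z' - g z = \sum_(i < d) (g (ctrunc z h i.+1) - g (ctrunc z h i)).
  transitivity (\sum_(0 <= i < d) (g (ctrunc z h i.+1) - g (ctrunc z h i))); last first.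
    by rewrite big_mkord.
  rewrite (telescope_sumr (fun i => g (ctrunc z h i)))//; congr (g _ - g _); apply/rowP => i.
    by rewrite !mxE ltn_ord /=; ring.
  by rewrite !mxE addr0.
rewrite -sumrB mulr_sumr (le_trans (ler_norm_sum _ _ _))//.
apply: ler_sum => k _.
pose p (s : R) := s *: ej k + ctrunc z h k.
have hk (s : R) : (`|s| <= `|h 0 k|) -> forall i, derivable g (p s) (ej i) /\ `|pd i g (p s) - pd i g z0| <= e.
  move=> sh i; apply: rb; rewrite -ball_normE /ball_ /=.
  have pz : `|p s - z| <= `|h|.
    rewrite [leLHS]/Num.Def.normr /= mx_normrE (bigmax_le _ (normr_ge0 _))//= => -[a b] _ /=.
    rewrite (ord1 a) !mxE; have hb := coord_le_norm h b.
    rewrite eqxx /=; case: (eqVneq b k) => [->|bk] /=.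
      by rewrite ltnn mulr1 mulr0n addr0 addrK (le_trans sh)// coord_le_norm.
    rewrite mulr0 add0r addrC addKr; move: hb; rewrite !mxE.
    by case: (b < k)%N => //; rewrite ?mulr1n ?mulr0n ?normr0 ?normr_ge0.
  have hn : `|h| < r / 3 + r / 3.
    by rewrite /h -(subrKA z0) (le_lt_trans (ler_normD _ _))// ltrD// distrC.
  rewrite -(subrKA z) (le_lt_trans (ler_normD _ _))//.
  rewrite [`|z - _|]distrC; have := ltrD zb (le_lt_trans pz hn); lra.
have [q qk ->] : exists2 q, `|q| <= `|h 0 k| &
    g (ctrunc z h k.+1) - g (ctrunc z h k) = h 0 k * pd k g (p q).
  have pk (s : R) : `|s| <= `|h 0 k| -> is_derive s 1 (fun s => g (p s)) (pd k g (p s)).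
    move=> /hk /(_ k)[dk _]; apply/is_derive_lineP; exact: derivableP.
  have -> : ctrunc z h k.+1 = p (h 0 k) by rewrite ctruncS.
  have -> : ctrunc z h k = p 0 by rewrite /p scale0r add0r.
  have mvt (a b : R) : a <= b -> (forall s : R, a <= s <= b -> `|s| <= `|h 0 k|) ->
      exists2 q, `|q| <= `|h 0 k| & g (p b) - g (p a) = (b - a) * pd k g (p q).
    move=> ab sb.
    have [||q + ->] := @MVT_segment _ (fun s => g (p s)) (fun s => pd k g (p s)) a b ab.
    - by move=> s; rewrite in_itv /= => /andP[/ltW a1 /ltW b1]; apply/pk/sb; rewrite a1.
    - apply: derivable_within_continuous => s; rewrite in_itv /= => /sb/pk sd.
      exact: ex_derive.
    - by rewrite in_itv /= => /sb qb; exists q => //; rewrite mulrC.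
  have [h0|h0] := leP 0 (h 0 k).
    have [|q qb E] := mvt 0 (h 0 k) h0; last by exists q => //; rewrite E subr0.
    by move=> s /andP[s0 sh]; rewrite !ger0_norm.
  have [|q qb E] := mvt (h 0 k) 0 (ltW h0).
    by move=> s /andP[s0 sh]; rewrite !ler0_norm ?lerN2// ltW.
  exists q => //; apply: oppr_inj.
  by rewrite opprB E sub0r mulNr.
rewrite -mulrBr normrM mulrC ler_wpM2r//.
by have [] := hk q qk k.
Qed.

(** The increment of [c] has coordinates [h] times the convergent quotients [D i h]; strict
    differentiability of [g] at [c x] turns it into an increment of [g] with an error that is small
    relative to |h|. *)
Lemma is_derive_comp_rV (U : normedModType R) (g : V -> R) (c : U -> V) (x v : U)
    (dc : 'I_d -> R) :
  (\forall z \near c x, forall i, derivable g z (ej i)) ->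
  (forall i, {for c x, continuous (pd i g)}) ->
  (forall i, is_derive x v (fun y => c y 0 i) (dc i)) ->
  is_derive x v (g \o c) (\sum_i dc i * pd i g (c x)).
Proof.
move=> gd gc cd.
pose D i (h : R) := h^-1 * (c (h *: v + x) 0 i - c x 0 i).
have Dcvg i : D i h @[h --> 0^'] --> dc i.
  have [cdi <-] := cd i; exact: cdi.
have cc : c (h *: v + x) @[h --> 0^'] --> c x.
  apply: cvg_rV => i.
  have E : {near (0 : R)^', (fun h => h * D i h + c x 0 i) =1 (fun h => c (h *: v + x) 0 i)}.
    near=> h; have h0 : h != 0 by near: h; exact: nbhs_dnbhs_neq.
    by rewrite /D mulrA divff// mul1r subrK.
  apply: cvg_trans; first exact: near_eq_cvg E.
  have hc : h * D i h + c x 0 i @[h --> 0^'] --> 0 * dc i + c x 0 i.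
    apply: cvgD; last exact: cvg_cst.
    by apply: cvgM; [exact: cvg_within | exact: Dcvg].
  by move: hc; rewrite mul0r add0r.
suff H : (fun h : R => h^-1 *: (((g \o c) \o shift x) (h *: v) - (g \o c) x)) @ 0^' -->
    \sum_i dc i * pd i g (c x).
  by apply: DeriveDef; [apply/cvg_ex; eexists; exact: H | exact/cvg_lim].
pose Q h := h^-1 * (g (c (h *: v + x)) - g (c x)).
pose S h := \sum_i D i h * pd i g (c x).
have Scvg : S h @[h --> 0^'] --> \sum_i dc i * pd i g (c x).
  by apply: cvg_bigsum => i; apply: cvgM; [exact: Dcvg | exact: cvg_cst].
suff QS : (fun h => Q h - S h) @ 0^' --> (0 : R).
  have H := cvgD QS Scvg; rewrite add0r in H.
  have E : (fun h => Q h - S h) + S = Q.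
    by apply/funext => h; rewrite -[LHS]/(Q h - S h + S h) subrK.
  by rewrite E in H; exact: H.
(* Bounds the sum of the quotients |D i h| near 0, so that a relative error e / M becomes an error
   [e]. *)
pose M := \sum_i `|dc i| + 1.
have M0 : 0 < M by rewrite ltr_wpDl// sumr_ge0.
have Mn : \forall h \near (0 : R)^', \sum_i `|D i h| <= M.
  have : (\sum_i `|D i h|) @[h --> 0^'] --> \sum_i `|dc i|.
    by apply: cvg_bigsum => i; apply: cvg_norm; exact: Dcvg.
  by move/cvgr_le; apply; rewrite ltrDl ltr01.
apply/cvgrPdist_le => e e0.
have eM0 : 0 < e / M by rewrite divr_gt0.
have := strict_differentiability gd gc eM0.
move=> [[A B] /= [Ac Bc] ABs].
have cB : \forall h \near (0 : R)^', B (c (h *: v + x)) by apply: cc.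
near=> h.
have h0 : h != 0 by near: h; exact: nbhs_dnbhs_neq.
have Bh : B (c (h *: v + x)) by near: h.
have Mh : \sum_i `|D i h| <= M by near: h.
have /= := ABs (c x, c (h *: v + x)) (conj (nbhs_singleton Ac) Bh).
have coordD i : (c (h *: v + x) - c x) 0 i = h * D i h.
  by rewrite /D !mxE mulrA divff// mul1r.
have -> : \sum_i (c (h *: v + x) - c x) 0 i * pd i g (c x) = h * S h.
  by rewrite /S mulr_sumr; apply: eq_bigr => i _; rewrite coordD -mulrA.
have -> : g (c (h *: v + x)) - g (c x) = h * Q h by rewrite /Q mulrA divff// mul1r.
have -> : \sum_i `|(c (h *: v + x) - c x) 0 i| = `|h| * \sum_i `|D i h|.
  by rewrite mulr_sumr; apply: eq_bigr => i _; rewrite coordD normrM.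
rewrite -mulrBr normrM mulrCA ler_pM2l ?normr_gt0// sub0r normrN => H.
apply: (le_trans H); apply: (@le_trans _ _ (e / M * M)).
  by rewrite ler_wpM2l// ltW.
by rewrite divfK// gt_eqF.
Unshelve. all: by end_near. Qed.

End several_variables.

(** * Uniform convergence on bounded time intervals *)

Section uniform_on_segments.
Context {R : realType}.

Definition ucv {I : Type} (F : set_system I) (q : I -> R -> R) (ql : R -> R) :=
  forall T e : R, 0 < T -> 0 < e ->
  \forall h \near F, forall t : R, 0 <= t <= T -> `|q h t - ql t| <= e.

Section filter.
Context {I : Type} {F : set_system I} {FF : Filter F}.

Lemma ucv_cst (f : R -> R) : ucv F (fun=> f) f.
Proof. by move=> T e _ e0; near=> h => t _; rewrite subrr normr0 ltW.
Unshelve. all: by end_near. Qed.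

Lemma ucvD (q p : I -> R -> R) (ql pl : R -> R) :
  ucv F q ql -> ucv F p pl -> ucv F (fun h t => q h t + p h t) (fun t => ql t + pl t).
Proof.
move=> qq pp T e T0 e0.
have e20 : 0 < e / 2 by rewrite divr_gt0.
have A := qq T _ T0 e20; have B := pp T _ T0 e20.
apply: (filterS _ (filterI A B)) => h [h1 h2] t tT.
rewrite opprD addrACA (splitr e) (le_trans (ler_normD _ _))// lerD//.
  exact: h1.
exact: h2.
Qed.

Lemma ucvN (q : I -> R -> R) (ql : R -> R) :
  ucv F q ql -> ucv F (fun h t => - q h t) (fun t => - ql t).
Proof.
move=> qq T e T0 e0; apply: filterS (qq T e T0 e0) => h qh t tT.
by rewrite -opprD normrN qh.
Qed.

Lemma ucvM (q p : I -> R -> R) (ql pl : R -> R) :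
  continuous ql -> continuous pl ->
  ucv F q ql -> ucv F p pl -> ucv F (fun h t => q h t * p h t) (fun t => ql t * pl t).
Proof.
move=> qc pc qq pp T e T0 e0.
have [Q [Q0 HQ]] := continuous_bounded_segment T0 qc.
have [P [P0 HP]] := continuous_bounded_segment T0 pc.
(* The cap 1 serves the product of the two errors, which is then at most [eta]. *)
pose eta := Num.min 1 (e / (Q + P + 1)).
have D0 : 0 < Q + P + 1 by rewrite ltr_wpDl// addr_ge0.
have eta0 : 0 < eta by rewrite lt_min ltr01 divr_gt0.
have A := qq T _ T0 eta0; have B := pp T _ T0 eta0.
apply: (filterS _ (filterI A B)) => h [h1 h2] t tT.
have {h1} := h1 t tT; have {h2} := h2 t tT.
have := HQ t tT; have := HP t tT.
have -> : q h t * p h t - ql t * pl t = (q h t - ql t) * (p h t - pl t)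
   + (q h t - ql t) * pl t + ql t * (p h t - pl t) by ring.
set a := q h t - ql t; set b := p h t - pl t => hP hQ hb ha.
have eta1 : eta <= 1 by rewrite ge_min lexx.
have etae : eta * (Q + P + 1) <= e.
  by rewrite -ler_pdivlMr// ge_min lexx orbT.
apply: (@le_trans _ _ (eta * 1 + eta * P + Q * eta)); last first.
  by rewrite mulr1; lra.
rewrite (le_trans (ler_normD _ _))// lerD//; last by rewrite normrM ler_pM.
rewrite (le_trans (ler_normD _ _))// lerD// normrM ler_pM//.
exact: le_trans hb eta1.
Qed.

Lemma ucv_sum n (q : 'I_n -> I -> R -> R) (ql : 'I_n -> R -> R) :
  (forall i, ucv F (q i) (ql i)) ->
  ucv F (fun h t => \sum_i q i h t) (fun t => \sum_i ql i t).
Proof.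
move=> qq T e T0 e0.
have D0 : 0 < n%:R + 1 :> R by rewrite ltr_wpDl.
have eta0 : 0 < e / (n%:R + 1) by rewrite divr_gt0.
have A := filter_forall FF (fun i => qq i T _ T0 eta0).
apply: filterS A => h qh t tT.
rewrite -sumrB (le_trans (ler_norm_sum _ _ _))//.
apply: (@le_trans _ _ (n%:R * (e / (n%:R + 1)))).
  by apply: ler_sum_ord => i; exact: qh.
by rewrite mulrA ler_pdivrMr// mulrC ler_pM2l// lerDl.
Qed.

End filter.

(** The tube lemma: continuity at every point of the compact slice over [x0] becomes uniform in
    [t]. *)
Lemma compact_unif_near {X : topologicalType} (G : X -> R -> R) (x0 : X) (T e : R) :
  (forall t : R, {for (x0, t), continuous (fun p : X * R => G p.1 p.2)}) -> 0 < e ->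
  \forall x \near x0, forall t : R, 0 <= t <= T -> `|G x t - G x0 t| <= e.
Proof.
move=> Gc e0.
have e20 : 0 < e / 2 by rewrite divr_gt0.
have H := (compact_near_coveringP _).1 (@segment_compact R 0 T) X (nbhs x0)
  (fun x t => `|G x t - G x0 t| <= e) (nbhs_filter x0).
suff K : forall t, `[0, T]%classic t -> \forall t' \near t & x \near x0,
    `|G x t' - G x0 t'| <= e.
  apply: filterS (H K) => x Hx t tT; apply: Hx.
  by rewrite /= in_itv.
move=> t _.
have /cvgrPdist_le /(_ _ e20) := Gc t.
move=> [[A C] /= [Ax Ct] ACs].
exists (C, A) => //= -[t' x] /= [Ct' Ax'].
have h1 := ACs (x, t') (conj Ax' Ct').
have h2 := ACs (x0, t') (conj (nbhs_singleton Ax) Ct').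
rewrite /= in h1 h2.
rewrite -(subrKA (G x0 t)) (splitr e) (le_trans (ler_normD _ _))// lerD//.
by rewrite distrC.
Qed.

(** For each [t] the quotient is a value of [dG] at some |c| <= |h|, so joint continuity of [dG] and
    compactness make the convergence uniform in [t]. *)
Lemma ucv_diffquot (G dG : R -> R -> R) (r : R) : 0 < r ->
  (forall h t : R, `|h| < r -> is_derive h 1 (G ^~ t) (dG h t)) ->
  (forall t : R, {for (0, t), continuous (fun p : R * R => dG p.1 p.2)}) ->
  ucv (0 : R)^' (fun h t => h^-1 * (G h t - G 0 t)) (dG 0).
Proof.
move=> r0 Gd dGc T e T0 e0.
have := compact_unif_near T dGc e0.
move=> /nbhs_ballP[s /= s0 sb].
near=> h => t tT.
have h0 : h != 0 by near: h; exact: nbhs_dnbhs_neq.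
have hs : `|h| < s by near: h; exact: dnbhs0_lt.
have hr : `|h| < r by near: h; exact: dnbhs0_lt.
have mvt (a b : R) : a < b -> (forall c : R, a <= c <= b -> `|c| <= `|h|) ->
    exists2 c : R, `|c| <= `|h| & G b t - G a t = dG c t * (b - a).
  move=> ab cc.
  have gd c : a <= c <= b -> is_derive c 1 (G ^~ t) (dG c t).
    by move=> /cc ch; apply: Gd; exact: le_lt_trans hr.
  have [||c + ->] := @MVT _ (G ^~ t) (dG ^~ t) a b ab.
  - by move=> c; rewrite in_itv /= => /andP[/ltW c1 /ltW c2]; apply: gd; rewrite c1.
  - apply: derivable_within_continuous => c; rewrite in_itv /= => /gd cd.
    exact: ex_derive.
  - by rewrite in_itv /= => /andP[/ltW c1 /ltW c2]; exists c => //; apply: cc; rewrite c1.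
have [c ch ->] : exists2 c : R, `|c| <= `|h| & G h t - G 0 t = dG c t * h.
  have [hp|hn] := ltP 0 h.
    have [|c cc E] := mvt 0 h hp; last by exists c => //; rewrite E subr0.
    by move=> c /andP[c0 cc]; rewrite !ger0_norm// ltW.
  have hn' : h < 0 by rewrite lt_neqAle h0.
  have [|c cc E] := mvt h 0 hn'; last first.
    by exists c => //; rewrite -opprB E sub0r mulrN opprK.
  by move=> c /andP[c0 cc]; rewrite !ler0_norm// lerN2.
rewrite [dG c t * h]mulrC mulrA mulVf// mul1r.
apply: sb => //; rewrite /ball /= sub0r normrN.
exact: le_lt_trans hs.
Unshelve. all: by end_near. Qed.

End uniform_on_segments.

(** * Families of functions with polynomially bounded derivatives *)

Section classes.
Context {R : realType} {d : nat}.
Local Notation V := 'rV[R]_d.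
Variables (D : Type) (B : D -> set V) (N : D -> R).
Hypothesis Bo : forall a, open (B a).
Hypothesis N1 : forall a, 1 <= N a.

Section one_parameter_space.
Context {Th : topologicalType}.
Implicit Types (g h : D -> Th -> V -> R) (w : Th -> R).

Definition jcont g := forall a th x, B a x ->
  {for (th, x), continuous (fun p : Th * V => g a p.1 p.2)}.

Definition polybounded w g := exists (C : R) (q : nat), 0 <= C /\
  forall a th x, B a x -> `|g a th x| <= C * N a ^+ q * w th.

Definition pdf (j : 'I_d) g : D -> Th -> V -> R := fun a th x => pd j (g a th) x.

(* The constants C and q must not depend on the element a of D: D stands for the
   collection of all admissible data, and N a for the norms of the data a, so that
   C * N a ^+ q is a bound which is polynomial in these norms. *)
Fixpoint wclass w (k : nat) g : Prop :=
  [/\ jcont g, polybounded w g &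
      if k is k'.+1 then
        (forall a th x j, B a x -> derivable (g a th) x (ej j)) /\
        (forall j, wclass w k' (pdf j g))
      else True].

Lemma wclass_jcont w k g : wclass w k g -> jcont g. Proof. by case: k => [|k] []. Qed.

Lemma wclass_bounded w k g : wclass w k g -> polybounded w g.
Proof. by case: k => [|k] []. Qed.

Lemma wclass_derivable w k g a th x j :
  wclass w k.+1 g -> B a x -> derivable (g a th) x (ej j).
Proof. by move=> [_ _ [H _]]; exact: H. Qed.

Lemma wclass_pdf w k g j : wclass w k.+1 g -> wclass w k (pdf j g).
Proof. by move=> [_ _ [_ H]]; exact: H. Qed.

Lemma is_derive_pdf w k g a th x j :
  wclass w k.+1 g -> B a x -> is_derive x (ej j) (g a th) (pdf j g a th x).
Proof. by move=> G Bx; apply: derivableP; exact: wclass_derivable G Bx. Qed.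

Lemma near_ball a x : B a x -> \forall z \near x, B a z.
Proof. move=> Bx; have H : open_nbhs x (B a) by split. exact: open_nbhs_nbhs H. Qed.

Lemma jcont_ext g h : (forall a th x, B a x -> g a th x = h a th x) ->
  jcont g -> jcont h.
Proof.
move=> E gc a th x Bx.
suff : h a p.1 p.2 @[p --> (th, x)] --> h a th x by [].
rewrite -(E a th x Bx).
apply: cvg_trans (gc a th x Bx); apply: near_eq_cvg.
have [U [Ux UB]] : exists U : set V, nbhs x U /\ U `<=` B a.
  by exists (B a); split => //; exact: near_ball.
exists (setT, U) => /=; first by split => //; exact: filterT.
by move=> [t z] [_ /UB Bz]; rewrite /= E.
Qed.

(** Since [B a] is open, functions that agree on it have the same partial derivatives there, and the
    induction can go on. *)
Lemma wclass_ext w k g h : (forall a th x, B a x -> g a th x = h a th x) ->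
  wclass w k g -> wclass w k h.
Proof.
have pb g' h' : (forall a th x, B a x -> g' a th x = h' a th x) ->
    polybounded w g' -> polybounded w h'.
  move=> E [C [q [C0 H]]]; exists C, q; split => // a th x Bx.
  by rewrite -E//; exact: H.
elim: k g h => [|k IH] g h E [gc gb] H.
  by split => //; [exact: jcont_ext gc | exact: pb gb].
split; [exact: jcont_ext gc | exact: pb gb | ].
have nE a th x : B a x -> \forall z \near x, g a th z = h a th z.
  by move=> /near_ball; apply: filterS => z; exact: E.
case: H => gd gk; split.
  move=> a th x j Bx; apply: near_eq_derivable (gd a th x j Bx).
  exact: nE.
move=> j; apply: IH (gk j) => a th x Bx.
by rewrite /pdf /pd; apply: near_eq_derive; exact: nE.
Qed.

Lemma wclass_le w k l g : (l <= k)%N -> wclass w k g -> wclass w l g.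
Proof.
elim: k l g => [|k IH] [|l] g //; first by move=> _ [].
by move=> lk [gc gb [gd gk]]; split => //; split => // j; apply: IH (gk j).
Qed.

Lemma exprN_ge0 a q : 0 <= N a ^+ q.
Proof. by apply: exprn_ge0; exact: le_trans ler01 (N1 a). Qed.

Lemma polybounded_weaken w w' (K : R) g : 0 <= K -> (forall th, w th <= K * w' th) ->
  polybounded w g -> polybounded w' g.
Proof.
move=> K0 ww [C [q [C0 H]]]; exists (C * K), q; split; first exact: mulr_ge0.
move=> a th x Bx; apply: (le_trans (H a th x Bx)).
have -> : C * K * N a ^+ q * w' th = C * N a ^+ q * (K * w' th) by ring.
by rewrite ler_wpM2l// mulr_ge0// exprN_ge0.
Qed.

Lemma wclass_weaken w w' (K : R) k g : 0 <= K -> (forall th, w th <= K * w' th) ->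
  wclass w k g -> wclass w' k g.
Proof.
move=> K0 ww; elim: k g => [|k IH] g [gc gb H].
  by split => //; exact: polybounded_weaken K0 ww gb.
split => //; first exact: polybounded_weaken K0 ww gb.
by case: H => gd gk; split => // j; exact: IH (gk j).
Qed.

Lemma exprN_le a q r : (q <= r)%N -> N a ^+ q <= N a ^+ r.
Proof. by move=> qr; rewrite ler_weXn2l. Qed.

Lemma wclass_cst (c : R) k : wclass (fun=> 1) k (fun _ _ _ => c).
Proof.
have jc (c' : R) : jcont (fun _ _ _ => c') by move=> a th x _; exact: cvg_cst.
have pb (c' : R) : polybounded (fun=> 1) (fun _ _ _ => c').
  by exists `|c'|, 0%N; split => // a th x _; rewrite expr0 !mulr1.
elim: k c => [|k IH] c; split => //; split.
  by move=> *; exact: derivable_cst.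
move=> j; apply: wclass_ext (IH 0) => a th x Bx.
by rewrite /pdf /pd derive_cst.
Qed.

Lemma wclass_add w k g h : (forall th, 0 <= w th) -> wclass w k g -> wclass w k h ->
  wclass w k (fun a th x => g a th x + h a th x).
Proof.
move=> w0; elim: k g h => [|k IH] g h G H.
all: have jc : jcont (fun a th x => g a th x + h a th x)
  by move=> a th x Bx; apply: cvgD; [exact: (wclass_jcont G) | exact: (wclass_jcont H)].
all: have pb : polybounded w (fun a th x => g a th x + h a th x).
1,3: have [C [q [C0 Hg]]] := wclass_bounded G; have [C' [q' [C'0 Hh]]] := wclass_bounded H;
  exists (C + C'), (q + q')%N; split; [exact: addr_ge0|];
  move=> a th x Bx; rewrite (le_trans (ler_normD _ _))// 2!mulrDl lerD//;
  [apply: (le_trans (Hg a th x Bx)) | apply: (le_trans (Hh a th x Bx))];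
  by rewrite ler_wpM2r// ler_wpM2l// exprN_le// ?leq_addr ?leq_addl.
  by split.
have dd a th x j : B a x -> is_derive x (ej j) (fun z => g a th z + h a th z)
    (pdf j g a th x + pdf j h a th x).
  move=> Bx; apply: is_derive_add; first exact: (is_derive_pdf _ _ G Bx).
  exact: (is_derive_pdf _ _ H Bx).
split => //; split; first by move=> a th x j Bx; apply: ex_derive; exact: dd.
move=> j; apply: wclass_ext (IH _ _ (wclass_pdf j G) (wclass_pdf j H)) => a th x Bx.
by rewrite [RHS]/pdf /pd; apply/esym; exact: (@derive_val _ _ _ _ _ _ _ (dd a th x j Bx)).
Qed.

Lemma wclass_mul w w' k g h : (forall th, 0 <= w th) -> (forall th, 0 <= w' th) ->
  wclass w k g -> wclass w' k h ->
  wclass (fun th => w th * w' th) k (fun a th x => g a th x * h a th x).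
Proof.
move=> w0 w'0; elim: k g h => [|k IH] g h G H.
all: have jc : jcont (fun a th x => g a th x * h a th x)
  by move=> a th x Bx; apply: cvgM; [exact: (wclass_jcont G) | exact: (wclass_jcont H)].
all: have pb : polybounded (fun th => w th * w' th) (fun a th x => g a th x * h a th x).
1,3: have [C [q [C0 Hg]]] := wclass_bounded G; have [C' [q' [C'0 Hh]]] := wclass_bounded H;
  exists (C * C'), (q + q')%N; split; [exact: mulr_ge0|];
  move=> a th x Bx; rewrite normrM exprD;
  have -> : C * C' * (N a ^+ q * N a ^+ q') * (w th * w' th) =
    (C * N a ^+ q * w th) * (C' * N a ^+ q' * w' th) by ring.
1,2: by rewrite ler_pM// ?Hg ?Hh.
  by split.
have dd a th x j : B a x -> is_derive x (ej j) (fun z => g a th z * h a th z)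
    (pdf j g a th x * h a th x + g a th x * pdf j h a th x).
  move=> Bx; apply: is_derive_mul; first exact: (is_derive_pdf _ _ G Bx).
  exact: (is_derive_pdf _ _ H Bx).
split => //; split; first by move=> a th x j Bx; apply: ex_derive; exact: dd.
move=> j; have G' := wclass_le (leqnSn k) G; have H' := wclass_le (leqnSn k) H.
have ww th : 0 <= w th * w' th by exact: mulr_ge0.
apply: wclass_ext (wclass_add ww (IH _ _ (wclass_pdf j G) H') (IH _ _ G' (wclass_pdf j H))) => a th x Bx.
by rewrite [RHS]/pdf /pd; apply/esym; exact: (@derive_val _ _ _ _ _ _ _ (dd a th x j Bx)).
Qed.

Lemma wclass_scale w k (c : R) g : (forall th, 0 <= w th) -> wclass w k g ->
  wclass w k (fun a th x => c * g a th x).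
Proof.
move=> w0 G; apply: (@wclass_weaken (fun th => 1 * w th) _ 1) => //.
apply: wclass_mul => //; exact: wclass_cst.
Qed.

Lemma wclass_sum n w k (g : 'I_n -> D -> Th -> V -> R) : (forall th, 0 <= w th) ->
  (forall i, wclass w k (g i)) -> wclass w k (fun a th x => \sum_i g i a th x).
Proof.
move=> w0; elim: n g => [|n IH] g G.
  (* Constants are known to have weight 1, while the empty sum must have weight [w], which may
     vanish; its bound is therefore redone with the constant 0. *)
  apply: (@wclass_ext _ _ (fun _ _ _ => 0)); first by move=> *; rewrite big_ord0.
  have c0 : wclass (fun=> 1) k (fun _ _ _ => 0) by exact: wclass_cst.
  have jc : jcont (fun _ _ _ => 0) by exact: wclass_jcont c0.
  have pb : polybounded w (fun _ _ _ => 0).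
    exists 0, 0%N; split => // a th x _.
    by rewrite normr0 !mul0r.
  elim: k {G c0} => [|k IH]; split => //; split.
    by move=> *; exact: derivable_cst.
  move=> j; apply: wclass_ext IH => a th x _.
  by rewrite /pdf /pd derive_cst.
apply: wclass_ext (wclass_add w0 (G ord0) (IH _ (fun i => G (lift ord0 i)))) => a th x _.
by rewrite big_ord_recl.
Qed.

End one_parameter_space.
End classes.

(** * Composition of families with maps that preserve the domain *)

Section composition.
Context {R : realType} {d : nat}.
Local Notation V := 'rV[R]_d.
Variables (D : Type) (B : D -> set V) (N : D -> R).
Hypothesis Bo : forall a, open (B a).
Hypothesis N1 : forall a, 1 <= N a.

Lemma continuous_pair {X Y Z : topologicalType} (f : X -> Y) (h : X -> Z) (x : X) :
  {for x, continuous f} -> {for x, continuous h} ->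
  {for x, continuous (fun z => (f z, h z))}.
Proof. by move=> fc hc; exact: (cvg_pair fc hc). Qed.

Lemma continuous_snd {X Y : topologicalType} : continuous (@snd X Y).
Proof. by move=> p; exact: cvg_snd. Qed.

(** Serves to insert dummy parameters and to identify independent ones. *)
Lemma wclass_reindex {Th Th' : topologicalType} (s : Th' -> Th) (w : Th -> R) k
    (g : D -> Th -> V -> R) : continuous s -> wclass B N w k g ->
  wclass B N (w \o s) k (fun a th x => g a (s th) x).
Proof.
move=> sc; elim: k g => [|k IH] g [gc gb H].
all: have jc : jcont B (fun a th x => g a (s th) x).
1,3: move=> a th x Bx;
  apply: (@continuous_comp _ _ _ (fun p : Th' * V => (s p.1, p.2)) (fun p => g a p.1 p.2));
  [apply: continuous_pair; [apply: continuous_comp; [exact: cvg_fst | exact: sc] | exact: cvg_snd]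
  |exact: gc].
all: have pb : polybounded B N (w \o s) (fun a th x => g a (s th) x)
  by case: gb => C [q [C0 Hg]]; exists C, q; split => // a th x Bx; exact: Hg.
  by split.
split => //; case: H => gd gk; split => [a th x j Bx|j]; first exact: gd.
exact: IH (gk j).
Qed.

Lemma jcont_slice {Th : topologicalType} (g : D -> Th -> V -> R) a th x :
  jcont B g -> B a x -> {for x, continuous (g a th)}.
Proof.
move=> gc Bx.
apply: (@continuous_comp _ _ _ (fun z : V => (th, z)) (fun p => g a p.1 p.2)).
  by apply: continuous_pair; [exact: cst_continuous | exact: cvg_id].
exact: gc.
Qed.

Section comp.
Context {Th1 Th2 : topologicalType}.
Variables (Y : 'I_d -> D -> Th2 -> V -> R).
Let c a t x : V := \row_i Y i a t x.
Hypothesis cB : forall a t x, B a x -> B a (c a t x).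
Hypothesis Yc : forall i, jcont B (Y i).
Hypothesis Yd : forall i a t x j, B a x -> derivable (Y i a t) x (ej j).

(** The parameter of the outer function and that of the inner map stay apart, so that their weights
    can be followed separately; [wclass_reindex] merges them later. *)
Definition fcomp (g : D -> Th1 -> V -> R) : D -> Th1 * Th2 -> V -> R :=
  fun a p x => g a p.1 (c a p.2 x).

Lemma jcont_fcomp g : jcont B g -> jcont B (fcomp g).
Proof.
move=> gc a [t1 t2] x Bx.
apply: (@continuous_comp _ _ _
  (fun p : (Th1 * Th2) * V => (p.1.1, c a p.1.2 p.2)) (fun p => g a p.1 p.2)).
  apply: continuous_pair; first by apply: continuous_comp; exact: cvg_fst.
  apply: cvg_rV => i; rewrite mxE.
  under eq_fun do rewrite mxE.
  apply: (@continuous_comp _ _ _ (fun p : (Th1 * Th2) * V => (p.1.2, p.2))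
    (fun p => Y i a p.1 p.2)); last exact: (Yc Bx).
  apply: continuous_pair; last exact: cvg_snd.
  by apply: continuous_comp; [exact: cvg_fst | exact: cvg_snd].
by apply: gc; exact: cB.
Qed.

Lemma polybounded_fcomp w g : polybounded B N w g ->
  polybounded B N (w \o fst) (fcomp g).
Proof.
case=> C [q [C0 H]]; exists C, q; split => // a [t1 t2] x Bx.
by apply: H; exact: cB.
Qed.

Lemma is_derive_fcomp w k g a p x j : wclass B N w k.+1 g -> B a x ->
  is_derive x (ej j) (fcomp g a p)
    (\sum_i pdf j (Y i) a p.2 x * fcomp (pdf i g) a p x).
Proof.
move=> G Bx; have Bc := cB p.2 Bx.
apply: (@is_derive_comp_rV _ _ _ (g a p.1) (c a p.2)).
- apply: filterS (near_ball Bo Bc) => z Bz i.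
  exact: wclass_derivable G Bz.
- move=> i; apply: (@jcont_slice _ (pdf i g)) => //.
  exact: wclass_jcont (wclass_pdf i G).
- move=> i; under eq_fun do rewrite mxE.
  by apply: derivableP; exact: Yd.
Qed.

(** Induction through the chain rule: each derivative produces a factor [pdf j (Y i)] of class k -
    1, whose bounded weight is absorbed into the constant. *)
Lemma wclass_fcomp w w2 K k g : (forall t, 0 <= w t) -> (forall t, 0 <= w2 t <= K) ->
  0 <= K -> wclass B N w k g ->
  (forall i j, (0 < k)%N -> wclass B N w2 k.-1 (pdf j (Y i))) ->
  wclass B N (w \o fst) k (fcomp g).
Proof.
move=> w0 w20 K0; elim: k g => [|k IH] g G YK.
  by case: G => gc gb _; split => //; [exact: jcont_fcomp | exact: polybounded_fcomp].
split; [exact/jcont_fcomp/(wclass_jcont G) | exact/polybounded_fcomp/(wclass_bounded G) | ].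
split.
  by move=> a p x j Bx; apply: ex_derive; exact: is_derive_fcomp G Bx.
move=> j; apply: (wclass_ext Bo (g := fun a p x => \sum_i pdf j (Y i) a p.2 x * fcomp (pdf i g) a p x)).
  by move=> a p x Bx; rewrite [RHS]/pdf /pd (@derive_val _ _ _ _ _ _ _ (is_derive_fcomp p j G Bx)).
apply: wclass_sum => // [p|i]; first exact: w0.
apply: (wclass_weaken N1 (w := fun p : Th1 * Th2 => w2 p.2 * w p.1) K0).
  by move=> p /=; rewrite ler_wpM2r//; have /andP[] := w20 p.2.
apply: wclass_mul => //.
- by move=> p; have /andP[] := w20 p.2.
- exact: (wclass_reindex (continuous_snd (X := Th1)) (YK i j isT)).
apply: IH; first exact: wclass_pdf.
move=> i' j' k0; apply: (wclass_le (leq_pred k)) => //; exact: YK.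
Qed.

(** In contrast to [wclass_fcomp], the weight of the first factor of the chain rule is kept: this
    [w2] is the source of the decay in the time of the flow. *)
Lemma wclass_pdf_fcomp w w2 K k g j : (forall t, 0 <= w t) -> (forall t, 0 <= w2 t <= K) ->
  0 <= K -> wclass B N w k.+1 g ->
  (forall i j, wclass B N w2 k (pdf j (Y i))) ->
  wclass B N (fun p => w2 p.2 * w p.1) k (pdf j (fcomp g)).
Proof.
move=> w0 w20 K0 G YK.
apply: (wclass_ext Bo (g := fun a p x => \sum_i pdf j (Y i) a p.2 x * fcomp (pdf i g) a p x)).
  by move=> a p x Bx; rewrite [RHS]/pdf /pd (@derive_val _ _ _ _ _ _ _ (is_derive_fcomp p j G Bx)).
have w2p t : 0 <= w2 t by have /andP[] := w20 t.
apply: wclass_sum => // [p|i]; first exact: mulr_ge0.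
apply: wclass_mul => //.
- exact: (wclass_reindex (continuous_snd (X := Th1)) (YK i j)).
apply: (wclass_fcomp w0 w20 K0); first exact: wclass_pdf.
by move=> i' j' _; apply: (wclass_le (leq_pred k)).
Qed.

End comp.
End composition.

(** * Linear equations depending on parameters *)

Section linear_regularity.
Context {R : realType} {d : nat}.
Local Notation V := 'rV[R]_d.
Variables (D : Type) (B : D -> set V).
Hypothesis Bo : forall a, open (B a).
Context {P : topologicalType}.
Implicit Types (g : D -> P * R -> V -> R).

Lemma jcont_time g a p x : jcont B g -> B a x -> continuous (fun t : R => g a (p, t) x).
Proof.
move=> gc Bx t.
apply: (@continuous_comp _ _ _ (fun s : R => ((p, s), x)) (fun q => g a q.1 q.2)).
  apply: continuous_pair; last exact: cst_continuous.
  by apply: continuous_pair; [exact: cst_continuous | exact: cvg_id].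
exact: gc.
Qed.

Lemma jcont_ucv g a p0 x0 : jcont B g -> B a x0 ->
  ucv (nbhs (p0, x0)) (fun q t => g a (q.1, t) q.2) (fun t => g a (p0, t) x0).
Proof.
move=> gc Bx T e T0 e0.
apply: (@compact_unif_near R (P * V)%type (fun q t => g a (q.1, t) q.2)) => // t.
apply: (@continuous_comp _ _ _ (fun s : (P * V) * R => ((s.1.1, s.2), s.1.2))
   (fun q => g a q.1 q.2)); last exact: gc.
apply: continuous_pair; last first.
  by apply: continuous_comp; [exact: cvg_fst | exact: cvg_snd].
apply: continuous_pair; last exact: cvg_snd.
by apply: continuous_comp; exact: cvg_fst.
Qed.

Lemma near_ball_prod a (p : P) x : B a x -> nbhs (p, x) [set q : P * V | B a q.2].
Proof.
move=> Bx; exists (setT, B a) => /=; last by move=> q [].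
by split; [exact: filterT | exact: (near_ball Bo Bx)].
Qed.

(** A change of time is made at the fixed base point, a change of (p, x) uniformly on a bounded time
    interval; the clamp brings negative times into that interval. *)
Lemma jcont_of_ucv g :
  (forall a p x, B a x -> continuous (fun t : R => g a (p, t) x)) ->
  (forall a p t x, B a x -> g a (p, t) x = g a (p, Num.max t 0) x) ->
  (forall a p x, B a x ->
     ucv (nbhs (p, x)) (fun q t => g a (q.1, t) q.2) (fun t => g a (p, t) x)) ->
  jcont B g.
Proof.
move=> gt gm gu a [p t] x Bx.
suff : g a q.1 q.2 @[q --> ((p, t), x)] --> g a (p, t) x by [].
apply/cvgrPdist_le => e e0.
have e20 : 0 < e / 2 by rewrite divr_gt0.
pose T := `|t| + 1; have T0 : 0 < T by rewrite ltr_wpDl.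
have [[U1 U2] /= [Up Ux] HU] :=
  filterI (gu a p x Bx T _ T0 e20) (near_ball_prod p Bx).
have /cvgrPdist_le /(_ _ e20) gtt := gt a p x Bx t.
have tT : \forall s \near t, s < T.
  by apply: lt_nbhsl; rewrite (le_lt_trans (ler_norm _))// ltrDl.
have [W tW HW] : exists2 W : set R, nbhs t W & forall s : R, W s ->
    `|g a (p, t) x - g a (p, s) x| <= e / 2 /\ s < T.
  by exists (fun s => `|g a (p, t) x - g a (p, s) x| <= e / 2 /\ s < T) => //; apply: filterI.
exists (U1 `*` W, U2) => /=.
  by split => //; exists (U1, W).
move=> [[p' s] x'] /= [[Up' Ws] Ux'].
have [/= h1 Bx'] := HU (p', x') (conj Up' Ux').
have [h2 sT] := HW s Ws.
rewrite -(subrKA (g a (p, s) x)) (splitr e) (le_trans (ler_normD _ _))// lerD//.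
rewrite (gm _ _ s)// (gm _ _ s x')// distrC h1// le_max lexx orbT.
by rewrite ge_max (ltW T0) (ltW sT).
Qed.

Section systems.
Variable n : nat.
Implicit Types (A : 'I_n -> 'I_n -> D -> P * R -> V -> R)
  (b w : 'I_n -> D -> P * R -> V -> R) (c : 'I_n -> R).

(* Functions of time are extended to t < 0 by their value at 0, which makes them
   continuous on the whole line. *)
Definition linsol A b w c := forall a p x, B a x ->
  [/\ forall i, continuous (fun t : R => w i a (p, t) x),
      forall i (t : R), w i a (p, t) x = w i a (p, Num.max t 0) x,
      forall i, w i a (p, 0) x = c i &
      forall i (t : R), 0 < t -> is_derive t 1 (fun t : R => w i a (p, t) x)
        (- (\sum_j A i j a (p, t) x * w j a (p, t) x) + b i a (p, t) x)].

Definition acoercive A (lam : R) := forall a p t x, B a x ->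
  coercive (fun i j => A i j a (p, t) x) lam.

Lemma acoercive_le A (l m : R) : l <= m -> acoercive A m -> acoercive A l.
Proof.
move=> lm Ac a p t x Bx v; apply: le_trans (Ac a p t x Bx v).
by rewrite ler_wpM2r// sumr_ge0// => i _; exact: sqr_ge0.
Qed.

(** The difference between the solutions at a moving and at a fixed point solves the equation of the
    moving point with forcing [F], which tends to 0 uniformly on [0, T]. *)
Lemma linsol_ucv A b w c i a p0 x0 : acoercive A 0 ->
  (forall i j, jcont B (A i j)) -> (forall i, jcont B (b i)) ->
  linsol A b w c -> B a x0 ->
  ucv (nbhs (p0, x0)) (fun q t => w i a (q.1, t) q.2) (fun t => w i a (p0, t) x0).
Proof.
move=> Acoer Ac bc sol Bx T e T0 e0.
have [wc wm w0 wd] := sol a p0 x0 Bx.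
have [C C0 HC] := linear_ode_small n (ltW T0).
pose F k (q : P * V) t :=
  - (\sum_j (A k j a (q.1, t) q.2 - A k j a (p0, t) x0) * w j a (p0, t) x0)
  + (b k a (q.1, t) q.2 - b k a (p0, t) x0).
(* This limit is 0, written in the shape that the rules for [ucv] produce. *)
pose Fl k t := - (\sum_j (A k j a (p0, t) x0 - A k j a (p0, t) x0) * w j a (p0, t) x0)
  + (b k a (p0, t) x0 - b k a (p0, t) x0).
have Fu k : ucv (nbhs (p0, x0)) (F k) (Fl k).
  apply: ucvD.
    apply: ucvN; apply: ucv_sum => j; apply: ucvM.
    - by move=> t; apply: cvgB; exact: (jcont_time (Ac k j) Bx).
    - exact: wc.
    - by apply: ucvD; [exact: jcont_ucv | exact: ucv_cst].
    - exact: ucv_cst.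
  by apply: ucvD; [exact: jcont_ucv | exact: ucv_cst].
have Fl0 k t : Fl k t = 0.
  rewrite /Fl subrr addr0 big1 ?oppr0// => j _.
  by rewrite subrr mul0r.
have eC0 : 0 < e / C by rewrite divr_gt0.
have Fn := filter_forall (nbhs_filter (p0, x0)) (fun k => Fu k T _ T0 eC0).
apply: (filterS _ (filterI (near_ball_prod p0 Bx) Fn)) => -[p x] /= [Bx' HF] t tT.
have [wc' wm' w0' wd'] := sol a p x Bx'.
have -> : e = C * (e / C) by rewrite mulrC divfK// gt_eqF.
apply: (HC (fun i j t => A i j a (p, t) x) (fun i t => w i a (p, t) x - w i a (p0, t) x0)
  (fun i t => F i (p, x) t)) => //.
- by move=> s _; exact: Acoer.
- by move=> k s; apply: cvgB; [exact: wc' | exact: wc].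
- move=> k s /andP[s0 _].
  have := is_derive_sub (wd' k s s0) (wd k s s0).
  move=> /is_derive_eq; apply; rewrite /F /=.
  have -> : \sum_j A k j a (p, s) x * (w j a (p, s) x - w j a (p0, s) x0) =
    \sum_j A k j a (p, s) x * w j a (p, s) x - \sum_j A k j a (p, s) x * w j a (p0, s) x0.
    by rewrite -sumrB; apply: eq_bigr => j _; rewrite mulrBr.
  have -> : \sum_j (A k j a (p, s) x - A k j a (p0, s) x0) * w j a (p0, s) x0 =
    \sum_j A k j a (p, s) x * w j a (p0, s) x0 - \sum_j A k j a (p0, s) x0 * w j a (p0, s) x0.
    by rewrite -sumrB; apply: eq_bigr => j _; rewrite mulrBl.
  by ring.
- by move=> k; rewrite w0 w0' subrr normr0 ltW.
- move=> k s /andP[/ltW s0 /ltW sT].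
  by have := HF k s; rewrite Fl0 subr0; apply; rewrite s0.
- exact: ltW.
Qed.

Lemma linsol_jcont A b w c i : acoercive A 0 ->
  (forall i j, jcont B (A i j)) -> (forall i, jcont B (b i)) ->
  linsol A b w c -> jcont B (w i).
Proof.
move=> Acoer Ac bc sol; apply: jcont_of_ucv.
- by move=> a p x /(sol a p)[].
- by move=> a p t x /(sol a p)[].
- by move=> a p x Bx; exact: (linsol_ucv _ _ Acoer Ac bc sol Bx).
Qed.

End systems.
End linear_regularity.

(** * Differentiation of solutions in the space variable *)

Section linear_differentiation.
Context {R : realType} {d : nat}.
Local Notation V := 'rV[R]_d.
Variables (D : Type) (B : D -> set V) (N : D -> R).
Hypothesis Bo : forall a, open (B a).
Context {P : topologicalType}.
Implicit Types (g : D -> P * R -> V -> R).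

Definition C1 g := [/\ jcont B g,
  forall a th x j, B a x -> derivable (g a th) x (ej j) &
  forall j, jcont B (pdf j g)].

Lemma wclass_C1 w k g : wclass B N w k.+1 g -> C1 g.
Proof.
move=> [gc _ [gd gk]]; split => // j; exact: wclass_jcont (gk j).
Qed.

Lemma line_continuous (v x : V) : continuous (fun h : R => h *: v + x).
Proof.
move=> h; apply: cvgD; last exact: cvg_cst.
by apply: cvgZr_tmp; exact: cvg_id.
Qed.

Lemma near_ball_line a x (v : V) : B a x ->
  exists2 r : R, 0 < r & forall h : R, `|h| < r -> B a (h *: v + x).
Proof.
move=> Bx.
have : \forall h \near (0 : R), B a (h *: v + x).
  apply: (@line_continuous v x 0); rewrite scale0r add0r.
  exact: (near_ball Bo Bx).
move=> /nbhs_ballP[r /= r0 rb]; exists r => // h hr; apply: rb.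
by rewrite /ball /= sub0r normrN.
Qed.

Lemma C1_ucv g a p x j : C1 g -> B a x ->
  ucv (0 : R)^' (fun h t => h^-1 * (g a (p, t) (h *: ej j + x) - g a (p, t) x))
     (fun t => pdf j g a (p, t) x).
Proof.
move=> [gc gd gdc] Bx.
have [r r0 rB] := near_ball_line (ej j) Bx.
have E : 0 *: ej j + x = x by rewrite scale0r add0r.
have H := (@ucv_diffquot R (fun h t => g a (p, t) (h *: ej j + x))
  (fun h t => pdf j g a (p, t) (h *: ej j + x)) r r0); rewrite /= E in H; apply: H.
  move=> h t hr; apply/is_derive_lineP; apply: derivableP.
  by apply: gd; exact: rB.
move=> t.
apply: (@continuous_comp _ _ _ (fun q : R * R => ((p, q.2), q.1 *: ej j + x))
  (fun q => pdf j g a q.1 q.2)); last first.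
  by apply: gdc; rewrite /= scale0r add0r.
apply: continuous_pair.
  by apply: continuous_pair; [exact: cst_continuous | exact: cvg_snd].
apply: (@continuous_comp _ _ _ (fun q : R * R => q.1) (fun h : R => h *: ej j + x)).
  exact: cvg_fst.
exact: line_continuous.
Qed.

Section systems.
Variable n : nat.
Implicit Types (A : 'I_n -> 'I_n -> D -> P * R -> V -> R)
  (b w : 'I_n -> D -> P * R -> V -> R) (c : 'I_n -> R).

(* The partial derivative z of w' = - A w + b in the direction j solves
   z' = - A z + dforcing. *)
Definition dforcing A b w (j : 'I_d) : 'I_n -> D -> P * R -> V -> R :=
  fun i a th x => - (\sum_k pdf j (A i k) a th x * w k a th x) + pdf j (b i) a th x.

(* Common part of the differentiation with respect to the initial data for
   linear and nonlinear equations: it suffices to control the equation satisfied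
   by the difference quotients. *)
Lemma derivable_of_quotients (A : 'I_n -> 'I_n -> R -> R) (gh : 'I_n -> R -> R -> R)
    (gl : 'I_n -> R -> R) (q0 : 'I_n -> R) w a p x j :
  B a x ->
  (forall i k, continuous (A i k)) -> (forall t : R, 0 < t -> coercive (fun i k => A i k t) 0) ->
  (forall i, continuous (gl i)) ->
  (forall i z, B a z -> continuous (fun t : R => w i a (p, t) z)) ->
  (forall i z (t : R), B a z -> w i a (p, t) z = w i a (p, Num.max t 0) z) ->
  let q h i t := h^-1 * (w i a (p, t) (h *: ej j + x) - w i a (p, t) x) in
  (forall i h (t : R), h != 0 -> B a (h *: ej j + x) -> 0 < t ->
    is_derive t 1 (q h i) (- (\sum_k A i k t * q h k t) + gh i h t)) ->
  (forall i, ucv (0 : R)^' (gh i) (gl i)) ->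
  (forall i, q h i 0 @[h --> (0 : R)^'] --> q0 i) ->
  [/\ forall i t, derivable (w i a (p, t)) x (ej j),
      forall i, continuous (fun t : R => pdf j (w i) a (p, t) x),
      forall i (t : R), pdf j (w i) a (p, t) x = pdf j (w i) a (p, Num.max t 0) x,
      forall i, pdf j (w i) a (p, 0) x = q0 i &
      forall i (t : R), 0 < t -> is_derive t 1 (fun t : R => pdf j (w i) a (p, t) x)
        (- (\sum_k A i k t * pdf j (w k) a (p, t) x) + gl i t)].
Proof.
move=> Bx Ac Acoer glc wc wm q qd ghu q0c.
have [r r0 rB] := near_ball_line (ej j) Bx.
have hB : \forall h \near (0 : R)^', h != 0 /\ B a (h *: ej j + x).
  near=> h; split; first by near: h; exact: nbhs_dnbhs_neq.
  by apply: rB; near: h; exact: dnbhs0_lt.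
have qc : \forall h \near (0 : R)^', forall i, continuous (q h i) /\ (forall t : R, 0 < t ->
     is_derive t 1 (q h i) (- (\sum_k A i k t * q h k t) + gh i h t)).
  apply: filterS hB => h [h0 Bh] i; split; last by move=> t; exact: qd.
  move=> t; apply: cvgM; first exact: cvg_cst.
  by apply: cvgB; exact: wc.
have ghu' (T e : R) : 0 < T -> 0 < e -> \forall h \near (0 : R)^',
    forall i (t : R), 0 <= t <= T -> `|gh i h t - gl i t| <= e.
  move=> T0 e0; exact: (filter_forall _ (fun i => ghu i T e T0 e0)).
have [ql [qlc qlm ql0 qld qlu]] := @linear_ode_limit R R (0 : R)^' _ n A q
  (fun h i => gh i h) gl q0 Ac Acoer glc qc ghu' q0c.
have wql i (t : R) : is_derive x (ej j) (w i a (p, t)) (ql i t).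
  suff pos (s : R) : 0 <= s -> is_derive x (ej j) (w i a (p, s)) (ql i s).
    rewrite qlm; have := pos (Num.max t 0); rewrite le_max lexx orbT => /(_ isT).
    apply: near_eq_is_derive; apply: filterS (near_ball Bo Bx) => z Bz.
    by rewrite [RHS]wm.
  move=> s0; have H : q h i s @[h --> (0 : R)^'] --> ql i s.
    apply/cvgrPdist_le => e e0.
    have T0 : 0 < s + 1 by rewrite ltr_wpDl.
    apply: filterS (qlu (s + 1) e T0 e0) => h /(_ i s).
    by rewrite distrC; apply; rewrite s0 lerDl ler01.
  by apply: DeriveDef; [apply/cvg_ex; exists (ql i s); exact: H | apply/cvg_lim => //; exact: H].
have E i t : pdf j (w i) a (p, t) x = ql i t.
  by rewrite /pdf /pd (@derive_val _ _ _ _ _ _ _ (wql i t)).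
split.
- by move=> i t; apply: ex_derive; exact: wql.
- by move=> i; under eq_fun do rewrite E; exact: qlc.
- by move=> i t; rewrite !E.
- by move=> i; rewrite E.
- move=> i t t0; under eq_fun do rewrite E.
  by under eq_bigr do rewrite E; exact: qld.
Unshelve. all: by end_near. Qed.

Lemma linsol_derive A b w c : acoercive B A 0 ->
  (forall i k, C1 (A i k)) -> (forall i, C1 (b i)) -> linsol B A b w c ->
  (forall i a th x j, B a x -> derivable (w i a th) x (ej j)) /\
  (forall j, linsol B A (dforcing A b w j) (fun i => pdf j (w i)) (fun=> 0)).
Proof.
move=> Acoer AC1 bC1 sol.
have Ac i k : jcont B (A i k) by case: (AC1 i k).
have bc i : jcont B (b i) by case: (bC1 i).
have wj i : jcont B (w i) := linsol_jcont Bo Acoer Ac bc sol.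
suff H a p x j : B a x ->
  [/\ forall i t, derivable (w i a (p, t)) x (ej j),
      forall i, continuous (fun t : R => pdf j (w i) a (p, t) x),
      forall i (t : R), pdf j (w i) a (p, t) x = pdf j (w i) a (p, Num.max t 0) x,
      forall i, pdf j (w i) a (p, 0) x = 0 &
      forall i (t : R), 0 < t -> is_derive t 1 (fun t : R => pdf j (w i) a (p, t) x)
        (- (\sum_k A i k a (p, t) x * pdf j (w k) a (p, t) x) + dforcing A b w j i a (p, t) x)].
  split; first by move=> i a [p t] x j /(H a p x j)[].
  by move=> j a p x /(H a p x j)[].
move=> Bx.
have [wc wm w0 wd] := sol a p x Bx.
(* Discrete product rule: the difference of [A] multiplies the solution at the displaced point,
   which converges to the one at [x] by [jcont_ucv]. *)
apply: (derivable_of_quotients (gh := fun i h t =>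
  - (\sum_k (h^-1 * (A i k a (p, t) (h *: ej j + x) - A i k a (p, t) x)) *
     w k a (p, t) (h *: ej j + x))
  + h^-1 * (b i a (p, t) (h *: ej j + x) - b i a (p, t) x)) Bx).
- by move=> i k; exact: jcont_time.
- by move=> t _; exact: Acoer.
- move=> i; rewrite /dforcing => t; apply: cvgD.
    apply: cvgN; apply: cvg_bigsum => k; apply: cvgM; last exact: wc.
    have [_ _ dc] := AC1 i k; exact: (jcont_time (dc j) Bx).
  have [_ _ dc] := bC1 i; exact: (jcont_time (dc j) Bx).
- by move=> i z Bz; have [] := sol a p z Bz.
- by move=> i z t Bz; have [] := sol a p z Bz.
- move=> i h t h0 Bh t0.
  have [_ _ _ wd'] := sol a p (h *: ej j + x) Bh.
  have := @is_deriveZ _ _ _ _ h^-1 t 1 _ (is_derive_sub (wd' i t t0) (wd i t t0)).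
  move=> /is_derive_eq; apply; rewrite /GRing.scale /=.
  have -> : \sum_k A i k a (p, t) x *
      (h^-1 * (w k a (p, t) (h *: ej j + x) - w k a (p, t) x)) =
    h^-1 * (\sum_k A i k a (p, t) x * w k a (p, t) (h *: ej j + x)
      - \sum_k A i k a (p, t) x * w k a (p, t) x).
    by rewrite -sumrB mulr_sumr; apply: eq_bigr => k _; ring.
  have -> : \sum_k h^-1 * (A i k a (p, t) (h *: ej j + x) - A i k a (p, t) x) *
      w k a (p, t) (h *: ej j + x) =
    h^-1 * (\sum_k A i k a (p, t) (h *: ej j + x) * w k a (p, t) (h *: ej j + x)
      - \sum_k A i k a (p, t) x * w k a (p, t) (h *: ej j + x)).
    by rewrite -sumrB mulr_sumr; apply: eq_bigr => k _; ring.
  by ring.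
- move=> i; apply: ucvD; last exact: C1_ucv.
  apply: ucvN; apply: ucv_sum => k; apply: ucvM.
  + have [_ _ dc] := AC1 i k; exact: (jcont_time (dc j) Bx).
  + exact: wc.
  + exact: C1_ucv.
  move=> T e T0 e0.
  have H := jcont_ucv p (wj k) Bx T0 e0.
  have L : (p, h *: ej j + x) @[h --> (0 : R)^'] --> (p, x).
    have L1 : h *: ej j + x @[h --> (0 : R)^'] --> x.
      apply: cvg_within_filter; have := @line_continuous (ej j) x 0.
      by rewrite /continuous_at scale0r add0r.
    exact: (cvg_pair (cvg_cst p) L1).
  by apply: (L _ H).
- move=> i; rewrite /=.
  have E : {near (0 : R)^', (fun=> 0) =1 (fun h => h^-1 * (w i a (p, 0) (h *: ej j + x) - w i a (p, 0) x))}.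
    have [r r0 rB] := near_ball_line (ej j) Bx.
    near=> h; have hr : `|h| < r by near: h; exact: dnbhs0_lt.
    have [_ _ w0' _] := sol a p (h *: ej j + x) (rB h hr).
    by rewrite w0 w0' subrr mulr0.
  by apply: (cvg_trans (near_eq_cvg E)); exact: cvg_cst.
Unshelve. all: by end_near. Qed.

End systems.
End linear_differentiation.

Lemma sqr_le_norm {R : realType} (x y : R) : `|x| <= y -> x ^+ 2 <= y ^+ 2.
Proof.
move=> xy; rewrite -[leLHS]real_normK ?num_real// lerXn2r// nnegrE.
exact: le_trans xy.
Qed.

(** * Decay of solutions and of all their derivatives *)

Section linear_classes.
Context {R : realType} {d : nat}.
Local Notation V := 'rV[R]_d.
Variables (D : Type) (B : D -> set V) (N : D -> R).
Hypothesis Bo : forall a, open (B a).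
Hypothesis N1 : forall a, 1 <= N a.
Context {P : topologicalType}.
Variable wP : P -> R.
Hypothesis wP0 : forall p, 0 <= wP p.

Definition etime (lam t : R) : R := expR (- lam * Num.max t 0).

Definition etw (lam : R) (th : P * R) : R := wP th.1 * etime lam th.2.

Lemma etime_ge0 lam t : 0 <= etime lam t. Proof. exact: expR_ge0. Qed.

Lemma etw_ge0 lam th : 0 <= etw lam th.
Proof. by rewrite mulr_ge0// etime_ge0. Qed.

Lemma etime_pos lam t : 0 <= t -> etime lam t = expR (- lam * t).
Proof. by move=> t0; rewrite /etime max_l. Qed.

Lemma polybounded_unif n {Th : topologicalType} (w : Th -> R)
    (g : 'I_n -> D -> Th -> V -> R) : (forall th, 0 <= w th) ->
  (forall i, polybounded B N w (g i)) ->
  exists (C : R) (q : nat), 0 <= C /\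
    forall i a th x, B a x -> `|g i a th x| <= C * N a ^+ q * w th.
Proof.
move=> w0 H; have [C HC] := choice H; have [q Hq] := choice HC.
exists (\sum_i C i), (\sum_i q i)%N; split.
  by apply: sumr_ge0 => i _; have [] := Hq i.
move=> i a th x Bx; have [C0 Hi] := Hq i.
apply: (le_trans (Hi a th x Bx)); rewrite ler_wpM2r// ler_pM ?(exprN_ge0 N1)//.
  by rewrite (bigD1 i)//= lerDl sumr_ge0// => k _; have [] := Hq k.
by rewrite (exprN_le N1)// (bigD1 i)//= leq_addr.
Qed.

Section systems.
Variable n : nat.
Implicit Types (A : 'I_n -> 'I_n -> D -> P * R -> V -> R)
  (b w : 'I_n -> D -> P * R -> V -> R) (c : 'I_n -> R).

Lemma linsol_polybounded A b w c (lam mu Cc : R) i : lam < mu -> 0 <= Cc ->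
  acoercive B A lam -> (forall i p, `|c i| <= Cc * wP p) ->
  (forall i, polybounded B N (etw mu) (b i)) -> linsol B A b w c ->
  polybounded B N (etw lam) (w i).
Proof.
move=> lm Cc0 Ac cC bb sol.
have [C [q [C0 HC]]] := polybounded_unif (etw_ge0 mu) bb.
pose M := expR (mu - lam)^-1 * (n%:R * (Cc ^+ 2 + C ^+ 2)).
have M0 : 0 <= M.
  by rewrite mulr_ge0 ?expR_ge0// mulr_ge0// addr_ge0// sqr_ge0.
(* [M] bounds the squares, and M <= (M + 1)^2. *)
exists (M + 1), q; split; first exact: addr_ge0.
move=> a [p t'] x Bx.
have [wc wm w0 wd] := sol a p x Bx.
rewrite /etw /etime /= wm; set t := Num.max t' 0.
have t0 : 0 <= t by rewrite le_max lexx orbT.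
(* A common scale for the initial values and the forcing: wP p <= Z because N^q >= 1. *)
pose Z := N a ^+ q * wP p; have Z0 : 0 <= Z by rewrite mulr_ge0// (exprN_ge0 N1).
have Zb : wP p <= Z by rewrite ler_peMl// exprn_ege1.
have b2 s : 0 < s < t -> \sum_k b k a (p, s) x ^+ 2 <=
    n%:R * (C ^+ 2 * Z ^+ 2) * expR (- (2 * mu) * s).
  move=> /andP[s0 _]; rewrite -mulrA; apply: ler_sum_ord => k.
  have := HC k a (p, s) x Bx; rewrite /etw /= etime_pos ?(ltW s0)// => h.
  have -> : C ^+ 2 * Z ^+ 2 * expR (- (2 * mu) * s) = (C * Z * expR (- mu * s)) ^+ 2.
    rewrite !exprMn -expRM_natl; congr (_ * expR _); ring.
  by apply: sqr_le_norm; rewrite (le_trans h)// /Z !mulrA.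
have K0 : 0 <= n%:R * (C ^+ 2 * Z ^+ 2) by rewrite mulr_ge0// mulr_ge0// sqr_ge0.
have wd' k s : 0 < s < t -> is_derive s 1 (fun t : R => w k a (p, t) x)
    (- (\sum_j A k j a (p, s) x * w j a (p, s) x) + b k a (p, s) x).
  by move=> /andP[s0 _]; exact: wd.
have Ac' s : 0 < s < t -> coercive (fun i j => A i j a (p, s) x) lam.
  by move=> _; exact: Ac.
have tt : 0 <= t <= t by rewrite t0 lexx.
have h := linear_energy wc wd' Ac' b2 K0 lm tt.
have c2 : \sum_k w k a (p, 0) x ^+ 2 <= n%:R * (Cc ^+ 2 * Z ^+ 2).
  apply: ler_sum_ord => k; rewrite w0 -exprMn.
  by apply: sqr_le_norm; rewrite (le_trans (cC k p))// ler_wpM2l.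
pose E := expR (- lam * t); have E0 : 0 <= E by exact: expR_ge0.
have h2 : w i a (p, t) x ^+ 2 <= M * (Z * E) ^+ 2.
  apply: (@le_trans _ _ (\sum_k w k a (p, t) x ^+ 2)).
    by rewrite [leRHS](bigD1 i)//= lerDl sumr_ge0// => k _; exact: sqr_ge0.
  apply: (le_trans h).
  have -> : expR (- (2 * lam) * t) = E ^+ 2.
    by rewrite /E -expRM_natl; congr expR; ring.
  have -> : M * (Z * E) ^+ 2 = expR (mu - lam)^-1 *
    (n%:R * (Cc ^+ 2 * Z ^+ 2) + n%:R * (C ^+ 2 * Z ^+ 2)) * E ^+ 2 by rewrite /M; ring.
  by rewrite ler_wpM2r ?sqr_ge0// ler_wpM2l ?expR_ge0// lerD2r.
have -> : (M + 1) * N a ^+ q * (wP p * expR (- lam * t)) = (M + 1) * (Z * E).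
  by rewrite /Z /E !mulrA.
have ZE0 : 0 <= Z * E by exact: mulr_ge0.
have MZ0 : 0 <= (M + 1) * (Z * E) by apply: mulr_ge0 => //; exact: addr_ge0.
rewrite -(@ler_pXn2r _ 2)// ?nnegrE//.
rewrite real_normK ?num_real// exprMn; apply: (le_trans h2).
by rewrite ler_wpM2r ?sqr_ge0//; nra.
Qed.

(** The energy estimate asks for a forcing that decays strictly faster than the solution, so the
    forcing is taken at the rate halfway between [lam] and [gamma]. With all rates below [gamma] on
    both sides, the statement can be iterated. *)
Lemma linsol_bounded (gamma Cc : R) A b w c : 0 <= Cc ->
  acoercive B A gamma -> (forall i p, `|c i| <= Cc * wP p) ->
  (forall lam, lam < gamma -> forall i, polybounded B N (etw lam) (b i)) ->
  linsol B A b w c ->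
  forall lam, lam < gamma -> forall i, polybounded B N (etw lam) (w i).
Proof.
move=> Cc0 Ac cC bb sol lam lg i.
have lm : lam < (lam + gamma) / 2 by rewrite midf_lt.
have mg : (lam + gamma) / 2 < gamma by rewrite midf_lt.
exact: (linsol_polybounded i lm Cc0 (acoercive_le (ltW lg) Ac) cC (bb _ mg) sol).
Qed.

(** A derivative of the solution solves the same equation with zero initial value and a forcing that
    contains [w] itself. The induction hypothesis is thus used twice at order [k]: for the
    derivative, and for [w] inside its forcing. *)
Lemma linsol_wclass (gamma Cc : R) k A b w c :
  0 <= gamma -> 0 <= Cc ->
  acoercive B A gamma -> (forall i p, `|c i| <= Cc * wP p) ->
  (forall i j, wclass B N (fun=> 1) k (A i j)) ->
  (forall lam, lam < gamma -> forall i, wclass B N (etw lam) k (b i)) ->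
  linsol B A b w c ->
  forall lam, lam < gamma -> forall i, wclass B N (etw lam) k (w i).
Proof.
move=> g0; elim: k Cc b w c => [|k IH] Cc b w c Cc0 Ac cC Acls bcls sol lam lg i.
all: have Ac0 : acoercive B A 0 by exact: acoercive_le g0 Ac.
all: have AJ i' j' : jcont B (A i' j') by exact: wclass_jcont (Acls i' j').
all: have bJ i' : jcont B (b i') by exact: wclass_jcont (bcls lam lg i').
all: have wJ : jcont B (w i) by exact: (linsol_jcont Bo Ac0 AJ bJ sol).
all: have wb := linsol_bounded Cc0 Ac cC
  (fun l lg i => wclass_bounded (bcls l lg i)) sol lg i.
  by split.
have [wd dsol] := linsol_derive Bo Ac0 (fun i j => wclass_C1 (Acls i j))
  (fun i => wclass_C1 (bcls lam lg i)) sol.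
split => //; split; first by move=> a th x j; exact: wd.
move=> j; apply: (IH 0 (dforcing A b w j) (fun i => pdf j (w i)) (fun=> 0)) => //.
- by move=> i' p; rewrite normr0 mul0r.
- by move=> i' j'; exact: wclass_le (leqnSn k) (Acls i' j').
move=> mu mg i'; rewrite /dforcing.
have mm th := etw_ge0 mu th.
apply: wclass_add => //; last exact: wclass_pdf (bcls mu mg i').
have S : wclass B N (etw mu) k (fun a th x => \sum_k0 pdf j (A i' k0) a th x * w k0 a th x).
  apply: wclass_sum => // k'.
  apply: (wclass_weaken N1 (w := fun th => 1 * etw mu th) ler01) => //.
  apply: wclass_mul => //; first exact: wclass_pdf (Acls i' k').
  apply: (IH Cc b w c) => // [i0 j0|l lg' i0].
    exact: wclass_le (leqnSn k) (Acls i0 j0).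
  exact: wclass_le (leqnSn k) (bcls l lg' i0).
by apply: (wclass_ext Bo _ (wclass_scale Bo N1 (-1) mm S)) => a th x _; rewrite mulN1r.
Qed.

End systems.
End linear_classes.

(** * The gradient flow *)

Section half_line.
Context {R : realType}.

Lemma max0_ge0 (t : R) : 0 <= Num.max t 0.
Proof. by rewrite le_max lexx orbT. Qed.

Lemma max0K (t : R) : Num.max (Num.max t 0) 0 = Num.max t 0.
Proof. by rewrite max_l// max0_ge0. Qed.

Lemma continuous_max0 (f : R -> R) : f @ 0^'+ --> f 0 ->
  (forall t : R, 0 < t -> {for t, continuous f}) ->
  continuous (fun t : R => f (Num.max t 0)).
Proof.
move=> f0 fc t.
have [t0|t0|t0] := ltgtP t 0.
- have E : {near t, (fun=> f 0) =1 (fun s => f (Num.max s 0))}.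
    near=> s; rewrite max_r//; apply/ltW; near: s; exact: lt_nbhsl.
  suff : f (Num.max s 0) @[s --> t] --> f 0 by rewrite /continuous_at max_r// ltW.
  by apply: (cvg_trans (near_eq_cvg E)); exact: cvg_cst.
- have E : {near t, f =1 (fun s => f (Num.max s 0))}.
    near=> s; rewrite max_l//; apply/ltW; near: s; exact: lt_nbhsr.
  suff : f (Num.max s 0) @[s --> t] --> f t by rewrite /continuous_at max_l// ltW.
  by apply: (cvg_trans (near_eq_cvg E)); exact: fc.
- rewrite t0; suff : f (Num.max s 0) @[s --> (0 : R)] --> f 0.
    by rewrite /continuous_at max_l.
  apply/cvgrPdist_le => e e0.
  have /cvgrPdist_le /(_ _ e0) := f0; rewrite near_withinE.
  apply: filterS => s; case: (ltP 0 s) => [s0 /(_ isT)|s0 _].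
    by [].
  by rewrite subrr normr0 ltW.
Unshelve. all: by end_near. Qed.

Lemma is_derive_max0 (f : R -> R) (t l : R) : 0 < t -> is_derive t 1 f l ->
  is_derive t 1 (fun s : R => f (Num.max s 0)) l.
Proof.
move=> t0; apply: near_eq_is_derive; near=> s.
by rewrite max_l//; apply/ltW; near: s; exact: lt_nbhsr.
Unshelve. all: by end_near. Qed.

Lemma is_derive_coord {d : nat} (y : R -> 'rV[R]_d) (t : R) (l : 'rV[R]_d) i :
  is_derive t 1 y l -> is_derive t 1 (fun s => y s 0 i) (l 0 i).
Proof.
move=> [yd <-]; rewrite (derive_mx yd) mxE; apply: derivableP.
exact: (derivable_mxP _ _ _).1.
Qed.

(* At the first exit time the barrier is reached from below by a function which is
   nonincreasing up to that time. *)
Lemma trapped (rho drho : R -> R) (r : R) : continuous rho -> rho 0 < r ->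
  (forall t : R, 0 < t -> is_derive t 1 rho (drho t)) ->
  (forall t : R, 0 < t -> rho t < r -> drho t <= 0) ->
  forall t : R, 0 <= t -> rho t < r.
Proof.
move=> rc r0 rd dle t t0; rewrite ltNge; apply/negP => rt.
pose S := [set s : R | 0 <= s /\ r <= rho s].
have S0 : S !=set0 by exists t.
have Slb : has_lbound S by exists 0 => s [].
have Si : has_inf S by split.
pose ts := inf S.
have ts0 : 0 <= ts by apply: lb_le_inf => // s [].
have below s : 0 <= s < ts -> rho s < r.
  move=> /andP[s0 st]; rewrite ltNge; apply/negP => rs.
  by move: st; rewrite ltNge => /negP; apply; apply: inf_lbound.
have rts : r <= rho ts.
  rewrite leNgt; apply/negP => rlt.
  have : \forall s \near ts, rho s < r by apply: (cvgr_lt _ (rc ts)).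
  move=> /nbhs_ballP[e /= e0 eb].
  have [s [s0 rs] sts] := inf_adherent e0 Si.
  have ss : ts <= s by apply: inf_lbound.
  have : rho s < r.
    apply: eb; rewrite /ball /= distrC ger0_norm ?subr_ge0//.
    by rewrite ltrBlDl.
  by rewrite ltNge rs.
have : rho ts <= rho 0.
  apply: (derive_le0_le ts0 rc (df := drho)).
  - by move=> s /andP[s0 _]; exact: rd.
  - by move=> s /andP[s0 st]; apply: dle => //; apply: below; rewrite (ltW s0).
by rewrite leNgt (lt_le_trans r0 rts).
Qed.

End half_line.

Section balls.
Context {R : realType} {d : nat}.
Local Notation V := 'rV[R]_d.

Lemma sqnorm_ge0 (x : V) : 0 <= sqnorm x.
Proof. by apply: sumr_ge0 => i _; exact: sqr_ge0. Qed.

Lemma eballE (r : R) (x : V) : 0 < r -> eball r x <-> sqnorm x < r ^+ 2.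
Proof.
move=> r0; rewrite /eball /= /enorm.
rewrite -[X in _ < X <-> _]ger0_norm ?(ltW r0)// -sqrtr_sqr.
by rewrite ltr_sqrt// exprn_gt0.
Qed.

Lemma sqnorm_continuous : continuous (@sqnorm R d).
Proof.
move=> x; apply: (cvg_bigsum (nbhs_filter x)) => i.
by rewrite expr2; under eq_fun do rewrite expr2; apply: cvgM; exact: coord_continuous.
Qed.

Lemma eball_open (r : R) : 0 < r -> open (@eball R d r).
Proof.
move=> r0; rewrite openE => x /= /(eballE _ r0) xr.
have H : \forall z \near x, sqnorm z < r ^+ 2.
  have /cvgr_lt h := @sqnorm_continuous x; exact: h.
rewrite /interior; apply: filterS H => z /= ?; exact/(eballE _ r0).
Qed.

End balls.

Lemma is_derive_quot {R : realType} (f : R -> R) (l : R) : is_derive (0 : R) 1 f l ->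
  h^-1 * (f h - f 0) @[h --> (0 : R)^'] --> l.
Proof.
move=> [fd <-].
have E : (fun h : R => h^-1 *: ((f \o shift 0) (h *: 1) - f 0)) = (fun h => h^-1 * (f h - f 0)).
  by apply/funext => h /=; rewrite [h *: 1]mulr1 addr0.
rewrite -E; exact: fd.
Qed.

Section gradient_flow.
Context {R : realType} {d : nat}.
Local Notation V := 'rV[R]_d.
Variables (D : Type) (rad N : D -> R).
Hypothesis rad0 : forall a, 0 < rad a.
Hypothesis N1 : forall a, 1 <= N a.
Let B a : set V := eball (rad a).
Variables (gamma : R) (F : 'I_d -> D -> V -> R) (m : nat).
Hypothesis gamma0 : 0 < gamma.
Hypothesis Fmono : forall a x z, B a x -> B a z ->
  gamma * sqnorm (x - z) <= \sum_i (x - z) 0 i * (F i a x - F i a z).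
Hypothesis F0 : forall a i, F i a 0 = 0.
Hypothesis Fcls : forall i, wclass B N (fun=> 1) m.+1 (fun a (_ : R) x => F i a x).
Variable y : D -> V -> R -> V.
Hypothesis yflow : forall a x, B a x ->
  [/\ y a x 0 = x, y a x @ 0^'+ --> x &
   forall t : R, 0 < t -> is_derive t 1 (y a x) (- \row_i F i a (y a x t))].
Context {P : topologicalType}.

Let Bo a : open (B a) := @eball_open R d _ (rad0 a).

(** The first component of the parameter is a dummy; it gives the flow the shape required of
    solutions of linear equations with parameters. *)
Definition flowc (i : 'I_d) : D -> P * R -> V -> R :=
  fun a p x => y a x (Num.max p.2 0) 0 i.

Lemma ball0 a : B a 0.
Proof.
apply/(eballE _ (rad0 a)); rewrite /sqnorm big1 ?exprn_gt0// => i _.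
by rewrite mxE expr0n.
Qed.

Lemma flow_cont i a x : B a x -> continuous (fun t : R => y a x (Num.max t 0) 0 i).
Proof.
move=> /yflow [y0 yr yd]; apply: (@continuous_max0 _ (fun s => y a x s 0 i)).
  rewrite y0; apply: (@cvg_comp _ _ _ (y a x) (fun M : V => M 0 i) _ _ _ yr).
  exact: coord_continuous.
move=> t t0; apply/differentiable_continuous/derivable1_diffP; apply: ex_derive.
exact: (is_derive_coord i (yd t t0)).
Qed.

Lemma flow_derive i a x (t : R) : B a x -> 0 < t ->
  is_derive t 1 (fun s : R => y a x (Num.max s 0) 0 i) (- F i a (y a x t)).
Proof.
move=> /yflow [_ _ yd] t0; apply: (is_derive_max0 (f := fun s => y a x s 0 i)) => //.
by have := is_derive_coord i (yd t t0); rewrite !mxE.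
Qed.

Lemma flow_ball a x (t : R) : B a x -> B a (y a x (Num.max t 0)).
Proof.
move=> Bx; apply/(eballE _ (rad0 a)).
pose rho s := sqnorm (y a x (Num.max s 0)).
suff H : forall s : R, 0 <= s -> rho s < rad a ^+ 2.
  by have := H _ (max0_ge0 t); rewrite /rho max0K.
pose drho s := \sum_i 2 * y a x (Num.max s 0) 0 i * (- F i a (y a x s)).
apply: (@trapped _ rho drho).
- move=> s; apply: cvg_bigsum => i.
  by rewrite expr2; under eq_fun do rewrite expr2; apply: cvgM; exact: flow_cont.
- have [y0 _ _] := yflow Bx.
  by rewrite /rho max_l// y0; apply/(eballE _ (rad0 a)).
- move=> s s0; apply: is_derive_bigsum => i; apply: is_derive_sqr.
  exact: flow_derive.
move=> s s0; rewrite /rho /drho max_l ?(ltW s0)// => /(eballE _ (rad0 a)) Bs.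
have := Fmono Bs (ball0 a); rewrite subr0 => h.
have {}h : 0 <= \sum_i y a x s 0 i * F i a (y a x s).
  have := sqnorm_ge0 (y a x s); have := gamma0; move: h.
  under eq_bigr do rewrite F0 subr0.
  by nra.
under eq_bigr do rewrite -mulrA mulrN.
by rewrite -mulr_sumr sumrN; lra.
Qed.

Lemma flow_zero a (t : R) : y a 0 (Num.max t 0) = 0.
Proof.
set t' := Num.max t 0; have t0 : 0 <= t' by exact: max0_ge0.
pose rho s := sqnorm (y a 0 (Num.max s 0)).
pose drho s := \sum_i 2 * y a 0 (Num.max s 0) 0 i * (- F i a (y a 0 s)).
have : rho t' <= rho 0.
  apply: (@derive_le0_le _ rho drho 0 t' t0).
  - move=> s; apply: cvg_bigsum => i.
    rewrite expr2; under eq_fun do rewrite expr2.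
    by apply: cvgM; exact: (flow_cont (ball0 a)).
  - move=> s /andP[s0 _]; apply: is_derive_bigsum => i; apply: is_derive_sqr.
    exact: (flow_derive i (ball0 a) s0).
  move=> s /andP[s0 _]; have Bs := flow_ball s (ball0 a).
  rewrite /drho; rewrite max_l ?(ltW s0)// in Bs *.
  have := Fmono Bs (ball0 a); rewrite subr0 => h.
  have {}h : 0 <= \sum_i y a 0 s 0 i * F i a (y a 0 s).
    have := sqnorm_ge0 (y a 0 s); have := gamma0; move: h.
    under eq_bigr do rewrite F0 subr0.
    by nra.
  under eq_bigr do rewrite -mulrA mulrN.
  by rewrite -mulr_sumr sumrN; lra.
have [y0 _ _] := yflow (ball0 a).
rewrite /rho [Num.max 0 0]max_l// y0 /t' max0K -/t' => h.
have z0 : sqnorm (0 : V) = 0 by rewrite /sqnorm big1// => i _; rewrite mxE expr0n.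
rewrite z0 in h; apply/rowP => i; rewrite mxE; apply/eqP.
rewrite -sqrf_eq0 eq_le sqr_ge0 andbT; apply: le_trans h.
rewrite /sqnorm (bigD1 i)//= lerDl sumr_ge0// => k _; exact: sqr_ge0.
Qed.

(** Monotonicity gives the energy inequality at rate 0 with zero forcing; the factor [expR 1] comes
    from using the general estimate with rates 0 and 1. *)
Lemma flow_lipschitz a x z (t : R) : B a x -> B a z ->
  sqnorm (y a x (Num.max t 0) - y a z (Num.max t 0)) <= expR 1 * sqnorm (x - z).
Proof.
move=> Bx Bz; set t' := Num.max t 0.
have t0 : 0 <= t' by exact: max0_ge0.
pose w i (s : R) := y a x (Num.max s 0) 0 i - y a z (Num.max s 0) 0 i.
have [x0 _ _] := yflow Bx; have [z0 _ _] := yflow Bz.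
have wE s : sqnorm (y a x (Num.max s 0) - y a z (Num.max s 0)) = \sum_i w i s ^+ 2.
  by rewrite /sqnorm; apply: eq_bigr => i _; rewrite /w !mxE.
have w0 : \sum_i w i 0 ^+ 2 = sqnorm (x - z) by rewrite -wE max_l// x0 z0.
have wc i : continuous (w i) by move=> s; apply: cvgB; exact: flow_cont.
have wd i (s : R) : 0 < s < t' -> is_derive s 1 (w i) (- F i a (y a x s) - - F i a (y a z s)).
  by move=> /andP[s0 _]; apply: is_derive_sub; exact: flow_derive.
have ineq (s : R) : 0 < s < t' ->
    \sum_i w i s * (- F i a (y a x s) - - F i a (y a z s)) <=
    - 0 * (\sum_i w i s ^+ 2) + \sum_i w i s * (fun=> 0) s.
  move=> /andP[s0 _]; have Bxs := flow_ball s Bx; have Bzs := flow_ball s Bz.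
  have := Fmono Bxs Bzs; rewrite wE max_l ?(ltW s0)// => h.
  have -> : \sum_i w i s * (fun=> 0) s = 0 by apply: big1 => i _; rewrite mulr0.
  rewrite oppr0 mul0r addr0.
  have -> : \sum_i w i s * (- F i a (y a x s) - - F i a (y a z s)) =
     - \sum_i (y a x s - y a z s) 0 i * (F i a (y a x s) - F i a (y a z s)).
    rewrite -sumrN; apply: eq_bigr => i _; rewrite /w max_l ?(ltW s0)// !mxE; ring.
  rewrite oppr_le0; apply: le_trans h; rewrite mulr_ge0 ?(ltW gamma0)//.
  by apply: sumr_ge0 => i _; exact: sqr_ge0.
have z2 (s : R) : 0 < s < t' -> \sum_(i < d) ((fun=> 0) s : R) ^+ 2 <= 0 * expR (- (2 * 1) * s).
  by move=> _; rewrite mul0r big1// => i _; rewrite expr0n.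
have tt : 0 <= t' <= t' by rewrite t0 lexx.
have := energy_estimate (g := fun _ _ => 0) wc wd ineq z2 (lexx 0) ltr01 tt.
rewrite subr0 invr1 mulr0 oppr0 mul0r expR0 mulr1 addr0 w0 -wE.
by rewrite /t' max0K.
Qed.

Lemma flow_jcont i : jcont B (flowc i).
Proof.
apply: (jcont_of_ucv Bo).
- by move=> a p x Bx; exact: flow_cont.
- by move=> a p t x Bx; rewrite /flowc /= max0K.
move=> a p x Bx T e T0 e0.
have c : expR 1 * sqnorm (q.2 - x) @[q --> (p, x)] --> expR 1 * sqnorm (x - x).
  apply: cvgM; first exact: cvg_cst.
  have c1 : (q : P * V).2 - x @[q --> (p, x)] --> x - x.
    by apply: cvgB; [exact: cvg_snd | exact: cvg_cst].
  exact: (cvg_comp _ _ c1 (@sqnorm_continuous R d (x - x))).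
have s0 : expR 1 * sqnorm (x - x) < e ^+ 2.
  by rewrite subrr /sqnorm big1 ?mulr0 ?exprn_gt0// => k _; rewrite mxE expr0n.
have /cvgr_lt /(_ _ s0) n := c.
apply: (filterS _ (filterI (near_ball_prod Bo p Bx) n)) => -[p' z] /= [Bz h] t tT.
have h2 := flow_lipschitz t Bz Bx.
rewrite -(@ler_pXn2r _ 2)// ?nnegrE ?(ltW e0)// real_normK ?num_real//.
apply: le_trans (ltW (le_lt_trans h2 h)).
rewrite /sqnorm (bigD1 i)//= !mxE lerDl sumr_ge0// => k _; exact: sqr_ge0.
Qed.

Definition hess i k : D -> P * R -> V -> R :=
  fun a p x => pd k (F i a) (y a x (Num.max p.2 0)).

Lemma flow_rowE a (p : P * R) x : \row_i flowc i a p x = y a x (Num.max p.2 0).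
Proof. by apply/rowP => i; rewrite mxE. Qed.

Lemma F_derivable i a x k : B a x -> derivable (F i a) x (ej k).
Proof. by move=> Bx; exact: (@wclass_derivable _ _ _ _ _ _ _ _ _ a (0 : R) x k (Fcls i) Bx). Qed.

Lemma F_pd_continuous i a x k : B a x -> {for x, continuous (pd k (F i a))}.
Proof.
move=> Bx; exact: (@jcont_slice _ _ _ _ _ _ a (0 : R) x (wclass_jcont (wclass_pdf k (Fcls i))) Bx).
Qed.

Lemma F_near_derivable i a x : B a x -> \forall z \near x, forall k, derivable (F i a) z (ej k).
Proof. by move=> Bx; apply: filterS (near_ball Bo Bx) => z Bz k; exact: F_derivable. Qed.

(** Divide the monotonicity inequality at h v + x and x by h^2 and let h tend to 0. *)
Lemma F_coercive a x : B a x -> coercive (fun i k => pd k (F i a) x) gamma.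
Proof.
move=> Bx v; pose v' : V := \row_i v i.
have Fd i : is_derive (0 : R) 1 (fun h : R => F i a (h *: v' + x)) (\sum_k v k * pd k (F i a) x).
  have E : x = 0 *: v' + x by rewrite scale0r add0r.
  rewrite [X in \sum_k v k * pd k _ X]E.
  apply: (@is_derive_comp_rV _ _ _ (F i a) (fun h : R => h *: v' + x)); rewrite -?E.
  - exact: F_near_derivable.
  - by move=> k; exact: F_pd_continuous.
  move=> k; have := @is_deriveZ _ _ _ id (v k) (0 : R) 1 1 (is_derive_id _ _).
  move=> /(is_derive_addr (x 0 k)) /is_derive_eq h.
  have {}h := h _ (mulr1 _); congr (is_derive _ _ _ _): h.
  by apply/funext => s; rewrite !mxE; congr (_ + _); exact: mulrC.
have phid : is_derive (0 : R) 1 (fun h : R => \sum_i v i * F i a (h *: v' + x))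
    (\sum_i v i * \sum_k pd k (F i a) x * v k).
  apply: is_derive_bigsum => i.
  have := is_derive_mul (is_derive_cst (v i) (0 : R) 1) (Fd i).
  move=> /is_derive_eq; apply; rewrite mul0r add0r; congr (_ * _).
  by apply: eq_bigr => k _; rewrite mulrC.
have [r r0 rB] := near_ball_line Bo v' Bx.
have H := is_derive_quot phid.
apply: (cvgr_to_ge H).
near=> h; have h0 : h != 0 by near: h; exact: nbhs_dnbhs_neq.
have Bh : B a (h *: v' + x) by apply: rB; near: h; exact: dnbhs0_lt.
have := Fmono Bh Bx; rewrite addrK.
have -> : sqnorm (h *: v') = h ^+ 2 * \sum_i v i ^+ 2.
  by rewrite mulr_sumr; apply: eq_bigr => i _; rewrite !mxE exprMn.
have -> : \sum_i (h *: v') 0 i * (F i a (h *: v' + x) - F i a x) =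
    h ^+ 2 * (h^-1 * (\sum_i v i * F i a (h *: v' + x) - \sum_i v i * F i a (0 *: v' + x))).
  rewrite -sumrB !mulr_sumr; apply: eq_bigr => i _; rewrite !mxE scale0r add0r.
  by field.
by rewrite mulrCA ler_pM2l// exprn_even_gt0.
Unshelve. all: by end_near. Qed.

Lemma hess_coercive : acoercive B hess gamma.
Proof. by move=> a p t x Bx; apply: F_coercive; exact: flow_ball. Qed.

Lemma flow_ballp a (p : P * R) x : B a x -> B a (\row_i flowc i a p x).
Proof. by move=> Bx; rewrite flow_rowE; exact: flow_ball. Qed.

Lemma flow_row_continuous a (p : P) x t : B a x ->
  {for (t, x), continuous (fun q : R * V => y a q.2 (Num.max q.1 0))}.
Proof.
move=> Bx.
have -> : (fun q : R * V => y a q.2 (Num.max q.1 0)) =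
    (fun q => \row_i flowc i a (p, q.1) q.2).
  by apply/funext => q; rewrite flow_rowE.
apply: (@cvg_rV _ _ _ _ _ _ (nbhs_filter (t, x))) => i; rewrite mxE.
under eq_fun do rewrite mxE.
apply: (@continuous_comp _ _ _ (fun q : R * V => ((p, q.1), q.2))
  (fun q => flowc i a q.1 q.2)); last exact: flow_jcont.
apply: continuous_pair; last exact: cvg_snd.
by apply: continuous_pair; [exact: cst_continuous | exact: cvg_fst].
Qed.

Lemma hess_time_continuous i k a (p : P) x : B a x ->
  continuous (fun t : R => hess i k a (p, t) x).
Proof.
move=> Bx t.
apply: (@continuous_comp _ _ _ (fun s : R => y a x (Num.max s 0)) (pd k (F i a))).
  apply: (@continuous_comp _ _ _ (fun s : R => (s, x))
    (fun q : R * V => y a q.2 (Num.max q.1 0))).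
    by apply: continuous_pair; [exact: cvg_id | exact: cst_continuous].
  exact: (flow_row_continuous p).
by apply: F_pd_continuous; exact: flow_ball.
Qed.

(** The remainder has to be small uniformly in [t] although the base point of the expansion moves
    with [t]. Strict differentiability copes with the moving base point near each time, and
    compactness of [0, T] does the rest. *)
Lemma hess_taylor i a (p : P) x j (T e : R) : B a x -> 0 < e ->
  \forall h \near (0 : R)^', forall t : R, 0 <= t <= T ->
  `|F i a (y a (h *: ej j + x) (Num.max t 0)) - F i a (y a x (Num.max t 0)) -
    \sum_k (flowc k a (p, t) (h *: ej j + x) - flowc k a (p, t) x) * hess i k a (p, t) x| <=
  e * \sum_k `|flowc k a (p, t) (h *: ej j + x) - flowc k a (p, t) x|.
Proof.
move=> Bx e0.
have e20 : 0 < e / 2 by rewrite divr_gt0.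
pose G (h t : R) := y a (h *: ej j + x) (Num.max t 0).
pose Q (h t : R) := `|F i a (G h t) - F i a (G 0 t) -
    \sum_k (G h t - G 0 t) 0 k * pd k (F i a) (G 0 t)| <=
  e * \sum_k `|(G h t - G 0 t) 0 k|.
suff H : \forall h \near (0 : R)^', `[0, T]%classic `<=` Q h.
  apply: filterS H => h Hh t tT; have := Hh t; rewrite /= in_itv /= => /(_ tT).
  rewrite /Q /G scale0r add0r.
  have -> : \sum_k (y a (h *: ej j + x) (Num.max t 0) - y a x (Num.max t 0)) 0 k *
      pd k (F i a) (y a x (Num.max t 0)) =
    \sum_k (flowc k a (p, t) (h *: ej j + x) - flowc k a (p, t) x) * hess i k a (p, t) x.
    by apply: eq_bigr => k _; rewrite !mxE.
  have -> // : \sum_k `|(y a (h *: ej j + x) (Num.max t 0) - y a x (Num.max t 0)) 0 k| =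
    \sum_k `|flowc k a (p, t) (h *: ej j + x) - flowc k a (p, t) x|.
  by apply: eq_bigr => k _; rewrite !mxE.
apply: ((compact_near_coveringP _).1 (@segment_compact R 0 T) R _ Q) => t _.
have G0 s : G 0 s = y a x (Num.max s 0) by rewrite /G scale0r add0r.
have BG s : B a (G 0 s) by rewrite G0; exact: flow_ball.
have strict := strict_differentiability (F_near_derivable i (BG t))
  (fun k => F_pd_continuous (BG t)) e20.
have near_pd : \forall z \near G 0 t, forall k, `|pd k (F i a) (G 0 t) - pd k (F i a) z| <= e / 2.
  apply: (filter_forall (nbhs_filter (G 0 t))) => k.
  by have /cvgrPdist_le /(_ _ e20) := F_pd_continuous (i := i) (k := k) (BG t).
have Gc : {for (t, (0 : R)), continuous (fun q : R * R => G q.2 q.1)}.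
  apply: (@continuous_comp _ _ _ (fun q : R * R => (q.1, q.2 *: ej j + x))
    (fun q : R * V => y a q.2 (Num.max q.1 0))); last first.
    by rewrite /= scale0r add0r; exact: (flow_row_continuous p).
  apply: continuous_pair; first exact: cvg_fst.
  apply: (@continuous_comp _ _ _ (fun q : R * R => q.2) (fun h : R => h *: ej j + x)).
    exact: cvg_snd.
  exact: line_continuous.
have G0c : {for (t, (0 : R)), continuous (fun q : R * R => G 0 q.1)}.
  have E : (fun q : R * R => G 0 q.1) = (fun q : R * R => y a (0 *: ej j + x) (Num.max q.1 0)) by [].
  rewrite E scale0r add0r.
  apply: (@continuous_comp _ _ _ (fun q : R * R => (q.1, x))
    (fun q : R * V => y a q.2 (Num.max q.1 0))); last first.
    exact: (flow_row_continuous p).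
  by apply: continuous_pair; [exact: cvg_fst | exact: cst_continuous].
have S1 : \forall q \near (t, (0 : R)), Q q.2 q.1.
  have [[U1 U2] /= [U1n U2n] HU] := strict.
  have n1 : \forall q \near (t, (0 : R)), U1 (G 0 q.1) by exact: (G0c _ U1n).
  have n2 : \forall q \near (t, (0 : R)), U2 (G q.2 q.1) by exact: (Gc _ U2n).
  have n3 : \forall q \near (t, (0 : R)), forall k,
    `|pd k (F i a) (G 0 t) - pd k (F i a) (G 0 q.1)| <= e / 2 by exact: (G0c _ near_pd).
  apply: (filterS _ (filterI n1 (filterI n2 n3))) => -[s h] /= [u1 [u2 u3]].
  have := HU (G 0 s, G h s) (conj u1 u2); rewrite /Q /=.
  set dG := G h s - G 0 s => st.
  (* Strict differentiability uses the derivative at [G 0 t]; passing to the derivative at [G 0 s]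
     costs the second half of [e]. *)
  have -> : F i a (G h s) - F i a (G 0 s) - \sum_k dG 0 k * pd k (F i a) (G 0 s) =
    (F i a (G h s) - F i a (G 0 s) - \sum_k dG 0 k * pd k (F i a) (G 0 t)) +
    \sum_k dG 0 k * (pd k (F i a) (G 0 t) - pd k (F i a) (G 0 s)).
    under [X in _ = _ + X]eq_bigr do rewrite mulrBr.
    by rewrite sumrB; ring.
  rewrite (le_trans (ler_normD _ _))// (splitr e) mulrDl lerD//.
  rewrite (le_trans (ler_norm_sum _ _ _))// mulr_sumr; apply: ler_sum => k _.
  by rewrite normrM mulrC ler_wpM2r// u3.
have [[U1 U2] /= [U1n U2n] HU] := S1.
exists (U1, U2) => /=; last by move=> [s h] /= sh; exact: (HU (s, h) sh).
by split => //; apply: filterS U2n => h Uh _.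
Qed.

(** The difference quotients solve the linearized equation up to the Taylor remainder divided by h,
    which vanishes in the limit because the increments of the flow are O(h) by [flow_lipschitz]. At
    time 0 the flow is the identity, whence the initial values. *)
Lemma flow_derivative :
  (forall i a th x j, B a x -> derivable (flowc i a th) x (ej j)) /\
  (forall j, linsol B hess (fun _ _ _ _ => 0) (fun i => pdf j (flowc i))
     (fun i => (i == j)%:R)).
Proof.
suff H a p x j : B a x ->
  [/\ forall i t, derivable (flowc i a (p, t)) x (ej j),
      forall i, continuous (fun t : R => pdf j (flowc i) a (p, t) x),
      forall i (t : R), pdf j (flowc i) a (p, t) x = pdf j (flowc i) a (p, Num.max t 0) x,
      forall i, pdf j (flowc i) a (p, 0) x = (i == j)%:R &
      forall i (t : R), 0 < t -> is_derive t 1 (fun t : R => pdf j (flowc i) a (p, t) x)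
        (- (\sum_k hess i k a (p, t) x * pdf j (flowc k) a (p, t) x) + 0)].
  split; first by move=> i a [p t] x j /(H a p x j)[].
  by move=> j a p x /(H a p x j)[].
move=> Bx.
pose q (h : R) i (t : R) := h^-1 * (flowc i a (p, t) (h *: ej j + x) - flowc i a (p, t) x).
have hB : \forall h \near (0 : R)^', h != 0 /\ B a (h *: ej j + x).
  have [r r0 rB] := near_ball_line Bo (ej j) Bx.
  near=> h; split; first by near: h; exact: nbhs_dnbhs_neq.
  by apply: rB; near: h; exact: dnbhs0_lt.
apply: (derivable_of_quotients Bo (gh := fun i h t =>
  - (h^-1 * (F i a (y a (h *: ej j + x) (Num.max t 0)) - F i a (y a x (Num.max t 0))
     - \sum_k (flowc k a (p, t) (h *: ej j + x) - flowc k a (p, t) x) * hess i k a (p, t) x)))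
  Bx).
- by move=> i k; exact: hess_time_continuous.
- by move=> t _; apply: (acoercive_le (ltW gamma0) hess_coercive).
- by move=> i; exact: cst_continuous.
- by move=> i z Bz; exact: flow_cont.
- by move=> i z t Bz; rewrite /flowc /= max0K.
- move=> i h t h0 Bh t0.
  have := @is_deriveZ _ _ _ _ h^-1 t 1 _
    (is_derive_sub (flow_derive i Bh t0) (flow_derive i Bx t0)).
  move=> /is_derive_eq; apply; rewrite /GRing.scale /= max_l ?(ltW t0)//.
  have -> : \sum_k hess i k a (p, t) x *
      (h^-1 * (flowc k a (p, t) (h *: ej j + x) - flowc k a (p, t) x)) =
    h^-1 * \sum_k (flowc k a (p, t) (h *: ej j + x) - flowc k a (p, t) x) * hess i k a (p, t) x.
    by rewrite mulr_sumr; apply: eq_bigr => k _; ring.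
  by ring.
- move=> i T e T0 e0.
  (* The increments of the flow sum up to at most c |h|: each is at most [expR 1] times |h|, and the
     added 1 keeps [c] positive. *)
  pose c := expR 1 * d%:R + 1 : R.
  have c0 : 0 < c by rewrite ltr_wpDl// mulr_ge0// expR_ge0.
  have := hess_taylor i p j T Bx (divr_gt0 e0 c0).
  apply: filterS2 hB => h [h0 Bh] Ht t tT.
  rewrite subr0 normrN normrM normfV ler_pdivrMl ?normr_gt0//.
  apply: (le_trans (Ht t tT)).
  have : \sum_k `|flowc k a (p, t) (h *: ej j + x) - flowc k a (p, t) x| <= d%:R * (expR 1 * `|h|).
    apply: ler_sum_ord => k.
    have := flow_lipschitz t Bh Bx; rewrite addrK.
    have -> : sqnorm (h *: ej j : V) = `|h| ^+ 2.
      rewrite /sqnorm (bigD1 j)//= !mxE !eqxx mulr1 big1 ?addr0 ?real_normK ?num_real//.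
      by move=> l /negbTE lj; rewrite !mxE lj andbF mulr0 expr0n.
    move=> hl; rewrite -(@ler_pXn2r _ 2)// ?nnegrE ?mulr_ge0 ?expR_ge0//.
    rewrite real_normK ?num_real// exprMn.
    apply: (@le_trans _ _ (expR 1 * `|h| ^+ 2)).
      apply: le_trans hl.
      rewrite /sqnorm (bigD1 k)//= !mxE lerDl sumr_ge0// => l _; exact: sqr_ge0.
    rewrite ler_wpM2r ?sqr_ge0// expr2 ler_peMl ?expR_ge0//.
    by rewrite -[leLHS]expR0 ler_expR.
  move=> S; apply: (@le_trans _ _ (e / c * (c * `|h|))).
    rewrite ler_wpM2l ?divr_ge0 ?(ltW e0) ?(ltW c0)//.
    apply: (le_trans S); have := normr_ge0 h; rewrite /c; nra.
  by rewrite mulrA divfK ?gt_eqF// mulrC.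
- move=> i; have E : {near (0 : R)^', (fun=> (i == j)%:R) =1 (fun h => q h i 0)}.
    apply: filterS hB => h [h0 Bh]; rewrite /q /flowc /= max_l//.
    have [-> _ _] := yflow Bh; have [-> _ _] := yflow Bx.
    by rewrite !mxE addrK mulrA mulVf// mul1r.
  by apply: (cvg_trans (near_eq_cvg E)); exact: cvg_cst.
Unshelve. all: by end_near. Qed.

Lemma flow_derivable i a th x j : B a x -> derivable (flowc i a th) x (ej j).
Proof. exact: flow_derivative.1. Qed.

Lemma etw1_0 (th : P * R) : 0 <= etw (fun _ : P => 1) 0 th <= 1.
Proof. by rewrite /etw /etime oppr0 !mul0r expR0 mulr1 ler01 lexx. Qed.

(** One half of a bootstrap: class [k] of the Hessian along the flow needs the first derivatives of
    the flow only in class k - 1, and with mere boundedness. The linearized equation then puts these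
    derivatives in class [k], with decay, in [flow_wclass]. *)
Lemma hess_wclass k : (k <= m)%N ->
  (forall i j, (0 < k)%N ->
     wclass B N (etw (fun _ : P => 1) 0) k.-1 (pdf j (flowc i))) ->
  forall i j, wclass B N (fun=> 1) k (hess i j).
Proof.
move=> km H i j.
have hc : wclass B N (fun=> 1) k (pdf j (fun a (_ : R) x => F i a x)).
  by apply: (wclass_le km); exact: wclass_pdf.
have H1 := wclass_fcomp Bo N1 flow_ballp flow_jcont flow_derivable
  (fun _ => ler01) etw1_0 ler01 hc H.
have sc : continuous (fun p : P * R => ((0 : R), p)).
  by move=> p; apply: continuous_pair; [exact: cst_continuous | exact: cvg_id].
apply: (wclass_ext Bo _ (wclass_reindex sc H1)) => a p x Bx.
by rewrite /fcomp flow_rowE.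
Qed.

Lemma wclass_0 {Th : topologicalType} (w : Th -> R) k : (forall th, 0 <= w th) ->
  wclass B N w k (fun _ _ _ => 0).
Proof.
move=> w0.
have H : wclass B N w k (fun a th x => \sum_(i < 0) (fun=> 0) i).
  by apply: (wclass_sum Bo N1 (g := fun (_ : 'I_0) _ _ _ => 0) w0) => -[].
by apply: (wclass_ext Bo _ H) => a th x _; rewrite big_ord0.
Qed.

Lemma flow_wclass k : (k <= m)%N -> forall lam, lam < gamma -> forall i j,
  wclass B N (etw (fun _ : P => 1) lam) k (pdf j (flowc i)).
Proof.
elim: k => [|k IH] km lam lg i j.
all: apply: (linsol_wclass Bo N1 (wP := fun _ : P => 1) (fun _ => ler01) (ltW gamma0) ler01
  hess_coercive (A := hess) (b := fun _ _ _ _ => 0) (c := fun i => (i == j)%:R) _ _ _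
  (flow_derivative.2 j) lg i).
1,4: by move=> l _; rewrite mulr1 normr_nat; case: (l == j).
2,4: by move=> l _ i'; apply: wclass_0 => th; apply: etw_ge0.
- by apply: hess_wclass.
- by apply: hess_wclass => // i' j' _; apply: IH => //; exact: ltnW.
Qed.

End gradient_flow.

(** * Integrals of exponentially decaying functions *)

Section integrals.
Context {R : realType}.
Notation mu := (@lebesgue_measure R).

Lemma continuous_integrable_segment (h : R -> R) (a b : R) : continuous h ->
  mu.-integrable `[a, b] (EFin \o h).
Proof.
move=> hc; apply: continuous_compact_integrable; first exact: segment_compact.
exact: continuous_subspaceT.
Qed.

Definition antider (h : R -> R) (t : R) : R :=
  Rintegral mu `[0, Num.max t 0] h.

Lemma antider0 h : antider h 0 = 0.
Proof. by rewrite /antider max_l// set_itv1 Rintegral_set1. Qed.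

Lemma antider_max h t : antider h t = antider h (Num.max t 0).
Proof. by rewrite /antider max0K. Qed.

Lemma is_derive_antider h (t : R) : continuous h -> 0 < t ->
  is_derive t 1 (antider h) (h t).
Proof.
move=> hc t0; apply: (is_derive_max0 (f := fun s => Rintegral mu `[0, s] h)) => //.
have tt : t < t + 1 by rewrite ltrDl.
have [fd fE] := continuous_FTC1_closed tt (continuous_integrable_segment 0 (t + 1) hc) t0 (hc t).
by apply: DeriveDef; [exact: fd | rewrite -derive1E fE].
Qed.

Lemma antider_continuous h : continuous h -> continuous (antider h).
Proof.
move=> hc; apply: (continuous_max0 (f := fun s => Rintegral mu `[0, s] h)).
  rewrite set_itv1 Rintegral_set1; apply: cvg_at_right_filter.
  apply: (@parameterized_integral_cvg_left _ 0 1) => //.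
  exact: continuous_integrable_segment.
move=> t t0; apply/differentiable_continuous/derivable1_diffP.
have tt : t < t + 1 by rewrite ltrDl.
by have [] := continuous_FTC1_closed tt (continuous_integrable_segment 0 (t + 1) hc) t0 (hc t).
Qed.

Lemma integral_expRy (lam t C : R) : 0 < lam -> 0 <= C ->
  (\int[mu]_(x in `[t, +oo[) (C * expR (- lam * x))%:E = (C / lam * expR (- lam * t))%:E)%E.
Proof.
move=> l0 C0.
have cE : continuous (fun x : R => C * expR (- lam * x)).
  move=> x; apply: cvgM; first exact: cvg_cst.
  apply: continuous_comp; last exact: continuous_expR.
  exact: mulrl_continuous.
have dE (x : R) : is_derive x 1 (fun x : R => - (C / lam) * expR (- lam * x)) (C * expR (- lam * x)).
  have := @is_deriveZ _ _ _ _ (- (C / lam)) x 1 _ (is_derive_expRM (- lam) x).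
  move=> /is_derive_eq; apply; rewrite /GRing.scale /= mulrA; congr (_ * _).
  by field; rewrite gt_eqF.
rewrite (@ge0_continuous_FTC2y _ _ (fun x => - (C / lam) * expR (- lam * x)) t 0).
- by rewrite -EFinD add0r mulNr opprK.
- by move=> x _; rewrite mulr_ge0// expR_ge0.
- exact: continuous_subspaceT.
- rewrite -[X in _ --> X](mulr0 (- (C / lam))); apply: cvgM; first exact: cvg_cst.
  have h : (fun x : R => lam * x) @ +oo --> +oo.
    by apply: gt0_cvgMry.
  have -> : (fun x : R => expR (- lam * x)) = (fun x : R => expR (- x)) \o (fun x => lam * x).
    by apply/funext => x /=; rewrite mulNr.
  exact: (cvg_comp _ _ h (@cvgr_expR R)).
- by move=> x _; apply: ex_derive.
- apply: cvg_at_right_filter; apply: cvgM; first exact: cvg_cst.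
  apply: continuous_comp; last exact: continuous_expR.
  exact: mulrl_continuous.
- by move=> x _; rewrite derive1E; apply: derive_val.
Qed.

Lemma expR_integrable (lam t C : R) : 0 < lam -> 0 <= C ->
  mu.-integrable `[t, +oo[ (EFin \o (fun x => C * expR (- lam * x))).
Proof.
move=> l0 C0; apply/integrableP; split.
  apply/measurable_EFinP; apply: measurable_funTS; apply: continuous_measurable_fun.
  move=> x; apply: cvgM; first exact: cvg_cst.
  apply: continuous_comp; last exact: continuous_expR.
  exact: mulrl_continuous.
under eq_integral do rewrite /= ger0_norm ?mulr_ge0 ?expR_ge0//.
by rewrite integral_expRy// ltry.
Qed.

Lemma exp_decay_integrable (h : R -> R) (lam t C : R) : 0 < lam -> 0 <= C ->
  continuous h -> (forall s : R, t <= s -> `|h s| <= C * expR (- lam * s)) ->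
  mu.-integrable `[t, +oo[ (EFin \o h).
Proof.
move=> l0 C0 hc hb; apply: le_integrable (expR_integrable t l0 C0) => //.
  apply/measurable_EFinP; apply: measurable_funTS; exact: continuous_measurable_fun.
move=> x /=; rewrite in_itv /= andbT => tx; rewrite lee_fin.
by rewrite [leRHS]ger0_norm ?mulr_ge0 ?expR_ge0// hb.
Qed.

Lemma exp_decay_tail (h : R -> R) (lam t C : R) : 0 < lam -> 0 <= C -> 0 <= t ->
  continuous h -> (forall s : R, 0 <= s -> `|h s| <= C * expR (- lam * s)) ->
  `|Rintegral mu `[0, +oo[ h - antider h t| <= C / lam * expR (- lam * t).
Proof.
move=> l0 C0 t0 hc hb.
rewrite /antider max_l// Rintegral_itvB; last 2 first.
- by rewrite bnd_simp.
- by [].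
have hbt (s : R) : t <= s -> `|h s| <= C * expR (- lam * s).
  by move=> ts; apply: hb; exact: le_trans ts.
have ih := exp_decay_integrable l0 C0 hc hbt.
have ih' : mu.-integrable `]t, +oo[ (EFin \o h).
  by apply: integrableS ih => //; apply: subset_itvr; rewrite bnd_simp.
rewrite Rintegral_itv_obnd_cbnd//.
apply: (le_trans (le_normr_Rintegral _ ih)) => //.
apply: (@le_trans _ _ (Rintegral mu `[t, +oo[ (fun x => C * expR (- lam * x)))).
  apply: le_Rintegral => //.
  - by have := integrable_norm ih.
  - exact: expR_integrable.
  by move=> x /=; rewrite in_itv /= andbT => tx; exact: hbt.
by rewrite /Rintegral integral_expRy.
exact: exp_decay_integrable l0 C0 hc hb.
Qed.

(** The function [f] below has zero derivative, and its values at [t] and 0 are the two sides. At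
    the fixed point 0 of the flow this makes the integral defining a coefficient depend on [t]
    through its upper limit only. *)
Lemma Rintegral_reverse (h : R -> R) (t : R) : continuous h -> 0 <= t ->
  Rintegral mu `[0, t] (fun s => h (t - s)) = antider h t.
Proof.
move=> hc t0.
pose k s := h (t - s).
have subc : continuous (fun s : R => t - s).
  by move=> s; apply: cvgB; [exact: cvg_cst | exact: cvg_id].
have kc : continuous k.
  by move=> s; apply: continuous_comp; [exact: subc | exact: hc].
have -> : Rintegral mu `[0, t] k = antider k t by rewrite /antider max_l.
pose f s := antider k s + antider h (t - s).
have fc : continuous f.
  move=> s; apply: cvgD; first exact: antider_continuous.
  exact: (cvg_comp _ _ (subc s) (@antider_continuous h hc (t - s))).
have fd s : 0 < s < t -> is_derive s 1 f 0.
  move=> /andP[s0 st].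
  have d1 := is_derive_antider kc s0.
  have ts : 0 < t - s by rewrite subr_gt0.
  have d2 : is_derive s 1 (fun s => t - s) (- 1).
    have := is_derive_sub (is_derive_cst t s 1) (is_derive_id s 1).
    by move=> /is_derive_eq; apply; rewrite sub0r.
  have d3 := @is_derive1_comp _ (antider h) (fun s => t - s) s _ _ (is_derive_antider hc ts) d2.
  have := is_derive_add d1 d3.
  by move=> /is_derive_eq; apply; rewrite mulrN1 subrr.
have le1 : f t <= f 0 by apply: (derive_le0_le t0 fc fd).
have le2 : - f t <= - f 0.
  apply: (derive_le0_le (f := fun s => - f s) (df := fun=> - 0) t0).
  - by move=> s; apply: cvgN; exact: fc.
  - by move=> s /fd fs; exact: is_deriveN.
  - by move=> s _; rewrite oppr0.
have : f t = f 0 by apply/eqP; rewrite eq_le le1 -lerN2.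
by rewrite /f !subrr subr0 !antider0 addr0 add0r.
Qed.

End integrals.

(** * The coefficients of the expansion *)

Section expansion.
Context {R : realType} {d : nat}.
Local Notation V := 'rV[R]_d.
Variables (D : Type) (rad N : D -> R).
Hypothesis rad0 : forall a, 0 < rad a.
Hypothesis N1 : forall a, 1 <= N a.
Let B a : set V := eball (rad a).
Variables (Xi : D -> finType) (p : forall a, Xi a -> R) (f : D -> V -> R)
  (fxi : forall a, Xi a -> V -> R) (phi : D -> V -> R) (y : D -> V -> R -> V).
Variables (gamma : R) (m : nat).
Hypothesis gamma0 : 0 < gamma.
Let F (i : 'I_d) (a : D) : V -> R := pd i (f a).
Let Sg (i j : 'I_d) (a : D) : V -> R := Sig (@p a) (f a) (@fxi a) i j.
Hypothesis Fmono : forall a x z, B a x -> B a z ->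
  gamma * sqnorm (x - z) <= \sum_i (x - z) 0 i * (F i a x - F i a z).
Hypothesis F0 : forall a i, F i a 0 = 0.
Hypothesis yflow : forall a x, B a x ->
  [/\ y a x 0 = x, y a x @ 0^'+ --> x &
   forall t : R, 0 < t -> is_derive t 1 (y a x) (- \row_i F i a (y a x t))].
Hypothesis Fcls : forall i, wclass B N (fun=> 1) m.+1 (fun a (_ : R) x => F i a x).
Hypothesis phicls : wclass B N (fun=> 1) m.+1 (fun a (_ : R) x => phi a x).
Hypothesis Sgcls : forall i j, wclass B N (fun=> 1) m.-1 (fun a (_ : R) x => Sg i j a x).

Let Bo a : open (B a) := @eball_open R d _ (rad0 a).

Definition L2f {Th : Type} (g : D -> Th -> V -> R) : D -> Th -> V -> R :=
  fun a th x => L2 (@p a) (f a) (@fxi a) (g a th) x.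

Definition uf (n : nat) : D -> R -> V -> R :=
  fun a t x => u (@p a) (f a) (@fxi a) (phi a) (y a) n x (Num.max t 0).

Lemma wclass_const_reindex {Th : topologicalType} k (g : D -> V -> R) :
  wclass B N (fun _ : R => 1) k (fun a _ x => g a x) ->
  wclass B N (fun _ : Th => 1) k (fun a _ x => g a x).
Proof.
move=> G; apply: (wclass_reindex (s := fun _ : Th => (0 : R)) _ G).
exact: cst_continuous.
Qed.

Lemma gradsq_wclass j : wclass B N (fun _ : R => 1) m
  (fun a _ x => pd j (fun w => sqnorm (grad (f a) w)) x).
Proof.
have H : wclass B N (fun _ : R => 1) m.+1 (fun a _ w => sqnorm (grad (f a) w)).
  apply: (wclass_ext Bo (g := fun a _ w => \sum_i F i a w * F i a w)).
    move=> a _ x _; rewrite /sqnorm; apply: eq_bigr => i _.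
    by rewrite /grad mxE expr2.
  apply: (wclass_sum Bo N1) => // i.
  apply: (wclass_weaken N1 (w := fun _ => 1 * 1) ler01); first by move=> _; rewrite !mulr1.
  exact: wclass_mul.
exact: (wclass_pdf j H).
Qed.

(** Two derivatives of [g] are lost, one of which is already taken in [pdf j g]. The regularity m -
    1 of Sigma is what limits [k]. *)
Lemma L2_wclass {Th : topologicalType} (w : Th -> R) k (g : D -> Th -> V -> R) :
  (forall th, 0 <= w th) -> (k <= m.-1)%N ->
  (forall j, wclass B N w k.+1 (pdf j g)) -> wclass B N w k (L2f g).
Proof.
move=> w0 km H.
have w1 th : 1 * w th <= 1 * w th by [].
apply: wclass_add => //.
  apply: wclass_scale => //; apply: wclass_sum => // j.
  apply: (wclass_weaken N1 ler01 w1); apply: wclass_mul => //.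
    apply: wclass_const_reindex; apply: wclass_le (gradsq_wclass j).
    exact: leq_trans km (leq_pred m).
  exact: wclass_le (leqnSn k) (H j).
apply: wclass_scale => //; apply: wclass_sum => // i; apply: wclass_sum => // j.
apply: (wclass_weaken N1 ler01 w1); apply: wclass_mul => //.
  by apply: wclass_const_reindex; apply: wclass_le (Sgcls i j).
exact: wclass_pdf (H j).
Qed.

Notation Yc := (@flowc R d D y R).

Lemma etime_le1 (lam t : R) : 0 <= lam -> etime lam t <= 1.
Proof.
move=> l0; rewrite /etime -[leRHS]expR0 ler_expR mulNr oppr_le0.
by rewrite mulr_ge0// max0_ge0.
Qed.

Lemma etw1_le1 (lam : R) (th : R * R) : 0 <= lam -> 0 <= etw (fun=> 1) lam th <= 1.
Proof. by move=> l0; rewrite /etw mul1r etime_ge0 etime_le1. Qed.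

(** No decay is claimed for [uf n] itself, which tends to a constant; [k] counts the derivatives
    beyond the first. Rates are nonnegative so that the weights of the flow are at most 1. *)
Definition uf_decay n k := (forall a t x j, B a x -> derivable (uf n a t) x (ej j)) /\
  forall lam : R, 0 <= lam < gamma -> forall j, wclass B N (etime lam) k (pdf j (uf n)).

Let Ycont := flow_jcont rad0 gamma0 Fmono F0 yflow (P := R).
Let Yder := flow_derivable rad0 gamma0 Fmono F0 Fcls yflow (P := R).
Let Yball := flow_ballp rad0 gamma0 Fmono F0 yflow (P := R).
Let Ycls := flow_wclass rad0 N1 gamma0 Fmono F0 Fcls yflow (P := R).

Lemma uf0_decay : uf_decay 0 m.
Proof.
pose s (t : R) : R * (R * R) := (0, (0, t)).
have sc : continuous s.
  move=> t; apply: continuous_pair; first exact: cst_continuous.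
  by apply: continuous_pair; [exact: cst_continuous | exact: cvg_id].
have E a t : uf 0 a t = fcomp Yc (fun a (_ : R) x => phi a x) a (s t).
  by apply/funext => x; rewrite /uf /= /fcomp flow_rowE.
split.
  move=> a t x j Bx; rewrite E.
  by apply: ex_derive; exact: (is_derive_fcomp Bo Yball Yder _ _ phicls Bx).
move=> lam /andP[l0 lg] j.
have H := wclass_pdf_fcomp Bo N1 Yball Ycont Yder j (fun _ => ler01)
  (fun th => etw1_le1 th l0) ler01 phicls (fun i j => Ycls (leqnn m) lg i j).
have H1 := wclass_reindex sc H.
apply: (wclass_ext Bo (g := fun a t x => pdf j (fcomp Yc (fun a (_ : R) x => phi a x)) a (s t) x)).
  by move=> a t x Bx; rewrite /pdf E.
apply: (wclass_weaken N1 ler01 _ H1) => t.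
by rewrite /= /etw /= !mul1r mulr1.
Qed.

Section step.
Variables (n k : nat).
Hypothesis km : (k.+1 <= m.-1)%N.
Hypothesis un : uf_decay n k.+2.

(** For q = (T, s) the outer function is taken at time T - s and the flow at time s; the 0 fills the
    dummy parameter of the flow. *)
Let sigma (q : R * R) : R * (R * R) := (q.1 - q.2, (0, q.2)).

Let sigmac : continuous sigma.
Proof.
move=> q; rewrite /sigma; apply: (continuous_pair (f := fun q => q.1 - q.2)); last first.
  by apply: continuous_pair; [exact: cst_continuous | exact: cvg_snd].
by apply: cvgB; [exact: cvg_fst | exact: cvg_snd].
Qed.

Definition integrand : D -> R * R -> V -> R :=
  fun a q x => fcomp Yc (L2f (uf n)) a (sigma q) x.

Lemma integrand_wclass lam : 0 <= lam < gamma ->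
  wclass B N (fun q => etime lam (q.1 - q.2)) k.+1 integrand.
Proof.
move=> lg; have [l0 l1] := andP lg.
have kml : (k.+1 <= m)%N by exact: leq_trans km (leq_pred m).
have HL := L2_wclass (etime_ge0 lam) km (un.2 lam lg).
have H := wclass_fcomp Bo N1 Yball Ycont Yder (etime_ge0 lam) (fun th => etw1_le1 th l0) ler01 HL.
apply: (wclass_reindex sigmac (H _)) => i j _ /=.
by apply: Ycls => //; exact: ltnW.
Qed.

(** The chain rule adds e^(- lam s) to the factor e^(- lam (T - s)), leaving e^(- lam T), which is
    constant in the integration time s. The integral solves an equation with coercivity 0, for which
    only rates below 0 are available; hence [mu]. *)
Lemma integrand_pdf_wclass lam mu j : 0 <= lam < gamma -> mu < 0 ->
  wclass B N (etw (etime lam) mu) k (pdf j integrand).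
Proof.
move=> lg m0; have [l0 l1] := andP lg.
have kml : (k.+1 <= m)%N by exact: leq_trans km (leq_pred m).
have HL := L2_wclass (etime_ge0 lam) km (un.2 lam lg).
have H := wclass_pdf_fcomp Bo N1 Yball Ycont Yder j (etime_ge0 lam)
  (fun th => etw1_le1 th l0) ler01 HL (fun i j => Ycls (ltnW kml) l1 i j).
apply: (wclass_weaken N1 ler01 _ (wclass_reindex sigmac H)) => -[T s] /=.
rewrite /etw /etime /= !mul1r -!expRD ler_expR.
(* Subadditivity of the positive part replaces T = s + (T - s) for clamped times. *)
have h : Num.max T 0 <= Num.max s 0 + Num.max (T - s) 0.
  rewrite ge_max; apply/andP; split; last by rewrite addr_ge0 ?max0_ge0.
  apply: (@le_trans _ _ (s + (T - s))); first by rewrite addrC subrK.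
  by apply: lerD; rewrite le_max lexx.
have := max0_ge0 s; move: h.
set x := Num.max s 0; set y0 := Num.max (T - s) 0; set z := Num.max T 0 => h x0.
nra.
Qed.

Definition primitive : D -> R * R -> V -> R :=
  fun a q x => antider (fun s => integrand a (q.1, s) x) q.2.

(** Read as the solution of a linear equation with A = 0, the integral is differentiated in x by
    [linsol_derive], which takes the place of differentiation under the integral sign. *)
Lemma primitive_linsol : linsol (n := 1) B (fun _ _ _ _ _ => 0) (fun _ => integrand)
  (fun _ => primitive) (fun=> 0).
Proof.
have l0 : (0 : R) <= 0 < gamma by rewrite lexx gamma0.
have ic := wclass_jcont (integrand_wclass l0).
move=> a T x Bx; have hc := jcont_time (p := T) ic Bx.
split => [_|_ t|_|_ t t0].
- exact: (antider_continuous hc).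
- exact: (antider_max (fun s => integrand a (T, s) x) t).
- exact: (antider0 (fun s => integrand a (T, s) x)).
rewrite big1 => [|i _]; last by rewrite mul0r.
by rewrite oppr0 add0r; exact: (is_derive_antider hc t0).
Qed.

Lemma primitive_decay : (forall a th x j, B a x -> derivable (primitive a th) x (ej j)) /\
  forall lam mu, 0 <= lam < gamma -> mu < 0 -> forall j,
    wclass B N (etw (etime lam) mu) k (pdf j primitive).
Proof.
have l0 : (0 : R) <= 0 < gamma by rewrite lexx gamma0.
have Ac0 : acoercive B (fun (_ _ : 'I_1) (_ : D) (_ : R * R) (_ : V) => 0) 0.
  move=> a q t x Bx v; rewrite mul0r big1// => i _.
  by rewrite big1 ?mulr0// => j _; rewrite mul0r.
have c0 l : wclass B N (fun _ : R * R => 1) l (fun _ _ _ => 0) by exact: wclass_cst.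
have [pd' psol] := linsol_derive Bo Ac0 (fun _ _ => wclass_C1 (c0 1%N))
  (fun _ => wclass_C1 (integrand_wclass l0)) primitive_linsol.
split; first by move=> a th x j; exact: (pd' ord0).
move=> lam mu lg m0 j.
apply: (linsol_wclass Bo N1 (etime_ge0 lam) (lexx 0) (lexx 0) Ac0 (c := fun=> 0) _ _ _ (psol j) m0 ord0).
- by move=> i t; rewrite normr0 mul0r.
- by move=> i i'; exact: c0.
move=> l lg0 i; apply: (wclass_ext Bo _ (integrand_pdf_wclass j lg lg0)) => a q x Bx.
rewrite /dforcing big1 ?oppr0 ?add0r// => i' _.
by rewrite /pdf /pd derive_cst mul0r.
Qed.

Lemma uf_primitive a t x : uf n.+1 a t x = primitive a (Num.max t 0, Num.max t 0) x.
Proof.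
have iE T r : integrand a (T, r) x = L2f (uf n) a (T - r) (y a x (Num.max r 0)).
  rewrite /integrand /fcomp /sigma; congr (L2f _ _ _ _).
  exact: (flow_rowE y a ((0 : R), r) x).
rewrite /uf /= /primitive /antider max0K; apply: eq_Rintegral => s.
rewrite inE /= in_itv /= => /andP[s0 st].
have e1 : Num.max s 0 = s by rewrite max_l.
have e2 : Num.max (Num.max t 0 - s) 0 = Num.max t 0 - s by rewrite max_l// subr_ge0.
rewrite iE e1 /L2f.
have -> // : uf n a (Num.max t 0 - s) =
  (fun z => u (@p a) (f a) (@fxi a) (phi a) (y a) n z (Num.max t 0 - s)).
by apply/funext => z; rewrite /uf e2.
Qed.

Lemma uf_step : uf_decay n.+1 k.
Proof.
have E a t : uf n.+1 a t = primitive a (Num.max t 0, Num.max t 0).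
  by apply/funext => x; exact: uf_primitive.
have [Pd Pcls] := primitive_decay.
split; first by move=> a t x j Bx; rewrite E; exact: Pd.
move=> lam /andP[l0 lg] j.
(* The integral is estimated by e^(- l1 t) times the growth e^((l1 - lam) t) that the negative rate
   lam - l1 allows; the product decays at rate [lam]. *)
pose l1 := (lam + gamma) / 2.
have lg1 : lam < l1 by rewrite midf_lt.
have lg2 : l1 < gamma by rewrite midf_lt.
have l10 : 0 <= l1 < gamma by rewrite lg2 andbT (le_trans l0)// ltW.
have m0 : lam - l1 < 0 by rewrite subr_lt0.
have sc : continuous (fun t : R => (Num.max t 0, Num.max t 0)).
  have mc : continuous (fun t : R => Num.max t 0).
    by move=> t; apply: continuous_max => //; exact: cvg_cst.
  by move=> t; exact: (continuous_pair (mc t) (mc t)).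
apply: (wclass_ext Bo _ (wclass_weaken N1 ler01 _ (wclass_reindex sc (Pcls _ _ l10 m0 j)))).
  by move=> a t x Bx; rewrite [RHS]/pdf E.
move=> t /=; rewrite mul1r /etw /etime /= !max0K -expRD ler_expR -mulrDl.
by rewrite -opprD addrC subrK.
Qed.

End step.

Lemma uf_decay_all n : (2 * n <= m)%N -> uf_decay n (m - 2 * n).
Proof.
elim: n => [|n IH] nm; first by rewrite muln0 subn0; exact: uf0_decay.
apply: uf_step; first lia.
have -> : (m - 2 * n.+1).+2 = (m - 2 * n)%N by lia.
by apply: IH; lia.
Qed.

End expansion.

(** * Checking the hypotheses *)

Section class_criteria.
Context {R : realType} {d : nat}.
Local Notation V := 'rV[R]_d.
Variables (D : Type) (B : D -> set V) (N : D -> R).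
Hypothesis N1 : forall a, 1 <= N a.

(** The last index of [J] is differentiated first, and [wclass] peels off this innermost derivative,
    so inductions on [J] run from the right. *)
Lemma pder_rcons (J : seq 'I_d) j (g : V -> R) : pder (rcons J j) g = pder J (pd j g).
Proof. by rewrite /pder foldr_rcons. Qed.

Lemma Ck_wclass k (g : D -> V -> R) :
  (forall a, Ck k (B a) (g a)) ->
  (forall a J x, (size J <= k)%N -> B a x -> `|pder J (g a) x| <= N a) ->
  wclass B N (fun _ : R => 1) k (fun a _ x => g a x).
Proof.
elim: k g => [|k IH] g gC gb.
all: have jc : jcont B (fun a (_ : R) x => g a x).
1,3: move=> a th x Bx; have [_ gc] := gC a;
  apply: (@continuous_comp _ _ _ (@snd R V) (g a)); [exact: cvg_snd | exact: (gc [::])].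
all: have pb : polybounded B N (fun _ : R => 1) (fun a (_ : R) x => g a x)
  by exists 1, 1%N; split => // a th x Bx; rewrite expr1 mul1r mulr1; exact: (gb a [::]).
  by split.
split => //; split.
  by move=> a th x j Bx; have [gd _] := gC a; exact: (gd [::] j x).
move=> j; apply: (IH (fun a => pd j (g a))).
  move=> a; have [gd gc] := gC a; split.
    by move=> J i x Jk Bx; rewrite -pder_rcons; apply: gd => //; rewrite size_rcons.
  by move=> J x Jk Bx; rewrite -pder_rcons; apply: gc => //; rewrite size_rcons.
by move=> a J x Jk Bx; rewrite -pder_rcons; apply: gb => //; rewrite size_rcons.
Qed.

Context {Th : topologicalType}.

Lemma wclass_pder_derivable (w : Th -> R) k (g : D -> Th -> V -> R) (J : seq 'I_d) a th x j :
  wclass B N w k g -> (size J < k)%N -> B a x -> derivable (pder J (g a th)) x (ej j).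
Proof.
elim: k g J => [//|k IH] g J G; case/lastP: J => [_ Bx|J i].
  exact: wclass_derivable G Bx.
rewrite size_rcons ltnS pder_rcons => Jk Bx.
exact: (IH (pdf i g) J (wclass_pdf i G) Jk Bx).
Qed.

Lemma wclass_pder_bounded (w : Th -> R) k (g : D -> Th -> V -> R) :
  (forall th, 0 <= w th) -> wclass B N w k g ->
  exists (C : R) (q : nat), 0 <= C /\ forall (J : seq 'I_d) a th x,
    (size J <= k)%N -> B a x -> `|pder J (g a th) x| <= C * N a ^+ q * w th.
Proof.
move=> w0; elim: k g => [|k IH] g G.
  have [C [q [C0 H]]] := wclass_bounded G.
  by exists C, q; split => // -[|j J] a th x //= _; exact: H.
have [C [q [C0 H]]] := wclass_bounded G.
have [C' HC'] := choice (fun j => IH _ (wclass_pdf j G)).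
have [q' Hq'] := choice HC'.
have C'0 j : 0 <= C' j by have [] := Hq' j.
exists (C + \sum_j C' j), (q + \sum_j q' j)%N; split.
  by rewrite addr_ge0// sumr_ge0.
move=> J a th x; case/lastP: J => [_ Bx|J j].
  apply: (le_trans (H a th x Bx)); rewrite ler_wpM2r// ler_pM ?(exprN_ge0 N1)//.
    by rewrite lerDl sumr_ge0.
  by rewrite (exprN_le N1)// leq_addr.
rewrite size_rcons ltnS pder_rcons => Jk Bx.
have [_ Hj] := Hq' j.
apply: (le_trans (Hj J a th x Jk Bx)); rewrite ler_wpM2r// ler_pM ?(exprN_ge0 N1)//.
  apply: (@le_trans _ _ (\sum_j C' j)); last by rewrite lerDr.
  by rewrite (bigD1 j)//= lerDl sumr_ge0.
rewrite (exprN_le N1)//; apply: (@leq_trans (\sum_j q' j)); last exact: leq_addl.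
by rewrite (bigD1 j)//= leq_addr.
Qed.

End class_criteria.

(** * Strong convexity and the minimum at 0 *)

Section convexity.
Context {R : realType} {d : nat}.
Local Notation V := 'rV[R]_d.

Lemma is_derive_line (g : V -> R) (x v : V) :
  Ck 1 setT g -> is_derive (0 : R) 1 (fun h : R => g (h *: v + x)) (\sum_k v 0 k * pd k g x).
Proof.
move=> [gd gc].
have E : x = 0 *: v + x by rewrite scale0r add0r.
rewrite [X in \sum_k v 0 k * pd k _ X]E.
apply: (@is_derive_comp_rV _ _ _ g (fun h : R => h *: v + x)); rewrite -?E.
- by near=> z => i; exact: (gd [::]).
- by move=> k; exact: (gc [:: k]).
move=> k; have := @is_deriveZ _ _ _ id (v 0 k) (0 : R) 1 1 (is_derive_id _ _).
move=> /(is_derive_addr (x 0 k)) /is_derive_eq h.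
have {}h := h _ (mulr1 _); congr (is_derive _ _ _ _): h.
by apply/funext => s; rewrite !mxE; congr (_ + _); exact: mulrC.
Unshelve. all: by end_near. Qed.

Lemma Ck_le k l (U : set V) g : (l <= k)%N -> Ck k U g -> Ck l U g.
Proof.
move=> lk [gd gc]; split=> [J j x Jl|J x Jl] Ux.
  by apply: gd => //; exact: leq_trans lk.
by apply: gc => //; exact: leq_trans lk.
Qed.

Lemma is_derive_sqnorm_line (x v : V) :
  is_derive (0 : R) 1 (fun h : R => sqnorm (h *: v + x)) (2 * \sum_i v 0 i * x 0 i).
Proof.
have H i : is_derive (0 : R) 1 (fun h : R => (h *: v + x) 0 i ^+ 2) (2 * (v 0 i * x 0 i)).
  have E : (fun h : R => (h *: v + x) 0 i ^+ 2) = (fun h : R => (v 0 i * h + x 0 i) ^+ 2).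
    by apply/funext => h; rewrite !mxE (mulrC h).
  rewrite E.
  have := @is_deriveZ _ _ _ id (v 0 i) (0 : R) 1 1 (is_derive_id _ _).
  move=> /(is_derive_addr (x 0 i)) /is_derive_sqr /is_derive_eq; apply.
  rewrite -[X in 2 * (X + _)]/(v 0 i * 0) -[X in _ * _ * X]/(v 0 i * 1).
  by ring.
by rewrite mulr_sumr; exact: is_derive_bigsum.
Qed.

(** Letting the convexity parameter tend to 0 from the right gives the tangent inequality for g -
    gamma / 2 |.|^2 at each of the two points; in their sum the values cancel. *)
Lemma strong_convexity_monotone (g : V -> R) (gamma : R) (U : set V) (x z : V) :
  Ck 1 setT g -> U x -> U z ->
  (forall (x y : V) (l : R), U x -> U y -> 0 <= l <= 1 ->
    let h := fun z => g z - gamma / 2 * sqnorm z in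
    h (l *: x + (1 - l) *: y) <= l * h x + (1 - l) * h y) ->
  gamma * sqnorm (x - z) <= \sum_i (x - z) 0 i * (pd i g x - pd i g z).
Proof.
move=> gC Ux Uz cvx.
pose h w := g w - gamma / 2 * sqnorm w.
have slope (x1 z1 : V) : U x1 -> U z1 ->
    (\sum_k (x1 - z1) 0 k * pd k g z1) - gamma / 2 * (2 * \sum_i (x1 - z1) 0 i * z1 0 i) <= h x1 - h z1.
  move=> Ux' Uz'; pose psi (l : R) := h (l *: (x1 - z1) + z1).
  have dpsi : is_derive (0 : R) 1 psi
      ((\sum_k (x1 - z1) 0 k * pd k g z1) - gamma / 2 * (2 * \sum_i (x1 - z1) 0 i * z1 0 i)).
    apply: is_derive_sub; first exact: is_derive_line.
    exact: is_deriveZ (is_derive_sqnorm_line z1 (x1 - z1)).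
  have H := cvg_dnbhs_at_right (is_derive_quot dpsi).
  apply: (cvgr_to_le H); near=> l.
  have l0 : 0 < l by near: l; exact: nbhs_right_gt.
  have l1 : l <= 1 by near: l; apply: nbhs_right_le.
  rewrite ler_pdivrMl// /psi scale0r add0r.
  have := cvx x1 z1 l Ux' Uz'; rewrite (ltW l0) l1 => /(_ isT) /=.
  have -> : l *: x1 + (1 - l) *: z1 = l *: (x1 - z1) + z1.
    by rewrite scalerBl scale1r scalerBr -addrA [- _ + _]addrC.
  rewrite -!/(h _); lra.
have s1 := slope x z Ux Uz; have s2 := slope z x Uz Ux.
have -> : \sum_i (x - z) 0 i * (pd i g x - pd i g z) =
  - (\sum_k (z - x) 0 k * pd k g x) - \sum_k (x - z) 0 k * pd k g z.
  by rewrite -sumrN -sumrB; apply: eq_bigr => k _; rewrite !mxE; ring.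
have -> : sqnorm (x - z) = - (\sum_i (z - x) 0 i * x 0 i) - \sum_i (x - z) 0 i * z 0 i.
  by rewrite /sqnorm -sumrN -sumrB; apply: eq_bigr => k _; rewrite !mxE; ring.
by lra.
Unshelve. all: by end_near. Qed.

Lemma local_min_pd (f : V -> R) (e : R) j : 0 < e ->
  (forall x, enorm x < e -> f 0 <= f x) -> (forall x, derivable f x (ej j)) ->
  pd j f 0 = 0.
Proof.
move=> e0 fmin fd.
have lineD (t : R) : is_derive t 1 (fun h : R => f (h *: ej j + 0)) (pd j f (t *: ej j + 0)).
  by apply/is_derive_lineP; apply: derivableP; exact: fd.
have hm : is_derive (0 : R) 1 (fun h : R => f (h *: ej j + 0)) 0.
  apply: (@derive1_at_min _ _ (- e) e).
  - by rewrite ge0_cp// ltW.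
  - by move=> t _; apply: ex_derive; exact: lineD.
  - by rewrite in_itv /= oppr_lt0 e0.
  move=> t; rewrite in_itv /= => te; rewrite scale0r !addr0; apply: fmin.
  rewrite /enorm /sqnorm (bigD1 j)//= big1 ?addr0 => [|i /negbTE ij].
    by rewrite !mxE !eqxx mulr1 sqrtr_sqr ltr_norml.
  by rewrite !mxE ij andbF mulr0 expr0n.
have := lineD 0; rewrite scale0r addr0 => l0.
by rewrite -(@derive_val _ _ _ _ _ _ _ l0) (@derive_val _ _ _ _ _ _ _ hm).
Qed.

End convexity.

(** * Polynomials in the three norms *)

Section polynomials.
Context {R : realType}.

Definition poly_repr (g : R -> R -> R -> R) := exists P : poly3 R, forall a b c, eval3 P a b c = g a b c.

Lemma poly_repr_mono (r : R) i j k :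
  poly_repr (fun a b c => r * a ^+ i * b ^+ j * c ^+ k).
Proof. by exists [:: (r, (i, j, k))] => a b c; rewrite /eval3 big_seq1. Qed.

Lemma poly_reprD g h : poly_repr g -> poly_repr h -> poly_repr (fun a b c => g a b c + h a b c).
Proof.
move=> [P HP] [Q HQ]; exists (P ++ Q) => a b c.
by rewrite /eval3 big_cat /= -HP -HQ.
Qed.

Lemma poly_reprM g h : poly_repr g -> poly_repr h -> poly_repr (fun a b c => g a b c * h a b c).
Proof.
move=> [P HP] [Q HQ].
exists [seq (m1.1 * m2.1, ((m1.2.1.1 + m2.2.1.1)%N, (m1.2.1.2 + m2.2.1.2)%N, (m1.2.2 + m2.2.2)%N))
  | m1 <- P, m2 <- Q] => a b c.
rewrite /eval3 big_allpairs_dep /= -HP -HQ /eval3 mulr_suml; apply: eq_bigr => m1 _.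
rewrite mulr_sumr; apply: eq_bigr => m2 _ /=; rewrite !exprD; ring.
Qed.

Lemma poly_repr_power (C : R) q : poly_repr (fun a b c => C * (1 + a + b + c) ^+ q).
Proof.
have linear : poly_repr (fun a b c => 1 + a + b + c).
  have [P HP] := poly_reprD (poly_reprD (poly_reprD (poly_repr_mono 1 0 0 0)
    (poly_repr_mono 1 1 0 0)) (poly_repr_mono 1 0 1 0)) (poly_repr_mono 1 0 0 1).
  by exists P => a b c; rewrite HP; ring.
elim: q => [|q IH].
  by have [P HP] := poly_repr_mono C 0 0 0; exists P => a b c; rewrite HP; ring.
have [P HP] := poly_reprM IH linear.
by exists P => a b c; rewrite HP exprSr mulrA.
Qed.

End polynomials.

(** * The estimates of the theorem *)

Section norms.
Context {R : realType} {d : nat}.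
Local Notation V := 'rV[R]_d.

Lemma pder_le_Cnorm k (U : set V) (g : V -> R) J x :
  Ck_bounded k U g -> (size J <= k)%N -> U x -> `|pder J g x| <= Cnorm k U g.
Proof.
move=> [M HM] Jk Ux; apply: sup_upper_bound; last by exists J, x.
split; first by exists `|pder J g x|, J, x.
by exists M => r [J' [x' [J'k Ux' ->]]]; exact: HM.
Qed.

Lemma Cnorm_ge0 k (U : set V) (g : V -> R) x : Ck_bounded k U g -> U x -> 0 <= Cnorm k U g.
Proof. by move=> gb Ux; apply: le_trans (pder_le_Cnorm (J := [::]) gb _ Ux). Qed.

End norms.

(** All admissible data for fixed [d], [gamma] and [m]: a constant uniform over this type depends on
    nothing else. The index [m] is 2 n in the first estimate and k + 2 n - 1 in the second. *)
Record setting (R : realType) (d : nat) (gamma : R) (m : nat) := Setting {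
  sXi : finType; sp : sXi -> R; sf : 'rV[R]_d -> R; sfxi : sXi -> 'rV[R]_d -> R;
  sb : R; sR1 : R; srad : R; sphi : 'rV[R]_d -> R; sy : 'rV[R]_d -> R -> 'rV[R]_d;
  sA : assumption_A sp sf sfxi gamma sb sR1;
  slt : 16 * sb / (3 * gamma) < srad;
  sle : srad <= sR1;
  sflow : is_flow sf srad sy;
  sphiC : Ck m.+1 (eball srad) sphi; sphib : Ck_bounded m.+1 (eball srad) sphi;
  sfC : Ck m.+2 (eball srad) sf; sfb : Ck_bounded m.+2 (eball srad) sf;
  sSig : Sig_Ck sp sf sfxi m.-1 (eball srad) }.

Section bounds.
Variables (R : realType) (d : nat) (gamma : R) (m : nat).
Local Notation V := 'rV[R]_d.
Local Notation D := (setting d gamma m).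
Hypothesis gamma0 : 0 < gamma.

Definition snorm (a : D) : R := 1 + Cnorm m.+1 (eball (srad a)) (sphi a)
  + Cnorm m.+2 (eball (srad a)) (sf a)
  + SigCnorm (@sp _ _ _ _ a) (sf a) (@sfxi _ _ _ _ a) m.-1 (eball (srad a)).

Local Notation B := (fun a : D => @eball R d (srad a)).

Lemma srad_gt0 (a : D) : 0 < srad a.
Proof.
apply: le_lt_trans (slt a); have [_ _ _ _ [g0 b0 _ _ _]] := sA a.
by rewrite divr_ge0 ?mulr_ge0 ?(ltW b0) ?(ltW g0).
Qed.

Lemma sball0 (a : D) : B a 0. Proof. exact: ball0 srad_gt0 a. Qed.

Lemma Sig_le_SigCnorm (a : D) i j :
  Cnorm m.-1 (B a) (Sig (@sp _ _ _ _ a) (sf a) (@sfxi _ _ _ _ a) i j) <=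
  SigCnorm (@sp _ _ _ _ a) (sf a) (@sfxi _ _ _ _ a) m.-1 (B a).
Proof.
apply: le_trans (le_bigmax _ _ i).
exact: (le_bigmax 0 (fun j => Cnorm m.-1 (B a) (Sig (@sp _ _ _ _ a) (sf a) (@sfxi _ _ _ _ a) i j)) j).
Qed.

Lemma SigCnorm_ge0 (a : D) :
  0 <= SigCnorm (@sp _ _ _ _ a) (sf a) (@sfxi _ _ _ _ a) m.-1 (B a).
Proof. exact: bigmax_ge_id. Qed.

Lemma snorm_bounds (a : D) : [/\ 1 <= snorm a,
  Cnorm m.+1 (B a) (sphi a) <= snorm a, Cnorm m.+2 (B a) (sf a) <= snorm a &
  SigCnorm (@sp _ _ _ _ a) (sf a) (@sfxi _ _ _ _ a) m.-1 (B a) <= snorm a].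
Proof.
have := SigCnorm_ge0 a.
have := Cnorm_ge0 (sphib a) (sball0 a).
have := Cnorm_ge0 (sfb a) (sball0 a).
by rewrite /snorm => *; split; lra.
Qed.

Lemma snorm_ge1 (a : D) : 1 <= snorm a. Proof. by have [] := snorm_bounds a. Qed.

(** Convexity is assumed for each [xi] on the ball of radius [sR1 a], which contains the present
    one; the monotonicity of the gradients is then averaged over [xi]. *)
Lemma sgrad_mono (a : D) x z : B a x -> B a z ->
  gamma * sqnorm (x - z) <= \sum_i (x - z) 0 i * (pd i (sf a) x - pd i (sf a) z).
Proof.
move=> Bx Bz; have [[p0 p1] fC fE _ [_ _ cvx _ _]] := sA a.
have R1x w : B a w -> eball (sR1 a) w by move=> wr; apply: lt_le_trans (sle a).
have H (xi : sXi a) : gamma * sqnorm (x - z) <=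
    \sum_i (x - z) 0 i * (pd i (sfxi xi) x - pd i (sfxi xi) z).
  apply: (strong_convexity_monotone (U := eball (sR1 a))).
  - exact: (Ck_le (isT : (1 <= 3)%N) (fC xi)).
  - exact: R1x.
  - exact: R1x.
  exact: cvx.
have -> : \sum_i (x - z) 0 i * (pd i (sf a) x - pd i (sf a) z) =
    \sum_(xi : sXi a) sp xi * \sum_i (x - z) 0 i * (pd i (sfxi xi) x - pd i (sfxi xi) z).
  under [RHS]eq_bigr do rewrite mulr_sumr.
  rewrite exchange_big /=; apply: eq_bigr => i _.
  have [_ ->] := fE x i; have [_ ->] := fE z i.
  rewrite -sumrB mulr_sumr; apply: eq_bigr => xi _; ring.
rewrite -[leLHS]mul1r -p1 mulr_suml; apply: ler_sum => xi _.
by rewrite ler_wpM2l.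
Qed.

Lemma sgrad0 (a : D) i : pd i (sf a) 0 = 0.
Proof.
have [_ _ fE [e e0 fmin] _] := sA a.
by apply: (local_min_pd e0 fmin) => x; have [] := fE x i.
Qed.

Lemma sgrad_wclass i :
  wclass B snorm (fun=> 1) m.+1 (fun a (_ : R) x => pd i (sf a) x).
Proof.
apply: (Ck_wclass (g := fun a : D => pd i (sf a))).
  move=> a; have [gd gc] := sfC a; split.
    by move=> J j x Jk Bx; rewrite -pder_rcons; apply: gd => //; rewrite size_rcons.
  by move=> J x Jk Bx; rewrite -pder_rcons; apply: gc => //; rewrite size_rcons.
move=> a J x Jk Bx; have [_ _ h _] := snorm_bounds a; apply: le_trans h.
by rewrite -pder_rcons; apply: pder_le_Cnorm (sfb a) _ Bx; rewrite size_rcons.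
Qed.

Lemma sphi_wclass : wclass B snorm (fun=> 1) m.+1 (fun a (_ : R) x => sphi a x).
Proof.
apply: (Ck_wclass (g := fun a : D => sphi a)) => a; first exact: sphiC.
move=> J x Jk Bx; have [_ h _ _] := snorm_bounds a; apply: le_trans h.
exact: pder_le_Cnorm (sphib a) Jk Bx.
Qed.

Lemma sSig_wclass i j : wclass B snorm (fun=> 1) m.-1
  (fun a (_ : R) x => Sig (@sp _ _ _ _ a) (sf a) (@sfxi _ _ _ _ a) i j x).
Proof.
apply: (Ck_wclass (g := fun a : D => Sig (@sp _ _ _ _ a) (sf a) (@sfxi _ _ _ _ a) i j)) => a.
  by have [] := sSig a i j.
move=> J x Jk Bx; have [_ _ _ h] := snorm_bounds a; apply: le_trans h.
apply: le_trans (Sig_le_SigCnorm a i j); have [_ Sb] := sSig a i j.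
exact: pder_le_Cnorm Sb Jk Bx.
Qed.

Local Notation ufs := (uf (fun a : D => @sp _ _ _ _ a) (fun a : D => sf a)
  (fun a : D => @sfxi _ _ _ _ a) (fun a : D => sphi a) (fun a : D => sy a)).

Lemma sflow_eq (a : D) x : B a x ->
  [/\ sy a x 0 = x, sy a x @ 0^'+ --> x &
   forall t : R, 0 < t -> is_derive t 1 (sy a x) (- \row_i pd i (sf a) (sy a x t))].
Proof. exact: sflow. Qed.

Lemma setting_decay n : (2 * n <= m)%N ->
  uf_decay (srad (m := m)) snorm (fun a : D => @sp _ _ _ _ a) (fun a : D => sf a)
    (fun a : D => @sfxi _ _ _ _ a) (fun a : D => sphi a) (fun a : D => sy a)
    gamma n (m - 2 * n).
Proof.
exact: (uf_decay_all srad_gt0 snorm_ge1 gamma0 sgrad_mono sgrad0 sflow_eq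
  sgrad_wclass sphi_wclass sSig_wclass).
Qed.

End bounds.

Section estimates.
Variables (R : realType) (d : nat) (gamma : R) (m : nat).
Local Notation V := 'rV[R]_d.
Local Notation D := (setting d gamma m).
Hypothesis gamma0 : 0 < gamma.
Local Notation B := (fun a : D => @eball R d (srad a)).

Definition su (a : D) (n : nat) : V -> R -> R :=
  u (@sp _ _ _ _ a) (sf a) (@sfxi _ _ _ _ a) (sphi a) (sy a) n.

Local Notation ufs := (uf (fun a : D => @sp _ _ _ _ a) (fun a : D => sf a)
  (fun a : D => @sfxi _ _ _ _ a) (fun a : D => sphi a) (fun a : D => sy a)).

Lemma uf_su n (a : D) (t : R) : 0 <= t -> ufs n a t = su a n ^~ t.
Proof. by move=> t0; apply/funext => x; rewrite /uf max_l. Qed.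

Lemma etime_le (l l' t : R) : l' <= l -> 0 <= t -> etime l t <= expR (- (l' * t)).
Proof.
move=> ll t0; rewrite etime_pos// ler_expR mulNr lerN2.
by rewrite ler_wpM2r.
Qed.

Lemma su_pder_derivable n (a : D) (J : seq 'I_d) j x (t : R) : (2 * n <= m)%N ->
  0 <= t -> (size J <= m - 2 * n)%N -> B a x ->
  derivable (pder J (su a n ^~ t)) x (ej j).
Proof.
move=> nm t0 Jk Bx; have [ud ucls] := setting_decay d gamma0 nm.
rewrite -uf_su//; case/lastP: J Jk => [_|J i]; first exact: ud.
rewrite size_rcons pder_rcons => Jk.
have l0 : (0 : R) <= 0 < gamma by rewrite lexx.
exact: (wclass_pder_derivable (ucls 0 l0 i) Jk Bx).
Qed.

Lemma su_pder_bounded n (lam : R) : (2 * n <= m)%N -> 0 <= lam < gamma ->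
  exists (C : R) (q : nat), 0 <= C /\ forall (a : D) (J : seq 'I_d) x (t : R),
    0 <= t -> (0 < size J <= (m - 2 * n).+1)%N -> B a x ->
    `|pder J (su a n ^~ t) x| <= C * snorm a ^+ q * etime lam t.
Proof.
move=> nm lg; have [_ ucls] := setting_decay d gamma0 nm.
have [C HC] := choice (fun j => wclass_pder_bounded (@snorm_ge1 _ _ _ _) (etime_ge0 lam) (ucls lam lg j)).
have [q Hq] := choice HC.
have C0 j : 0 <= C j by have [] := Hq j.
exists (\sum_j C j), (\sum_j q j)%N; split; first exact: sumr_ge0.
move=> a J x t t0; rewrite -uf_su//; case/lastP: J => [//|J j].
rewrite size_rcons ltnS pder_rcons => /= Jk Bx.
have [_ Hj] := Hq j.
apply: (le_trans (Hj J a t x Jk Bx)); rewrite ler_wpM2r ?etime_ge0//.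
rewrite ler_pM ?(exprN_ge0 (@snorm_ge1 _ _ _ _))//.
  by rewrite (bigD1 j)//= lerDl sumr_ge0.
by rewrite (exprN_le (@snorm_ge1 _ _ _ _))// (bigD1 j)//= leq_addr.
Qed.

(** The radius is not among the arguments of the polynomial. Monotonicity at 0 gives gamma |x|^2 <=
    x . grad f(x), where each partial derivative is at most N = [snorm a], so gamma^2 |x|^2 <= d
    N^2. With K = d / gamma^2, the bound K <= (K + 1)^2 spares a square root. *)
Lemma sball_coord (a : D) x i : B a x -> `|x 0 i| <= (d%:R / gamma ^+ 2 + 1) * snorm a.
Proof.
move=> Bx; have N1 := snorm_ge1 a; have N0 : 0 <= snorm a by exact: le_trans ler01 N1.
have Fb k : `|pd k (sf a) x| <= snorm a.
  have [_ _ h _] := snorm_bounds a; apply: le_trans h.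
  exact: (pder_le_Cnorm (J := [:: k]) (sfb a) _ Bx).
have g20 : 0 < gamma ^+ 2 by rewrite exprn_gt0.
have K0 : 0 <= d%:R / gamma ^+ 2 :> R by rewrite divr_ge0// ltW.
have mono := sgrad_mono Bx (sball0 a).
have key : gamma ^+ 2 * sqnorm x <= d%:R * snorm a ^+ 2.
  have h : gamma ^+ 2 * sqnorm x <= gamma * \sum_k x 0 k * pd k (sf a) x.
    rewrite expr2 -mulrA ler_wpM2l ?(ltW gamma0)//.
    move: mono; rewrite subr0; congr (_ <= _).
    by apply: eq_bigr => k _; rewrite sgrad0 subr0.
  have h2 : 2 * (gamma * \sum_k x 0 k * pd k (sf a) x) <=
      gamma ^+ 2 * sqnorm x + d%:R * snorm a ^+ 2.
    apply: (@le_trans _ _ (gamma ^+ 2 * sqnorm x + \sum_k pd k (sf a) x ^+ 2)).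
      rewrite /sqnorm !mulr_sumr -big_split /=; apply: ler_sum => k _.
      have := sqr_ge0 (gamma * x 0 k - pd k (sf a) x); nra.
    rewrite lerD2l; apply: ler_sum_ord => k; exact: sqr_le_norm.
  by lra.
have KN0 : 0 <= (d%:R / gamma ^+ 2 + 1) * snorm a.
  by apply: mulr_ge0 => //; exact: addr_ge0.
rewrite -(@ler_pXn2r _ 2)// ?nnegrE//.
rewrite real_normK ?num_real//.
have xi2 : x 0 i ^+ 2 <= sqnorm x.
  rewrite /sqnorm (bigD1 i)//= lerDl sumr_ge0// => k _; exact: sqr_ge0.
apply: (le_trans xi2).
have {key} : sqnorm x <= d%:R / gamma ^+ 2 * snorm a ^+ 2.
  by rewrite mulrAC ler_pdivlMr// mulrC.
have := sqr_ge0 (snorm a); rewrite exprMn.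
by move=> s0 h; apply: (le_trans h); rewrite ler_wpM2r//; nra.
Qed.

(** Mean value theorem on the segment from 0 to [x]; the additional power of [snorm a] bounds the
    coordinates of [x]. *)
Lemma su_oscillation n (lam : R) : (2 * n <= m)%N -> 0 <= lam < gamma ->
  exists (C : R) (q : nat), 0 <= C /\ forall (a : D) x (t : R), 0 <= t -> B a x ->
    `|su a n x t - su a n 0 t| <= C * snorm a ^+ q * etime lam t.
Proof.
move=> nm lg; have [C [q [C0 H]]] := su_pder_bounded nm lg.
pose K : R := d%:R / gamma ^+ 2 + 1.
have K0 : 0 <= K.
  by rewrite addr_ge0// divr_ge0// exprn_ge0// ltW.
exists (d%:R * (K * C)), q.+1; split; first by rewrite !mulr_ge0.
move=> a x t t0 Bx.
have [ud ucls] := setting_decay d gamma0 nm.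
have sB (s : R) : 0 <= s <= 1 -> B a (s *: x).
  move=> /andP[s0 s1]; apply/(eballE _ (srad_gt0 a)).
  have /(eballE _ (srad_gt0 a)) := Bx; apply: le_lt_trans.
  apply: ler_sum => i _; rewrite mxE exprMn ler_piMl ?sqr_ge0//.
  by rewrite exprn_ile1.
have dline (s : R) : 0 <= s <= 1 -> is_derive s 1 (fun s => su a n (s *: x) t)
    (\sum_i x 0 i * pd i (su a n ^~ t) (s *: x)).
  move=> s01; have Bs := sB s s01.
  have l0 : (0 : R) <= 0 < gamma by rewrite lexx.
  apply: (@is_derive_comp_rV _ _ _ (su a n ^~ t) (fun s : R => s *: x)).
  - apply: filterS (near_ball (B := B) (fun a => eball_open (srad_gt0 a)) Bs) => z Bz i.
    by rewrite -uf_su//; exact: ud.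
  - move=> i; rewrite -uf_su//.
    exact: (@jcont_slice _ _ _ _ _ _ a t (s *: x) (wclass_jcont (ucls 0 l0 i)) Bs).
  move=> i; have := @is_deriveZ _ _ _ id (x 0 i) s 1 1 (is_derive_id _ _).
  move=> /is_derive_eq h; have {}h := h _ (mulr1 _).
  congr (is_derive _ _ _ _): h.
  by apply/funext => r; rewrite !mxE; exact: mulrC.
have fd' (c : R) : c \in `]0, 1[%R -> is_derive c 1 (fun s => su a n (s *: x) t)
    (\sum_i x 0 i * pd i (su a n ^~ t) (c *: x)).
  by rewrite in_itv /= => /andP[c0 c1]; apply: dline; rewrite !ltW.
have fc : {within `[0, 1], continuous (fun s : R => su a n (s *: x) t)}.
  apply: derivable_within_continuous => c; rewrite in_itv /= => /dline cd.
  exact: ex_derive.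
have [c + ] := MVT ltr01 fd' fc.
rewrite in_itv /= => /andP[c0 c1]; rewrite scale1r scale0r subr0 mulr1 => ->.
have c01 : 0 <= c <= 1 by rewrite !ltW.
rewrite (le_trans (ler_norm_sum _ _ _))//.
have -> : d%:R * (K * C) * snorm a ^+ q.+1 * etime lam t =
    d%:R * ((K * snorm a) * (C * snorm a ^+ q * etime lam t)) by rewrite exprS; ring.
apply: ler_sum_ord => i; rewrite normrM ler_pM// ?sball_coord//.
by apply: (H a [:: i]) => //; exact: sB.
Qed.

(** The distance to the limit is a tail of the integral of [L2u]; the rate must be positive for it
    to converge, and 1 / lam is the mass of an exponential tail. *)
Lemma su_limit n (lam : R) : (2 * n.+1 <= m)%N -> 0 < lam < gamma ->
  exists (C : R) (q : nat), 0 <= C /\ forall a : D,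
    let L2u := fun s : R => L2 (@sp _ _ _ _ a) (sf a) (@sfxi _ _ _ _ a)
       (fun z => su a n z s) 0 in
    lebesgue_measure.-integrable `[0%R, +oo[ (EFin \o L2u) /\
    forall t : R, 0 <= t ->
    `|su a n.+1 0 t - Rintegral lebesgue_measure `[0%R, +oo[ L2u| <=
       C * snorm a ^+ q * etime lam t.
Proof.
move=> nm /andP[l0 lg].
have lg' : 0 <= lam < gamma by rewrite lg ltW.
have nm' : (2 * n <= m)%N by apply: leq_trans nm; lia.
have [ud ucls] := setting_decay d gamma0 nm'.
have bo (a : D) : open (B a) by exact: eball_open (srad_gt0 a).
have Hcls : wclass B (@snorm _ _ _ _) (etime lam) 0
    (L2f (fun a : D => @sp _ _ _ _ a) (fun a : D => sf a) (fun a : D => @sfxi _ _ _ _ a) (ufs n)).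
  apply: (L2_wclass (@srad_gt0 _ _ _ _) (@snorm_ge1 _ _ _ _) (m := m)) => //.
  - exact: sgrad_wclass.
  - exact: sSig_wclass.
  - exact: etime_ge0.
  by move=> j; apply: wclass_le (ucls lam lg' j); lia.
have [C [q [C0 HC]]] := wclass_bounded Hcls.
exists (C / lam), q; split; first by rewrite divr_ge0// ltW.
move=> a L2u.
(* The clamped version of [L2u]: equal to it for s >= 0 and continuous on the whole line. *)
pose h (s : R) := L2f (fun a : D => @sp _ _ _ _ a) (fun a : D => sf a)
  (fun a : D => @sfxi _ _ _ _ a) (ufs n) a s 0.
have hE (s : R) : 0 <= s -> h s = L2u s by move=> s0; rewrite /h /L2f uf_su.
have hc : continuous h.
  move=> s; apply: (@continuous_comp _ _ _ (fun s : R => (s, (0 : V)))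
    (fun q => L2f (fun a : D => @sp _ _ _ _ a) (fun a : D => sf a)
      (fun a : D => @sfxi _ _ _ _ a) (ufs n) a q.1 q.2)).
    by apply: continuous_pair; [exact: cvg_id | exact: cst_continuous].
  exact: (wclass_jcont Hcls (sball0 a)).
have hb (s : R) : 0 <= s -> `|h s| <= C * snorm a ^+ q * expR (- lam * s).
  by move=> s0; have := HC a s 0 (sball0 a); rewrite etime_pos.
have CN0 : 0 <= C * snorm a ^+ q.
  by rewrite mulr_ge0// (exprN_ge0 (@snorm_ge1 _ _ _ _)).
have E : {in `[0%R, +oo[%classic, h =1 L2u}.
  by move=> s; rewrite inE /= in_itv /= andbT; exact: hE.
split.
  have E' : {in `[0%R, +oo[%classic, EFin \o h =1 EFin \o L2u}.
    by move=> s sI; rewrite /comp (E s sI).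
  have H0 := exp_decay_integrable l0 CN0 hc hb.
  refine (@eq_integrable _ _ R (@lebesgue_measure R) `[0%R, +oo[%classic _ _ _ E' H0).
  exact: measurable_itv.
move=> t t0.
rewrite -(eq_Rintegral (@lebesgue_measure R) E).
have -> : su a n.+1 0 t = antider h t.
  pose G (s : R) := L2 (@sp _ _ _ _ a) (sf a) (@sfxi _ _ _ _ a)
    (fun z => su a n z (t - s)) (sy a 0 s).
  have -> : su a n.+1 0 t = Rintegral lebesgue_measure `[0, t] G by [].
  rewrite -(Rintegral_reverse hc t0).
  have GE : {in `[0, t]%classic, G =1 (fun s => h (t - s))}.
    move=> s; rewrite inE /= in_itv /= => /andP[s0 st].
    have ts : 0 <= t - s by rewrite subr_ge0.
    rewrite (hE _ ts) /G /L2u.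
    have y0 := flow_zero (@srad_gt0 _ _ _ _) gamma0 (@sgrad_mono _ _ _ _) (@sgrad0 _ _ _ _)
      (@sflow_eq _ _ _ _) a s.
    by move: y0; rewrite (max_l s0) => ->.
  exact: (eq_Rintegral (@lebesgue_measure R) GE).
rewrite distrC etime_pos//.
have -> : C / lam * snorm a ^+ q * expR (- lam * t) =
  C * snorm a ^+ q / lam * expR (- lam * t) by ring.
exact: exp_decay_tail.
Qed.

End estimates.

Theorem theorem2p3 (R : realType) (d n : nat) (n_ge1 : (1 <= n)%N) :
  (* first part *)
  (forall gamma gamma' : R, gamma' < gamma ->
   exists P : poly3 R,
   forall (Xi : finType) (p : Xi -> R) (f : 'rV[R]_d -> R)
          (fxi : Xi -> 'rV[R]_d -> R) (b R1 Rr : R)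
          (phi : 'rV[R]_d -> R) (y : 'rV[R]_d -> R -> 'rV[R]_d),
     assumption_A p f fxi gamma b R1 ->
     16 * b / (3 * gamma) < Rr -> Rr <= R1 ->
     is_flow f Rr y ->
     Ck (2 * n + 1) (eball Rr) phi -> Ck_bounded (2 * n + 1) (eball Rr) phi ->
     Ck (2 * n + 2) (eball Rr) f -> Ck_bounded (2 * n + 2) (eball Rr) f ->
     Sig_Ck p f fxi (2 * n - 1) (eball Rr) ->
     let L2u := fun s : R => L2 p f fxi (fun z => u p f fxi phi y n.-1 z s) 0 in
     lebesgue_measure.-integrable `[0%R, +oo[ (EFin \o L2u) /\
     (forall (t : R) (x : 'rV[R]_d), 0 <= t -> eball Rr x ->
        `|u p f fxi phi y n x t - Rintegral lebesgue_measure `[0%R, +oo[ L2u|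
        <= eval3 P (Cnorm (2 * n + 1) (eball Rr) phi)
                   (Cnorm (2 * n + 2) (eball Rr) f)
                   (SigCnorm p f fxi (2 * n - 1) (eball Rr))
           * expR (- (gamma' * t)))) /\
  (* second part *)
  (forall (k : nat), (1 <= k)%N ->
   forall gamma gamma'' : R, gamma'' < gamma ->
   exists P : poly3 R,
   forall (Xi : finType) (p : Xi -> R) (f : 'rV[R]_d -> R)
          (fxi : Xi -> 'rV[R]_d -> R) (b R1 Rr : R)
          (phi : 'rV[R]_d -> R) (y : 'rV[R]_d -> R -> 'rV[R]_d),
     assumption_A p f fxi gamma b R1 ->
     16 * b / (3 * gamma) < Rr -> Rr <= R1 ->
     is_flow f Rr y ->
     Ck (k + 2 * n) (eball Rr) phi -> Ck_bounded (k + 2 * n) (eball Rr) phi ->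
     Ck (k + 1 + 2 * n) (eball Rr) f -> Ck_bounded (k + 1 + 2 * n) (eball Rr) f ->
     Sig_Ck p f fxi (k + 2 * n - 2) (eball Rr) ->
     forall t : R, 0 <= t ->
       (forall (J : seq 'I_d) (j : 'I_d) (x : 'rV[R]_d), (size J < k)%N -> eball Rr x ->
          derivable (pder J (fun z => u p f fxi phi y n z t)) x (ej j)) /\
       (forall (J : seq 'I_d) (x : 'rV[R]_d), size J = k -> eball Rr x ->
          `|pder J (fun z => u p f fxi phi y n z t) x|
          <= eval3 P (Cnorm (k + 2 * n) (eball Rr) phi)
                     (Cnorm (k + 1 + 2 * n) (eball Rr) f)
                     (SigCnorm p f fxi (k + 2 * n - 2) (eball Rr))
             * expR (- (gamma'' * t)))).
Proof.
have no_setting (g : R) : g <= 0 -> forall (Xi : finType) (p : Xi -> R)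
    (f : 'rV[R]_d -> R) (fxi : Xi -> 'rV[R]_d -> R) (b R1 : R),
    ~ assumption_A p f fxi g b R1.
  by move=> g0 Xi p f fxi b R1 [_ _ _ _ [+ _ _ _ _]]; rewrite ltNge g0.
split.
  move=> gamma gamma' gg.
  (* For gamma <= 0 no data satisfy the assumption, and any polynomial will do. *)
  have [g0|g0] := leP gamma 0.
    by exists [::] => Xi p f fxi b R1 Rr phi y /(no_setting _ g0).
  (* The given rate may be negative, but the limit needs a positive one; gamma / 2 is a safe
     floor. *)
  pose lam := Num.max gamma' (gamma / 2).
  have lg : 0 < lam < gamma by rewrite lt_max gt_max gg !ltr_pdivrMr ?divr_gt0// ?orbT /=; lra.
  have lg' : 0 <= lam < gamma by case/andP: lg => /ltW -> ->.
  (* Then m - 2 n = 0: exactly the first derivatives of u_n are controlled, as the oscillation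
     estimate requires. *)
  pose m := (2 * n)%N.
  have [C1 [q1 [C10 H1]]] := @su_oscillation R d gamma m g0 n lam (leqnn _) lg'.
  have nE : n = n.-1.+1 by rewrite prednK.
  have nm : (2 * n.-1.+1 <= m)%N by rewrite -nE.
  have [C2 [q2 [C20 H2]]] := @su_limit R d gamma m g0 n.-1 lam nm lg.
  (* Since N >= 1, this power dominates the sum of the two bounds C1 N^q1 and C2 N^q2. *)
  have [P HP] := poly_repr_power (C1 + C2) (q1 + q2).
  exists P => Xi p f fxi b R1 Rr phi y hA hlt hle hfl hp hpb hf hfb hS.
  have e1 : (2 * n + 1)%N = m.+1 by rewrite addn1.
  have e2 : (2 * n + 2)%N = m.+2 by rewrite addn2.
  have e3 : (2 * n - 1)%N = m.-1 by rewrite subn1.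
  rewrite e1 in hp hpb *; rewrite e2 in hf hfb *; rewrite e3 in hS *.
  pose a := Setting hA hlt hle hfl hp hpb hf hfb hS.
  have [Hi Hl] := H2 a; split; first exact: Hi.
  move=> t x t0 Bx; rewrite HP -/(snorm a).
  have h1 := H1 a x t t0 Bx; have h2 := Hl t t0; rewrite -nE in h2.
  have N1 := snorm_ge1 a.
  rewrite -(subrKA (su a n 0 t)).
  apply: (le_trans (ler_normD _ _)); apply: (le_trans (lerD h1 h2)).
  rewrite -mulrDl; apply: ler_pM; rewrite ?etime_ge0//.
  - by rewrite addr_ge0// mulr_ge0// exprn_ge0// (le_trans ler01 N1).
  - rewrite mulrDl; apply: lerD; rewrite ler_wpM2l// ler_weXn2l// ?leq_addr ?leq_addl//.
  - by apply: etime_le => //; rewrite le_max lexx.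
move=> k k1 gamma gamma'' gg.
have [g0|g0] := leP gamma 0.
  by exists [::] => Xi p f fxi b R1 Rr phi y /(no_setting _ g0).
(* The bounds on derivatives are stated for nonnegative rates; a negative rate is raised to 0. *)
pose lam := Num.max gamma'' 0.
have lg : 0 <= lam < gamma by rewrite le_max gt_max gg g0 lexx orbT.
(* Gives m - 2 n = k - 1: the first derivative of u_n is counted separately, so this allows [k]
   derivatives in all. *)
pose m := (k + 2 * n).-1.
have nm : (2 * n <= m)%N by rewrite /m; lia.
have mn : (m - 2 * n)%N = k.-1 by rewrite /m; lia.
have [C [q [C0 H]]] := @su_pder_bounded R d gamma m g0 n lam nm lg.
have [P HP] := poly_repr_power C q.
exists P => Xi p f fxi b R1 Rr phi y hA hlt hle hfl hp hpb hf hfb hS.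
have e1 : (k + 2 * n)%N = m.+1 by rewrite /m; lia.
have e2 : (k + 1 + 2 * n)%N = m.+2 by rewrite /m; lia.
have e3 : (k + 2 * n - 2)%N = m.-1 by rewrite /m; lia.
rewrite e2 in hf hfb *; rewrite e3 in hS *; rewrite e1 in hp hpb *.
pose a := Setting hA hlt hle hfl hp hpb hf hfb hS.
move=> t t0; split.
  move=> J j x Jk Bx.
  apply: (@su_pder_derivable R d gamma m g0 n a J j x t nm t0 _ Bx).
  by rewrite mn; lia.
move=> J x Jk Bx; rewrite HP -/(snorm a).
have Jm : (0 < size J <= (m - 2 * n).+1)%N by rewrite mn Jk; lia.
apply: (le_trans (H a J x t t0 Jm Bx)).
rewrite ler_wpM2l//; last by apply: etime_le => //; rewrite le_max lexx.
by rewrite mulr_ge0// exprn_ge0// (le_trans ler01 (snorm_ge1 a)).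
Qed.
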